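(* Let $X$ be a compact filtered space. Consider the open cone $\mathring{\mathtt c}X=X\times[0,\infty[\,/\,X\times\{0\}$, with apex $\mathtt w$, equipped with the conical filtration and a perversity $\overline p$. Denote also by $\overline p$ the perversity induced on $X$. Then, for any commutative ring $R$: (a) The inclusion $\iota\colon X\to\mathring{\mathtt c}X$, $x\mapsto[x,1]$, induces an isomorphism $\mathscr H^k_{\overline p}(\mathring{\mathtt c}X;R)\xrightarrow{\ \cong\ }\mathscr H^k_{\overline p}(X;R)$ for each $k\le\overline p(\mathtt w)$. (b) For each $k>\overline p(\mathtt w)$ one has $\mathscr H^k_{\overline p}(\mathring{\mathtt c}X;R)=0$.
   Context: Commutative rings have a unity. Filtered spaces. A filtered space is a Hausdorff space $X$ with a filtration by closed subspaces $\emptyset=X_{-1}\subseteq X_0\subseteq\dots\subseteq X_{n-1}\subsetneq X_n=X$; $n=\dim X$ is the formal dimension. Strata are the non-empty connected components of the $X_i\setminus X_{i-1}$; a stratum $S\subset X_i\setminus X_{i-1}$ has $\operatorname{codim}S=n-i$; it is regular if $\operatorname{codim}S=0$, singular otherwise. A perversity on $X$ is a map $\overline p$ from the set of strata to $\mathbb Z\cup\{\pm\infty\}$ with value $0$ on regular strata. The conical filtration on $\mathring{\mathtt c}X$ (formal dimension $n+1$) is $(\mathring{\mathtt c}X)_0=\{\mathtt w\}$, $(\mathring{\mathtt c}X)_i=\mathring{\mathtt c}X_{i-1}$ for $i\ge1$ (with $\mathring{\mathtt c}\emptyset=\{\mathtt w\}$); its strata are $\{\mathtt w\}$ and the $S\times]0,\infty[$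 with $S$ a stratum of $X$. One writes $\overline p(\mathtt w)$ for $\overline p(\{\mathtt w\})$; the induced perversity on $X$ is $\overline p(S)=\overline p(S\times]0,\infty[)$. Filtered simplices. A filtered singular simplex is a continuous map $\sigma\colon\Delta\to X$ from a euclidean simplex (with ordered vertices) with a join decomposition $\Delta=\Delta_0*\dots*\Delta_n$ (some $\Delta_i$ may be empty), compatible with the vertex order, such that $\sigma^{-1}(X_i)=\Delta_0*\dots*\Delta_i$ for all $i$. It is regular if $\Delta_n\neq\emptyset$. A regular face operator is the inclusion $\delta_\ell\colon\nabla\to\Delta$ of a codimension-one face with $\nabla_i=\nabla\cap\Delta_i$ and $\nabla_n\ne\emptyset$. Blow-up. For an ordered simplicial complex $K$, $N_*(K)$ is its simplicial chain complex over $R$, $N^*(K)=\operatorname{Hom}(N_*(K),R)$ with $(\delta f)(v)=-(-1)^{|f|}f(\partial v)$, and $\mathbf 1_F$ is the cochain equal to $1$ on the simplex $F$ and $0$ on the others. For a simplex $E$, $\mathtt cE=E*[\mathtt v]$ is the cone with apex $\mathtt v$ as last vertex ($\mathtt c\emptyset=[\mathtt v]$); its faces are written $(F,0)=F$ ($\emptyset\ne F$ a face of $E$) and $(F,1)=F*[\mathtt v]$ ($F$ a possibly empty face of $E$). Put $|(F,\varepsilon)|=\dim F+\varepsilon$, with $|(\emptyset,1)|=0$. For a regular simplex $\Delta$ put $\widetilde N^*(\Delta)=N^*(\mathtt c\Delta_0)\otimes\dots\otimes N^*(\mathtt c\Delta_{n-1})\otimes N^*(\Delta_n)$ with the tensor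 product differential and basis $\mathbf 1_{(F,\varepsilon)}=\mathbf 1_{(F_0,\varepsilon_0)}\otimes\dots\otimes\mathbf 1_{(F_{n-1},\varepsilon_{n-1})}\otimes\mathbf 1_{F_n}$ ($\varepsilon_n=0$, $F_n\neq\emptyset$). For $\ell\in\{1,\dots,n\}$, $\|\mathbf 1_{(F,\varepsilon)}\|_\ell=-\infty$ if $\varepsilon_{n-\ell}=1$ and $=\sum_{i>n-\ell}|(F_i,\varepsilon_i)|$ if $\varepsilon_{n-\ell}=0$; for a linear combination with non-zero coefficients take the maximum; $\|0\|_\ell=-\infty$. $\widetilde N^*(X;R)$ is the complex of families $\omega=(\omega_\sigma)_\sigma$ indexed by regular simplices $\sigma\colon\Delta\to X$, $\omega_\sigma\in\widetilde N^*(\Delta)$, with $\delta_\ell^*\omega_\sigma=\omega_{\sigma\circ\delta_\ell}$ for every regular face operator; $(\delta\omega)_\sigma=\delta(\omega_\sigma)$. For a singular stratum $S$, $\|\omega\|_S=\sup\{\|\omega_\sigma\|_{\operatorname{codim}S}: \sigma\text{ regular},\ \operatorname{im}\sigma\cap S\neq\emptyset\}$. $\omega$ is $\overline p$-allowable if $\|\omega\|_S\le\overline p(S)$ for all singular $S$. $\widetilde N^*_{\overline p}(X;R)$ is the complex of $\omega$ with $\omega,\delta\omega$ both $\overline p$-allowable; its cohomology is the blown-up intersection cohomology $\mathscr H^*_{\overline p}(X;R)$. Induced map. $(\iota^*\omega)_\tau=\omega_{\iota\circ\tau}$ for a regular simplex $\tau\colon\Delta_0*\dots*\Delta_n\to X$;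 here $\iota\circ\tau$ is a regular simplex of $\mathring{\mathtt c}X$ with decomposition $\emptyset*\Delta_0*\dots*\Delta_n$, and the extra tensor factor $N^*(\mathtt c\emptyset)=R\,\mathbf 1_{(\emptyset,1)}$ is identified with $R$. *)

(* Defs.v *)
(* [K : realType] plays the role of the real numbers; [R : comPzRingType] is an
   arbitrary commutative ring with unit, the zero ring included. *)
From HB Require Import structures.
From mathcomp Require Import all_boot all_order all_algebra.
From mathcomp Require Import all_classical all_reals all_analysis.

Set Implicit Arguments.
Unset Strict Implicit.
Unset Printing Implicit Defensive.

Import Order.TTheory GRing.Theory Num.Theory.
Import numFieldNormedType.Exports.

Local Open Scope classical_set_scope.
Local Open Scope ring_scope.
Local Open Scope quotient_scope.

(* [below F i] is F_{i-1}, with F_{-1} empty. *)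
Definition below (T : Type) (F : nat -> set T) (i : nat) : set T :=
  if i is j.+1 then F j else set0.

(* [skel i] is X_i and [fdim] is n; the filtration is continued by X_i = X for
   i > n, which adds no stratum. *)
Record filteredSpace := FilteredSpace {
  fcarrier :> topologicalType;
  fdim : nat;
  skel : nat -> set fcarrier;
  skel_closed : forall i, closed (skel i);
  skel_mono : forall i, skel i `<=` skel i.+1;
  skel_top : forall i, (fdim <= i)%N -> skel i = setT;
  skel_proper : below skel fdim <> setT;
  fcarrier_hausdorff : hausdorff_space fcarrier
}.
Arguments skel : clear implicits.

Definition layer (X : filteredSpace) (i : nat) : set X :=
  skel X i `\` below (skel X) i.
Arguments layer : clear implicits.

(* [stratum_dim] is redundant: a stratum is non-empty and the layers are
   pairwise disjoint. *)
Record stratum (X : filteredSpace) := Stratum {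
  stratum_set :> set X;
  stratum_dim : nat;
  stratumP : exists2 x, layer X stratum_dim x &
    stratum_set = connected_component (layer X stratum_dim) x
}.

Definition codim (X : filteredSpace) (S : stratum X) : nat :=
  fdim X - stratum_dim S.

Definition regular_stratum (X : filteredSpace) (S : stratum X) := codim S = 0%N.
Definition singular_stratum (X : filteredSpace) (S : stratum X) := codim S <> 0%N.

Record perversity (X : filteredSpace) := Perversity {
  perv_val :> stratum X -> \bar int;
  perv_regular : forall S, regular_stratum S -> perv_val S = 0%E
}.

Definition halfline (K : realType) : set K := [set t | 0 <= t].
Arguments halfline : clear implicits.

Section Cone.
Context (K : realType) (X : topologicalType).

(* The open cone is the quotient of X x [0,oo[ collapsing X x {0}. *)
Definition cone_rel_fun (a b : X * halfline K) : bool :=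
  (a == b) || ((val a.2 == 0) && (val b.2 == 0)).

Lemma cone_rel_refl : reflexive cone_rel_fun.
Proof. by move=> a; rewrite /cone_rel_fun eqxx. Qed.
Lemma cone_rel_sym : symmetric cone_rel_fun.
Proof. by move=> a b; rewrite /cone_rel_fun eq_sym [X in _ || X]andbC. Qed.
Lemma cone_rel_trans : transitive cone_rel_fun.
Proof.
move=> b a c /predU1P[-> //|/andP[a0 b0]] /predU1P[<-|/andP[_ c0]];
  by rewrite /cone_rel_fun a0 ?b0 ?c0 orbT.
Qed.

Definition cone_rel := EquivRel _ cone_rel_refl cone_rel_sym cone_rel_trans.

Definition cone := {eq_quot cone_rel}.
HB.instance Definition _ := Topological.copy cone (quotient_topology cone).
HB.instance Definition _ := Quotient.on cone.

Definition cone_pt (x : X) (t : halfline K) : cone := \pi_cone (x, t).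

Lemma halfline_mem (t : K) : 0 <= t -> t \in halfline K.
Proof. by move=> t0; apply/mem_set. Qed.
Definition halfline_pt (t : K) (t0 : 0 <= t) : halfline K := exist _ t (halfline_mem t0).

Lemma halfline_ge0 (t : halfline K) : 0 <= val t.
Proof. by case: t => t /= /set_mem. Qed.

Lemma cone_ptP (z : cone) : exists x t, z = cone_pt x t.
Proof. by exists (repr z).1, (repr z).2; rewrite /cone_pt -surjective_pairing reprK. Qed.

Lemma cone_pt_eq x s y t : (cone_pt x s = cone_pt y t) <->
  (x = y /\ s = t) \/ (val s = 0 /\ val t = 0).
Proof.
split=> [/eqmodP /orP[/eqP[-> ->]|/andP[/eqP ? /eqP ?]]|[[-> ->]|[s0 t0]]] //.
- by left.
- by right.
- by apply/eqmodP/orP; right; rewrite /= s0 t0 !eqxx.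
Qed.

Definition cone_ht (z : cone) : K := val (repr z).2.
Definition cone_pr (z : cone) : X := (repr z).1.

Lemma cone_htE x t : cone_ht (cone_pt x t) = val t.
Proof.
have := reprK (cone_pt x t); rewrite /cone_ht [repr _]surjective_pairing.
by move=> /cone_pt_eq[[_ ->]//|[-> ->]].
Qed.

Lemma cone_prE x t : 0 < val t -> cone_pr (cone_pt x t) = x.
Proof.
move=> t0; have := reprK (cone_pt x t); rewrite /cone_pr [repr _]surjective_pairing.
by move=> /cone_pt_eq[[-> _]//|[_ h]]; rewrite h ltxx in t0.
Qed.

Lemma cone_openE (U : set cone) :
  open U <-> open [set a : X * halfline K | U (cone_pt a.1 a.2)].
Proof.
have -> : [set a : X * halfline K | U (cone_pt a.1 a.2)] = \pi_cone @^-1` U.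
  by apply/seteqP; split=> -[x t].
by [].
Qed.

Lemma halfline_snd_continuous : continuous (fun a : X * halfline K => val a.2).
Proof.
move=> a; apply: (@continuous_comp _ (halfline K) K snd val); first exact: cvg_snd.
exact: initial_continuous.
Qed.

Lemma cone_ht_continuous : continuous cone_ht.
Proof.
apply/continuousP => A oA; apply/cone_openE.
rewrite (_ : [set _ | _] = [set a : X * halfline K | A (val a.2)]); last first.
  by apply/seteqP; split=> -[x t] /=; rewrite cone_htE.
move: A oA; apply/continuousP => a.
exact: halfline_snd_continuous.
Qed.

Lemma cone_ht_ge0 z : 0 <= cone_ht z. Proof. exact: halfline_ge0. Qed.

Lemma cone_pr_open (U : set X) : open U ->
  open [set z | 0 < cone_ht z /\ U (cone_pr z)].
Proof.
move=> oU; apply/cone_openE.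
rewrite (_ : [set _ | _] = [set a : X * halfline K | 0 < val a.2] `&` (fst @^-1` U)).
  apply: openI.
    have oP : open [set t : K | 0 < t] by exact: open_gt.
    have /continuousP h := halfline_snd_continuous.
    exact: h _ oP.
  move: U oU; apply/continuousP => a; exact: cvg_fst.
apply/seteqP; split=> -[x t] /=; rewrite cone_htE => -[t0]; by rewrite cone_prE.
Qed.

Lemma cone_hausdorff : hausdorff_space X -> hausdorff_space cone.
Proof.
move=> hX; rewrite open_hausdorff => z z' zz'.
have [hh|hh] := eqVneq (cone_ht z) (cone_ht z').
  have [x [s zE]] := cone_ptP z; have [y [t z'E]] := cone_ptP z'.
  move: hh zz'; rewrite zE z'E !cone_htE => /val_inj st; rewrite {}st in zE *.
  have [t0|t0] := eqVneq (val t) 0.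
    by case/eqP; apply/cone_pt_eq; right.
  have {}t0 : 0 < val t by rewrite lt_neqAle eq_sym t0 halfline_ge0.
  have [->|xy _] := eqVneq x y; first by rewrite eqxx.
  move: hX; rewrite open_hausdorff => /(_ _ _ xy) [[A B] /= [xA yB] [oA oB /eqP AB]].
  exists ([set z | 0 < cone_ht z /\ A (cone_pr z)],
          [set z | 0 < cone_ht z /\ B (cone_pr z)]).
    by rewrite !inE /= !cone_htE !cone_prE //; rewrite !inE in xA yB.
  split; [exact: cone_pr_open|exact: cone_pr_open|].
  by apply/eqP/seteqP; split=> // w /= [[_ wA] [_ wB]]; have : (A `&` B) (cone_pr w) by []; rewrite AB.
have := @Rhausdorff K; rewrite open_hausdorff => /(_ _ _ hh).
move=> [[A B] /= [xA yB] [oA oB /eqP AB]].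
exists (cone_ht @^-1` A, cone_ht @^-1` B).
  by move: xA yB; rewrite !inE.
split; [| |].
- by have /continuousP h := cone_ht_continuous; exact: h.
- by have /continuousP h := cone_ht_continuous; exact: h.
- by apply/eqP/seteqP; split=> // w /= [wA wB]; have : (A `&` B) (cone_ht w) by []; rewrite AB.
Qed.

(* The open cone of A inside the open cone of X: it always contains the apex, so
   that the cone of the empty set is the apex. *)
Definition subcone (A : set X) : set cone :=
  [set cone_pt a.1 a.2 | a in [set a : X * halfline K | val a.2 = 0 \/ A a.1]].

(* A x ]0,oo[ *)
Definition cyl (A : set X) : set cone :=
  [set cone_pt a.1 a.2 | a in [set a : X * halfline K | 0 < val a.2 /\ A a.1]].

Lemma subconeE A x t : subcone A (cone_pt x t) <-> (val t = 0 \/ A x).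
Proof.
split=> [[[y s] /= h /cone_pt_eq[[<- <-]//|[_ ->]]]|h]; first by left.
by exists (x, t).
Qed.

Lemma cylE A x t : cyl A (cone_pt x t) <-> (0 < val t /\ A x).
Proof.
split=> [[[y s] /= h /cone_pt_eq[[<- <-]//|[s0 ->]]]|h]; last by exists (x, t).
by rewrite s0 ltxx in h; case: h.
Qed.

Lemma subcone_closed A : closed A -> closed (subcone A).
Proof.
move=> cA; rewrite -[subcone A]setCK; apply: open_closedC.
rewrite (_ : ~` _ = [set z | 0 < cone_ht z /\ (~` A) (cone_pr z)]).
  by apply: cone_pr_open; exact: closed_openC.
apply/seteqP; split=> z; have [x [t ->]] := cone_ptP z => /=.
  move=> /subconeE/not_orP[/eqP t0 Ax]; rewrite cone_htE.
  have {}t0 : 0 < val t by rewrite lt_neqAle eq_sym t0 halfline_ge0.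
  by rewrite cone_prE.
rewrite cone_htE => -[t0]; rewrite cone_prE // => Ax /subconeE[t1|//].
by rewrite t1 ltxx in t0.
Qed.

Lemma subcone_sub A B : A `<=` B -> subcone A `<=` subcone B.
Proof. by move=> AB z; have [x [t ->]] := cone_ptP z => /subconeE[?|/AB ?]; apply/subconeE; [left|right]. Qed.

Lemma cylD A B : subcone A `\` subcone B = cyl (A `\` B).
Proof.
apply/seteqP; split=> z; have [x [t ->]] := cone_ptP z.
  move=> [/subconeE hA /subconeE/not_orP[/eqP t0 Bx]]; apply/cylE.
  have {}t0 : 0 < val t by rewrite lt_neqAle eq_sym t0 halfline_ge0.
  by split => //; split => //; case: hA => // h; rewrite h ltxx in t0.
move=> /cylE[t0 [Ax Bx]]; split; first by apply/subconeE; right.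
by move=> /subconeE[h|//]; rewrite h ltxx in t0.
Qed.

Lemma cone_pt_continuousl t : continuous (cone_pt^~ t).
Proof.
move=> x; apply: (@continuous_comp X (X * halfline K)%type cone (fun x => (x, t)) \pi_cone).
  by apply: (@cvg_pair _ _ _ _ (nbhs x) (nbhs t)) => /=; [exact: cvg_id|exact: cvg_cst].
exact: pi_continuous.
Qed.

Lemma cone_ray_continuous x : continuous (fun t : K => cone_pt x (halfline_pt (normr_ge0 t))).
Proof.
move=> t; apply: (@continuous_comp K (X * halfline K)%type cone
    (fun t => (x, halfline_pt (normr_ge0 t))) \pi_cone).
  apply: (@cvg_pair _ _ _ _ (nbhs x) (nbhs (halfline_pt (normr_ge0 t)))) => /=.
    exact: cvg_cst.
  move: t; apply: (@continuous_comp_initial _ K K (val : halfline K -> K)).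
  exact: norm_continuous.
exact: pi_continuous.
Qed.

Lemma cyl_connected A : connected A -> connected (cyl A).
Proof.
move=> cA; have [->|/set0P[x0 Ax0]] := eqVneq A set0.
  rewrite (_ : cyl _ = set0); first exact: connected0.
  by apply/seteqP; split=> // z; have [x [t ->]] := cone_ptP z => /cylE[].
pose one := halfline_pt (@ler01 K).
pose slice := (cone_pt^~ one) @` A.
pose ray x := (fun t : K => cone_pt x (halfline_pt (normr_ge0 t))) @` [set t | 0 < t].
have cslice : connected slice.
  apply: connected_continuous_connected => //.
  by apply: continuous_subspaceT; exact: cone_pt_continuousl.
have cray x : connected (ray x).
  apply: connected_continuous_connected.
    apply/connected_intervalP => a b /= a0 b0 c /andP[ac _].
    exact: lt_le_trans ac.
  by apply: continuous_subspaceT; exact: cone_ray_continuous.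
have oneP x : ray x (cone_pt x one).
  exists 1 => //=; congr cone_pt; apply: val_inj; exact: normr1.
rewrite (_ : cyl A = \bigcup_(x in A) (slice `|` ray x)).
  apply: bigcup_connected.
    by exists (cone_pt x0 one) => x Ax; left; exists x0.
  move=> x Ax; apply: connectedU => //.
  by exists (cone_pt x one); split; [exists x|exact: oneP].
apply/seteqP; split=> z.
  have [x [t ->]] := cone_ptP z => /cylE[t0 Ax]; exists x => //; right.
  exists (val t) => //; congr cone_pt; apply: val_inj => /=; exact: gtr0_norm.
move=> [x Ax [[y Ay <-]|[t /= t0 <-]]]; apply/cylE; split => //=.
by rewrite normr_gt0 gt_eqF.
Qed.

Lemma cyl_component A x t : 0 < val t -> A x ->
  cyl (connected_component A x) = connected_component (cyl A) (cone_pt x t).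
Proof.
move=> t0 Ax; apply/seteqP; split.
  apply: connected_component_max.
  - by apply/cylE; split=> //; exact: connected_component_refl.
  - move=> z; have [y [s ->]] := cone_ptP z => /cylE[s0 /connected_component_sub Ay].
    exact/cylE.
  - exact/cyl_connected/component_connected.
move=> z [D [Dxt DA cD] Dz].
have Dht w : D w -> 0 < cone_ht w.
  by move=> /DA; have [y [s ->]] := cone_ptP w; rewrite cone_htE => /cylE[].
have cpr : {within D, continuous cone_pr}.
  apply: continuous_in_subspaceT => w /set_mem Dw U.
  rewrite nbhsE => -[V [oV Vw VU]].
  have : nbhs w [set z | 0 < cone_ht z /\ V (cone_pr z)].
    by apply: open_nbhs_nbhs; split; [exact: cone_pr_open|split=> //; exact: Dht].
  by apply: filterS => v /= [_ /VU].
have cprD := connected_continuous_connected cD cpr.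
have [y [s zE]] := cone_ptP z; rewrite zE in Dz *.
have s0 : 0 < val s by have := Dht _ Dz; rewrite cone_htE.
apply/cylE; split=> //; exists (cone_pr @` D); last by exists (cone_pt y s); rewrite ?cone_prE.
split=> //; first by exists (cone_pt x t); rewrite ?cone_prE.
move=> _ [w Dw <-]; have := DA _ Dw; have := Dht _ Dw.
by have [u [r ->]] := cone_ptP w; rewrite cone_htE => r0 /cylE[_]; rewrite cone_prE.
Qed.

End Cone.

Lemma fspace_inhabited (X : filteredSpace) : exists x : X, True.
Proof.
apply: contrapT => /forallNP X0; apply: (@skel_proper X).
by apply/seteqP; split=> // x; have := X0 x.
Qed.

Section FilteredCone.
Context (K : realType) (X : filteredSpace).

(* (cX)_0 = {w} and (cX)_{i+1} = c(X_i). *)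
Definition cone_skel (i : nat) : set (cone K X) := subcone (below (skel X) i).

Lemma below_closed i : closed (below (skel X) i).
Proof. by case: i => [|i]; [exact: closed0|exact: skel_closed]. Qed.

Lemma cone_skel_closed i : closed (cone_skel i).
Proof. exact/subcone_closed/below_closed. Qed.

Lemma below_mono i : below (skel X) i `<=` below (skel X) i.+1.
Proof. by case: i => [|i] //; exact: skel_mono. Qed.

Lemma cone_skel_mono i : cone_skel i `<=` cone_skel i.+1.
Proof. exact/subcone_sub/below_mono. Qed.

Lemma cone_skel_top i : ((fdim X).+1 <= i)%N -> cone_skel i = setT.
Proof.
case: i => // i ni; apply/seteqP; split=> // z _; have [x [t ->]] := cone_ptP z.
by apply/subconeE; right; rewrite /= skel_top.
Qed.

Definition halfline1 : halfline K := halfline_pt ler01.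

Lemma halfline1_gt0 : 0 < val halfline1. Proof. exact: ltr01. Qed.

Lemma cone_skel_proper : below cone_skel (fdim X).+1 <> setT.
Proof.
move=> /seteqP[_ h]; apply: (@skel_proper X); apply/seteqP; split=> // x _.
have /subconeE[h1|//] := h (cone_pt x halfline1) I.
by have := halfline1_gt0; rewrite h1 ltxx.
Qed.

Definition open_cone : filteredSpace :=
  @FilteredSpace (cone K X) (fdim X).+1 cone_skel cone_skel_closed cone_skel_mono
    cone_skel_top cone_skel_proper (cone_hausdorff (@fcarrier_hausdorff X)).

(* The class [x, 0], which does not depend on x (lemma [apexE]); X is non-empty
   since X_{n-1} is a proper subset. *)
Definition apex : open_cone := cone_pt (sval (cid (fspace_inhabited X))) (halfline_pt (lexx (0 : K))).

Lemma apexE x t : apex = cone_pt x t <-> val t = 0.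
Proof.
split=> [/cone_pt_eq[[_ <-]|[]]//|t0]; by apply/cone_pt_eq; right.
Qed.

Lemma cone_layer i : layer open_cone i.+1 = cyl (layer X i).
Proof. by rewrite /layer /= cylD. Qed.

Lemma cone_layer0 : layer open_cone 0 = [set apex].
Proof.
rewrite /layer setD0; apply/seteqP; split=> z /=.
  have [x [t ->]] := cone_ptP z => /subconeE[t0|//]; exact/esym/apexE.
by move=> ->; apply/subconeE; left.
Qed.

Lemma apex_stratumP : exists2 x, layer open_cone 0 x &
  [set apex] = connected_component (layer open_cone 0) x.
Proof.
exists apex; rewrite cone_layer0 // connected_component_id //.
exact: connected1.
Qed.

Definition apex_stratum : stratum open_cone := Stratum apex_stratumP.

Lemma cyl_stratumP (S : stratum X) : exists2 x, layer open_cone (stratum_dim S).+1 x &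
  cyl S = connected_component (layer open_cone (stratum_dim S).+1) x.
Proof.
have [x Lx SE] := stratumP S; exists (cone_pt x halfline1); rewrite cone_layer.
  by apply/cylE; split=> //; exact: halfline1_gt0.
by rewrite SE; apply: cyl_component => //; exact: halfline1_gt0.
Qed.

Definition cyl_stratum (S : stratum X) : stratum open_cone := Stratum (cyl_stratumP S).

Lemma cyl_codim (S : stratum X) : codim (cyl_stratum S) = codim S.
Proof. by rewrite /codim /= subSS. Qed.

Lemma induced_perversity_regular (p : perversity open_cone) (S : stratum X) :
  regular_stratum S -> p (cyl_stratum S) = 0%E.
Proof. by move=> rS; apply: perv_regular; rewrite /regular_stratum cyl_codim. Qed.

Definition induced_perversity (p : perversity open_cone) : perversity X :=
  Perversity (@induced_perversity_regular p).

Definition iota (x : X) : open_cone := cone_pt x halfline1.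

Lemma iota_continuous : continuous iota.
Proof. exact: cone_pt_continuousl. Qed.

End FilteredCone.

Definition stdsimplex (K : realType) (m : nat) : set 'rV[K]_m.+1 :=
  [set t | (forall i, 0 <= t ord0 i) /\ \sum_i t ord0 i = 1].
Arguments stdsimplex : clear implicits.

Section Face.
Context (K : realType) (m : nat) (l : 'I_m.+2).

(* The face of the standard simplex opposite to the vertex l, parametrized by
   the standard simplex through the order-preserving bijection of vertices. *)
Definition face_row (t : 'rV[K]_m.+1) : 'rV[K]_m.+2 :=
  \row_j oapp (fun i => t ord0 i) 0 (unlift l j).

Lemma face_row_lift t i : face_row t ord0 (lift l i) = t ord0 i.
Proof. by rewrite mxE liftK. Qed.

Lemma face_row_l t : face_row t ord0 l = 0.
Proof. by rewrite mxE unlift_none. Qed.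

Lemma face_mapP (t : stdsimplex K m) : face_row (val t) \in stdsimplex K m.+1.
Proof.
case: t => t /= /set_mem[t0 t1]; apply/mem_set; split.
  by move=> j; case: (unliftP l j) => [i|] ->; rewrite ?face_row_lift ?face_row_l.
rewrite (bigD1_ord l) //= face_row_l add0r -t1.
by apply: eq_bigr => i _; rewrite face_row_lift.
Qed.

Definition face_map (t : stdsimplex K m) : stdsimplex K m.+1 :=
  exist _ (face_row (val t)) (face_mapP t).

Lemma face_row_continuous : continuous face_row.
Proof.
move=> t A [P tP PA]; exists (fun _ k => P ord0 (lift l k)).
  by move=> i k; rewrite (ord1 i) -face_row_lift; exact: tP.
move=> s sP; apply: PA => i j; rewrite !ord1.
case: (unliftP l j) => [k ->|->]; first by rewrite face_row_lift; exact: sP.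
by rewrite face_row_l; have := nbhs_singleton (tP ord0 l); rewrite face_row_l.
Qed.

Lemma face_map_continuous : continuous face_map.
Proof.
apply: (@continuous_comp_initial _ (stdsimplex K m) _ (val : stdsimplex K m.+1 -> _)).
move=> t; apply: (@continuous_comp (stdsimplex K m) _ _ val face_row).
  exact: initial_continuous.
exact: face_row_continuous.
Qed.

End Face.

Section Simplices.
Context (K : realType) (X : filteredSpace).

(* A filtered singular simplex on the standard m-simplex.  The join decomposition
   Delta_0 * ... * Delta_n is given by [lvl]: the vertex v lies in Delta_i iff
   [lvl v = i], so that Delta_0 * ... * Delta_i is the set of points whose
   barycentric coordinates vanish at every vertex of level > i.  Being
   compatible with the order of the vertices means that [lvl] is monotone. *)
Record fsimplex (m : nat) := FSimplex {
  smap :> stdsimplex K m -> X;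
  lvl : 'I_m.+1 -> 'I_(fdim X).+1;
  smap_continuous : continuous smap;
  lvl_mono : {homo lvl : u v / (u <= v)%N};
  smap_skel : forall (i : nat) (t : stdsimplex K m), (i <= fdim X)%N ->
    skel X i (smap t) <-> (forall v, val t ord0 v != 0 -> (lvl v <= i)%N)
}.

Definition regular_simplex m (s : fsimplex m) : Prop :=
  exists v, lvl s v = ord_max.

Record rsimplex (m : nat) := RSimplex {
  rsimplex_val :> fsimplex m;
  rsimplexP : regular_simplex rsimplex_val
}.

Section FaceSimplex.
Context (m : nat) (s : fsimplex m.+1) (l : 'I_m.+2).

Let fmap (t : stdsimplex K m) : X := s (face_map l t).
Let flvl (v : 'I_m.+1) := lvl s (lift l v).

Lemma face_continuous : continuous fmap.
Proof.
move=> t; apply: (@continuous_comp _ _ _ (face_map l) s).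
  exact: face_map_continuous.
exact: smap_continuous.
Qed.

Lemma face_lvl_mono : {homo flvl : u v / (u <= v)%N}.
Proof. by move=> u v uv; apply: lvl_mono; rewrite leq_bump2. Qed.

Lemma face_skel (i : nat) (t : stdsimplex K m) : (i <= fdim X)%N ->
  skel X i (fmap t) <-> (forall v, val t ord0 v != 0 -> (flvl v <= i)%N).
Proof.
move=> iX; rewrite /fmap smap_skel //; split=> h v.
  by move=> v0; apply: h; rewrite /= face_row_lift.
case: (unliftP l v) => [k|] ->; rewrite /= ?face_row_lift; first exact: h.
by rewrite face_row_l eqxx.
Qed.

Definition face : fsimplex m := FSimplex face_continuous face_lvl_mono face_skel.

End FaceSimplex.

Definition rface m (s : rsimplex m.+1) l (h : regular_simplex (face s l)) :
  rsimplex m := RSimplex h.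

End Simplices.

Section IotaSimplex.
Context (K : realType) (X : filteredSpace) (m : nat).

Section Fsimplex.
Variable s : fsimplex K X m.

Let imap (t : stdsimplex K m) : open_cone K X := iota K (s t).
Let ilvl (v : 'I_m.+1) : 'I_(fdim (open_cone K X)).+1 := lift ord0 (lvl s v).

Lemma iota_simplex_continuous : continuous imap.
Proof.
move=> t; apply: (@continuous_comp _ _ _ s (@iota K X)).
  exact: smap_continuous.
exact: iota_continuous.
Qed.

Lemma iota_lvl_mono : {homo ilvl : u v / (u <= v)%N}.
Proof. by move=> u v uv; rewrite !lift0 ltnS; apply: lvl_mono. Qed.

Lemma stdsimplex_neq0 (t : stdsimplex K m) : exists v, val t ord0 v != 0.
Proof.
case: t => t /= /set_mem[_ t1]; apply: contrapT => /forallNP h.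
move: t1; rewrite big1 ?(eqP _) => [/eqP|i _]; first by rewrite eq_sym oner_eq0.
by apply/eqP; have /negP := h i; rewrite negbK.
Qed.

Lemma iota_skel (i : nat) (t : stdsimplex K m) : (i <= (fdim X).+1)%N ->
  skel (open_cone K X) i (imap t) <->
  (forall v, val t ord0 v != 0 -> (ilvl v <= i)%N).
Proof.
move=> iX; rewrite /imap /iota /= /cone_skel subconeE.
have h1 : ~ (val (halfline1 K) = 0) by move=> h; have := halfline1_gt0 K; rewrite h ltxx.
case: i iX => [_|i iX] /=.
  split=> [[]//|h]; have [v /h] := stdsimplex_neq0 t.
  by rewrite leqn0.
split=> [[//|/smap_skel h] v v0|h]; first exact: h v v0.
by right; apply/smap_skel => // v /h.
Qed.

Definition iota_fsimplex : fsimplex K (open_cone K X) m :=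
  @FSimplex K (open_cone K X) m imap ilvl
    iota_simplex_continuous iota_lvl_mono iota_skel.

End Fsimplex.

Lemma iota_regular (s : rsimplex K X m) : regular_simplex (iota_fsimplex s).
Proof.
have [v sv] := rsimplexP s; exists v; apply: val_inj => /=.
by rewrite sv.
Qed.

Definition iota_simplex (s : rsimplex K X m) : rsimplex K (open_cone K X) m :=
  RSimplex (iota_regular s).

End IotaSimplex.

(* The blown-up complex N^*(c Delta_0) (x) ... (x) N^*(c Delta_{n-1}) (x) N^*(Delta_n)
   of a simplex with m+1 vertices and level function [lv].

   A vertex of one of the n+1 factors is either [inl v], a vertex of Delta, or
   [inr i] with i < n, the apex of the cone c Delta_i; [blk] gives the factor in
   which it lies.  A basis element 1_{(F_0,e_0)} (x) ... (x) 1_{F_n} is encoded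
   by the set b of all the vertices of (F_0,e_0), ..., F_n: F_i consists of the
   vertices of level i in b, and e_i = 1 iff [inr i \in b].  The i-th component
   [factor b i] has to be a simplex, i.e. non-empty, for each i; as there is no
   [inr n], this makes F_n non-empty. *)
Section Cells.
Context (m n : nat) (lv : 'I_m.+1 -> 'I_n.+1).

Definition bvert : Type := ('I_m.+1 + 'I_n)%type.
HB.instance Definition _ := Finite.on bvert.

Definition blk (x : bvert) : 'I_n.+1 :=
  match x with inl v => lv v | inr i => widen_ord (leqnSn n) i end.

(* Only used inside one factor, where the apex is the last vertex. *)
Definition vlt (x y : bvert) : bool :=
  match x, y with
  | inl u, inl v => (u < v)%N
  | inl _, inr _ => true
  | inr _, _ => false
  end.

Definition factor (b : {set bvert}) (i : 'I_n.+1) : {set bvert} :=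
  [set x in b | blk x == i].

Definition is_cell (b : {set bvert}) : bool := [forall i, factor b i != finset.set0].

Definition cell : Type := {b : {set bvert} | is_cell b}.
HB.instance Definition _ := SubFinite.on cell.

(* |(F_i, e_i)| = dim F_i + e_i, and the total degree. *)
Definition fdeg (b : {set bvert}) (i : 'I_n.+1) : nat := #|factor b i|.-1.
Definition cdeg (b : cell) : nat := \sum_(i < n.+1) fdeg (val b) i.

(* The rank of x among the vertices of the factor of b containing x. *)
Definition vpos (b : {set bvert}) (x : bvert) : nat :=
  #|[set y in factor b (blk x) | vlt y x]|.

(* ||1_b||_l, for l in {1, ..., n}. *)
Definition cnorm (l : nat) (b : cell) : \bar int :=
  if [exists i : 'I_n, (nat_of_ord i == n - l)%N && (inr i \in val b)]
  then -oo%E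
  else ((\sum_(i < n.+1 | (n - l < i)%N) fdeg (val b) i)%N%:Z)%:E.

Section Cochains.
Context (R : comPzRingType).

(* A cochain is given by its coordinates in the basis of the cells. *)
Definition blowup : Type := {ffun cell -> R^o}.
HB.instance Definition _ := GRing.Lmodule.on blowup.

(* The coordinate of w on b, read as 0 when b is not a cell: the latter occurs in
   [dfactor] when the boundary of a vertex is taken. *)
Definition coef0 (w : blowup) (b : {set bvert}) : R :=
  if insub b is Some c then w c else 0.

(* The coordinate on b of (1 (x) ... (x) delta (x) ... (x) 1) w, with delta in the
   i-th place and without the Koszul sign: by (delta f)(v) = -(-1)^|f| f(d v)
   with |f| = |b_i| - 1, and d v is the alternating sum of the faces of v = b_i. *)
Definition dfactor (w : blowup) (b : {set bvert}) (i : 'I_n.+1) : R :=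
  - (-1) ^+ (fdeg b i).-1 *
  \sum_(x in factor b i) (-1) ^+ vpos b x * coef0 w (b :\ x)%SET.

(* The tensor product differential, with the Koszul sign (-1)^(|b_0|+...+|b_{i-1}|)
   in front of the i-th term. *)
Definition cobord (w : blowup) : blowup :=
  [ffun b : cell => \sum_(i < n.+1)
     (-1) ^+ (\sum_(j < n.+1 | (j < i)%N) fdeg (val b) j) * dfactor w (val b) i].

Definition blowup_norm (l : nat) (w : blowup) : \bar int :=
  \big[Order.max/-oo%E]_(b | w b != 0) cnorm l b.

Lemma coef0D w w' b : coef0 (w + w') b = coef0 w b + coef0 w' b.
Proof. by rewrite /coef0; case: insub => [c|]; rewrite ?ffunE ?addr0. Qed.

Lemma coef0Z a w b : coef0 (a *: w) b = a * coef0 w b.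
Proof. by rewrite /coef0; case: insub => [c|]; rewrite ?ffunE ?mulr0. Qed.

Lemma dfactorD w w' b i : dfactor (w + w') b i = dfactor w b i + dfactor w' b i.
Proof.
rewrite /dfactor -mulrDr -big_split /=; congr (_ * _); apply: eq_bigr => x _.
by rewrite coef0D mulrDr.
Qed.

Lemma dfactorZ a w b i : dfactor (a *: w) b i = a * dfactor w b i.
Proof.
rewrite /dfactor mulrCA; congr (_ * _); rewrite mulr_sumr; apply: eq_bigr => x _.
by rewrite coef0Z mulrCA.
Qed.

Lemma cobord_linear a w w' : cobord (a *: w + w') = a *: cobord w + cobord w'.
Proof.
apply/ffunP => b; rewrite !ffunE scaler_sumr -big_split; apply: eq_bigr => i _ /=.
by rewrite dfactorD dfactorZ mulrDr; congr (_ + _); rewrite mulrCA.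
Qed.

Lemma blowup_norm_leP l w (y : \bar int) :
  (blowup_norm l w <= y)%O <-> forall b, w b != 0 -> (cnorm l b <= y)%O.
Proof.
rewrite /blowup_norm; split=> [h b wb|h].
  by apply: le_trans h; rewrite (bigD1 b) //= le_max lexx.
by elim/big_ind: _ => // [|x z hx hz]; rewrite ?leNye // ge_max hx.
Qed.

End Cochains.
End Cells.

Section FaceCell.
Context (m n : nat) (lv : 'I_m.+2 -> 'I_n.+1) (l : 'I_m.+2).

Definition face_vert (x : bvert m n) : bvert m.+1 n :=
  match x with inl v => inl (lift l v) | inr i => inr i end.

Lemma face_cellP (b : cell (fun v => lv (lift l v))) :
  is_cell lv (face_vert @: val b)%SET.
Proof.
apply/forallP => i; have /forallP/(_ i)/set0Pn[x] := valP b.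
rewrite inE => /andP[xb /eqP xi]; apply/set0Pn; exists (face_vert x).
by rewrite inE imset_f //= -xi; case: (x).
Qed.

Definition face_cell (b : cell (fun v => lv (lift l v))) : cell lv :=
  Sub _ (face_cellP b).

(* The factor-wise restriction of cochains to a face: 1_b is sent to itself if b
   lies in the face, and to 0 otherwise. *)
Definition face_pull (R : comPzRingType) (w : blowup lv R) :
    blowup (fun v => lv (lift l v)) R :=
  [ffun b => w (face_cell b)].

Lemma face_pull_linear (R : comPzRingType) a (w w' : blowup lv R) :
  face_pull (a *: w + w') = a *: face_pull w + face_pull w'.
Proof. by apply/ffunP => b; rewrite !ffunE. Qed.

End FaceCell.

Section IotaCell.
Context (m n : nat) (lv : 'I_m.+1 -> 'I_n.+1).
Let lv' (v : 'I_m.+1) : 'I_n.+2 := lift ord0 (lv v).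

Definition iota_vert (x : bvert m n) : bvert m n.+1 :=
  match x with inl v => inl v | inr i => inr (lift ord0 i) end.

Lemma iota_vert_inj : injective iota_vert.
Proof.
move=> [u|i] [v|j] //= => [[->]//|ij]; congr inr; apply: (@lift_inj _ ord0).
by apply: (inr_inj ij).
Qed.

Lemma blk_iota x : blk lv' (iota_vert x) = lift ord0 (blk lv x).
Proof. by case: x => [v|i] //; apply: val_inj. Qed.

Lemma vlt_iota x y : vlt (iota_vert x) (iota_vert y) = vlt x y.
Proof. by case: x => [u|i]; case: y => [v|j]. Qed.

(* The cells of emptyset * Delta_0 * ... * Delta_n are those of
   Delta_0 * ... * Delta_n with the levels shifted and the apex of c emptyset
   added.  Hence [iota_pull] below is the identification of the extra tensor
   factor N^*(c emptyset) with R. *)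
Definition iota_set (b : {set bvert m n}) : {set bvert m n.+1} :=
  (inr ord0 |: iota_vert @: b)%SET.

Lemma iota_vert_neq x : iota_vert x != inr ord0.
Proof. by case: x. Qed.

Lemma mem_iota_set x b : (iota_vert x \in iota_set b) = (x \in b).
Proof.
by rewrite in_setU1 (negPf (iota_vert_neq x)) mem_imset //; exact: iota_vert_inj.
Qed.

Lemma factor_iota0 b : factor lv' (iota_set b) ord0 = [set inr ord0]%SET.
Proof.
apply/setP => y; rewrite !inE; apply/andP/eqP => [[]|->].
  by case/predU1P => // /imsetP[x _ ->]; rewrite blk_iota.
by rewrite eqxx /=; split=> //; apply/eqP/val_inj.
Qed.

Lemma factor_iota b i :
  factor lv' (iota_set b) (lift ord0 i) = (iota_vert @: factor lv b i)%SET.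
Proof.
apply/setP => y; rewrite inE; apply/andP/imsetP => [[]|[x xb ->]].
  rewrite in_setU1 => /predU1P[->|/imsetP[x xb ->]].
    by move=> /eqP/(congr1 val).
  by rewrite blk_iota (inj_eq lift_inj) => xi; exists x => //; rewrite inE xb.
by move: xb; rewrite inE mem_iota_set blk_iota (inj_eq lift_inj) => /andP.
Qed.

Lemma is_cell_iota b : is_cell lv' (iota_set b) = is_cell lv b.
Proof.
apply/forallP/forallP => h i.
  by have := h (lift ord0 i); rewrite factor_iota imset_eq0.
case: (unliftP ord0 i) => [j|] ->; last first.
  by rewrite factor_iota0; apply/set0Pn; exists (inr ord0); rewrite inE.
by rewrite factor_iota imset_eq0.
Qed.

Lemma iota_cellP (b : cell lv) : is_cell lv' (iota_set (val b)).
Proof. by rewrite is_cell_iota; exact: valP. Qed.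

Definition iota_cell (b : cell lv) : cell lv' := Sub _ (iota_cellP b).

Lemma fdeg_iota0 b : fdeg lv' (iota_set b) ord0 = 0%N.
Proof. by rewrite /fdeg factor_iota0 cards1. Qed.

Lemma fdeg_iota b i : fdeg lv' (iota_set b) (lift ord0 i) = fdeg lv b i.
Proof. by rewrite /fdeg factor_iota card_imset //; exact: iota_vert_inj. Qed.

Lemma cdeg_iota b : cdeg (iota_cell b) = cdeg b.
Proof.
rewrite /cdeg big_ord_recl fdeg_iota0 add0n; apply: eq_bigr => i _.
exact: fdeg_iota.
Qed.

Lemma vpos_iota b x : vpos lv' (iota_set b) (iota_vert x) = vpos lv b x.
Proof.
rewrite /vpos blk_iota factor_iota -(card_imset _ iota_vert_inj).
congr #|pred_of_set _|; apply/setP => y; rewrite inE; apply/andP/imsetP.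
  by move=> [/imsetP[z zb ->]]; rewrite vlt_iota => zx; exists z => //; rewrite inE zb.
by move=> [z]; rewrite inE => /andP[zb zx] ->; rewrite vlt_iota imset_f.
Qed.

Lemma cnorm_iota l b : (0 < l <= n)%N -> cnorm l (iota_cell b) = cnorm l b.
Proof.
move=> /andP[l0 ln]; rewrite /cnorm subSn //.
have -> : [exists i : 'I_n.+1, (nat_of_ord i == (n - l).+1) && (inr i \in val (iota_cell b))]
   = [exists i : 'I_n, (nat_of_ord i == (n - l)%N) && (inr i \in val b)].
  apply/existsP/existsP => -[i /andP[/eqP il ib]].
    have := il; case: (unliftP ord0 i) => [j|] ij; rewrite ij // lift0 => -[jl].
    by exists j; rewrite jl eqxx; rewrite ij -(mem_iota_set (inr j)) /= in ib *.
  by exists (lift ord0 i); rewrite lift0 il eqxx /=; rewrite -(mem_iota_set (inr i)) in ib.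
case: ifP => // _; congr (_%:Z%:E)%E.
rewrite big_mkcond big_ord_recl /= add0n [RHS]big_mkcond; apply: eq_bigr => i _.
by rewrite /bump /= add1n ltnS fdeg_iota.
Qed.

Context (R : comPzRingType).

Definition iota_pull (w : blowup lv' R) : blowup lv R :=
  [ffun b => w (iota_cell b)].

Lemma iota_pull_linear a (w w' : blowup lv' R) :
  iota_pull (a *: w + w') = a *: iota_pull w + iota_pull w'.
Proof. by apply/ffunP => b; rewrite !ffunE. Qed.

Lemma coef0_iota w b : coef0 w (iota_set b) = coef0 (iota_pull w) b.
Proof.
rewrite /coef0; case: insubP => [c _ cE|].
  have cb : is_cell lv b by rewrite -is_cell_iota -cE; exact: valP.
  by rewrite (insubT (is_cell lv) cb) ffunE; congr (w _); apply: val_inj; rewrite /= cE.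
by rewrite is_cell_iota => cb; rewrite insubN.
Qed.

Lemma iota_setD1 b x : (iota_set b :\ iota_vert x = iota_set (b :\ x))%SET.
Proof.
apply/setP => y; rewrite !inE; have [->|y0] /= := eqVneq y (inr ord0).
  by rewrite eq_sym iota_vert_neq.
apply/andP/imsetP => [[yx /imsetP[z zb yz]]|[z]].
  by exists z => //; rewrite !inE zb andbT; apply: contra yx => /eqP <-; apply/eqP.
rewrite !inE => /andP[zx zb] ->; rewrite (inj_eq iota_vert_inj) zx; split=> //.
by rewrite imset_f.
Qed.

Lemma iota_pull_cobord w : iota_pull (cobord w) = cobord (iota_pull w).
Proof.
apply/ffunP => b; rewrite !ffunE big_ord_recl /dfactor /= factor_iota0 big_set1.
rewrite /coef0 insubN ?mulr0 ?add0r; last first.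
  apply/negP => /forallP/(_ ord0)/set0Pn[y].
  rewrite inE => /andP[/setD1P[y0 yb] yi].
  have : y \in factor lv' (iota_set (val b)) ord0 by rewrite inE yb.
  by rewrite factor_iota0 inE (negPf y0).
apply: eq_bigr => i _; congr (_ * _).
  rewrite big_mkcond big_ord_recl /= fdeg_iota0 add0n [in RHS]big_mkcond.
  by congr (_ ^+ _); apply: eq_bigr => j _; rewrite fdeg_iota /bump /= !add1n ltnS.
rewrite fdeg_iota factor_iota big_imset /=; last by move=> ? ? _ _ /iota_vert_inj.
congr (_ * _); apply: eq_bigr => x xb.
by rewrite vpos_iota iota_setD1; congr (_ * _); exact: coef0_iota.
Qed.

End IotaCell.

Lemma face_iota_cell m n (lv : 'I_m.+2 -> 'I_n.+1) (l : 'I_m.+2)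
    (b : cell (fun v => lv (lift l v))) :
  iota_cell (face_cell b) =
  face_cell (lv := fun v => lift ord0 (lv v)) (l := l) (iota_cell b).
Proof.
apply: val_inj; rewrite /= /iota_set; apply/setP => y.
rewrite !inE; apply/predU1P/imsetP.
  case=> [->|/imsetP[x /imsetP[z zb ->] ->]].
    by exists (inr ord0) => //; rewrite !inE eqxx.
  exists (iota_vert z); last by case: (z).
  by rewrite in_setU1 imset_f ?orbT.
move=> [x]; rewrite in_setU1 => /predU1P[->|/imsetP[z zb ->]] ->; first by left.
right; apply/imsetP; exists (face_vert l z); first exact: imset_f.
by case: (z).
Qed.

Lemma bar_int_sup (A : set (\bar int)) : supremums A !=set0.
Proof.
have [Apoo|Apoo] := pselect (A +oo%E).
  by exists +oo%E; split=> [y _|y]; [exact: leey|exact].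
have [[z Az]|Afin] := pselect (exists z : int, A z%:E); last first.
  exists -oo%E; split=> [[y|//|_]|y _]; rewrite ?leNye // => Ay.
  by exfalso; apply: Afin; exists y.
have [[u uA]|Aub] := pselect (exists u : int, forall y : int, A y%:E -> y <= u); last first.
  exists +oo%E; split=> [y _|y yA]; first exact: leey.
  case: y yA => [u uA|//|]; last by move=> /(_ _ Az).
  by exfalso; apply: Aub; exists u => y /uA.
pose P (k : nat) := `[< A (u - k%:Z)%:E >].
have exP : exists k, P k.
  exists `|u - z|%N; apply/asboolP.
  by rewrite gez0_abs ?subr_ge0 ?uA // opprB addrC subrK.
case: (ex_minnP exP) => k /asboolP Ak kmin.
exists (u - k%:Z)%:E; split=> [[y Ay|//|]|y yA]; rewrite ?leNye //; last exact: yA.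
rewrite lee_fin lerBrDr -lerBrDl.
have -> : u - y = `|u - y|%N%:Z by rewrite gez0_abs // subr_ge0 uA.
rewrite lez_nat; apply: kmin; apply/asboolP.
by rewrite gez0_abs ?subr_ge0 ?uA // opprB addrC subrK.
Qed.

Lemma supremum_leP (A : set (\bar int)) (y : \bar int) :
  (supremum -oo%E A <= y)%O <-> forall a, A a -> (a <= y)%O.
Proof.
have Asup : supremums A (supremum -oo%E A) \/ (A = set0).
  rewrite /supremum; case: ifPn => [/eqP|_]; first by right.
  by left; have [x Ax] := bar_int_sup A; exact: xgetI Ax.
case: Asup => [[ubA lubA]|->].
  by split=> [h a Aa|h]; [exact: le_trans (ubA _ Aa) h|exact: lubA].
by rewrite supremum0 leNye; split.
Qed.

Section Families.
Context (K : realType) (X : filteredSpace) (R : comPzRingType).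

(* All families (w_s)_s indexed by the regular simplices, without compatibility. *)
Definition family : Type := forall m (s : rsimplex K X m), blowup (lvl s) R.

HB.instance Definition _ := gen_eqMixin family.
HB.instance Definition _ := gen_choiceMixin family.

Definition family0 : family := fun m s => 0.
Definition familyN (w : family) : family := fun m s => - w m s.
Definition familyD (w w' : family) : family := fun m s => w m s + w' m s.
Definition familyZ (a : R) (w : family) : family := fun m s => a *: w m s.

Lemma familyP (w w' : family) : (forall m s, w m s = w' m s) -> w = w'.
Proof.
by move=> h; apply: functional_extensionality_dep => m;
  apply: functional_extensionality_dep => s.
Qed.

Lemma familyDA : associative familyD.
Proof. by move=> u v w; apply: familyP => m s; exact: addrA. Qed.
Lemma familyDC : commutative familyD.
Proof. by move=> u v; apply: familyP => m s; exact: addrC. Qed.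
Lemma family0D : left_id family0 familyD.
Proof. by move=> u; apply: familyP => m s; exact: add0r. Qed.
Lemma familyND : left_inverse family0 familyN familyD.
Proof. by move=> u; apply: familyP => m s; exact: addNr. Qed.
HB.instance Definition _ :=
  GRing.isZmodule.Build family familyDA familyDC family0D familyND.

Lemma familyZA a b w : familyZ a (familyZ b w) = familyZ (a * b) w.
Proof. by apply: familyP => m s; exact: scalerA. Qed.
Lemma familyZ1 : left_id 1 familyZ.
Proof. by move=> w; apply: familyP => m s; exact: scale1r. Qed.
Lemma familyZDr : right_distributive familyZ +%R.
Proof. by move=> a u v; apply: familyP => m s; exact: scalerDr. Qed.
Lemma familyZDl w : {morph familyZ^~ w : a b / a + b}.
Proof. by move=> a b; apply: familyP => m s; exact: scalerDl. Qed.
HB.instance Definition _ :=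
  GRing.Zmodule_isLmodule.Build R family familyZA familyZ1 familyZDr familyZDl.

Definition delta (w : family) : family := fun m s => cobord (w m s).

Lemma delta_linear : linear delta.
Proof. by move=> a u v; apply: familyP => m s; exact: cobord_linear. Qed.
HB.instance Definition _ := GRing.isLinear.Build R family family _ delta delta_linear.

Definition compatible (w : family) : Prop :=
  forall m (s : rsimplex K X m.+1) l (h : regular_simplex (face s l)),
    face_pull l (w m.+1 s) = w m (rface h).

Definition homogeneous (k : int) (w : family) : Prop :=
  forall m (s : rsimplex K X m) (b : cell (lvl s)), w m s b != 0 -> (cdeg b)%:Z = k.

(* The least upper bound exists in Z u {-oo, +oo} (lemma [bar_int_sup]), and is
   -oo for the empty set. *)
Definition stratum_norm (S : stratum X) (w : family) : \bar int :=
  supremum -oo%E [set y | exists m (s : rsimplex K X m),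
    (exists t, stratum_set S (s t)) /\ y = blowup_norm (codim S) (w m s)].

Definition allowable (p : perversity X) (w : family) : Prop :=
  forall S : stratum X, singular_stratum S -> (stratum_norm S w <= p S)%O.

Lemma allowableP p w : allowable p w <->
  forall S : stratum X, singular_stratum S -> forall m (s : rsimplex K X m),
    (exists t, stratum_set S (s t)) -> forall b, w m s b != 0 -> (cnorm (codim S) b <= p S)%O.
Proof.
split=> h S Ssing.
  move=> m s St; apply/blowup_norm_leP.
  by have /supremum_leP := h S Ssing; apply; exists m, s.
by apply/supremum_leP => _ [m [s [St ->]]]; apply/blowup_norm_leP; exact: h.
Qed.

(* The elements of degree k of the complex of cochains w such that w and delta w
   are both p-allowable. *)
Definition bcochain (p : perversity X) (k : int) (w : family) : Prop :=
  [/\ compatible w, homogeneous k w, allowable p w & allowable p (delta w)].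

Lemma blowup_lin_neq0 n m (lv : 'I_m.+1 -> 'I_n.+1) a (u v : blowup lv R) b :
  (a *: u + v) b != 0 -> u b != 0 \/ v b != 0.
Proof.
rewrite !ffunE; have [->|? _] := eqVneq (u b) 0; last by left.
by rewrite scaler0 add0r; right.
Qed.

Lemma allowable_lin p a u v : allowable p u -> allowable p v -> allowable p (a *: u + v).
Proof.
move=> /allowableP hu /allowableP hv; apply/allowableP => S Ss m s St b.
by move=> /blowup_lin_neq0[]; [exact: hu|exact: hv].
Qed.

Lemma bcochain_lin p k a u v : bcochain p k u -> bcochain p k v ->
  bcochain p k (a *: u + v).
Proof.
move=> [cu du au bu] [cv dv av bv]; split.
- by move=> m s l h; rewrite -[RHS]/(a *: u m (rface h) + v m (rface h)) -cu -cv -face_pull_linear.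
- by move=> m s b /blowup_lin_neq0[]; [exact: du|exact: dv].
- exact: allowable_lin.
- by rewrite linearP; exact: allowable_lin.
Qed.

Lemma bcochain0 p k : bcochain p k 0.
Proof.
split.
- by move=> m s l h; apply/ffunP => b; rewrite !ffunE.
- by move=> m s b; rewrite ffunE eqxx.
- by apply/allowableP => S _ m s _ b; rewrite ffunE eqxx.
- by rewrite linear0; apply/allowableP => S _ m s _ b; rewrite ffunE eqxx.
Qed.

Section Cohomology.
Context (p : perversity X) (k : int).

Definition is_cocycle : {pred family} := fun w => `[< bcochain p k w /\ delta w = 0 >].

Lemma is_cocycle_submod : submod_closed is_cocycle.
Proof.
split=> [|a u v]; first by apply/asboolP; split; [exact: bcochain0|exact: linear0].
move=> /asboolP[cu du] /asboolP[cv dv]; apply/asboolP; split.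
  exact: bcochain_lin.
by rewrite delta_linear du dv scaler0 addr0.
Qed.
HB.instance Definition _ := GRing.isSubmodClosed.Build R family is_cocycle is_cocycle_submod.

Record cocycle := Cocycle { cocycle_val : family; cocycleP : cocycle_val \in is_cocycle }.
HB.instance Definition _ := [isSub for cocycle_val].
HB.instance Definition _ := [Choice of cocycle by <:].
HB.instance Definition _ := [SubChoice_isSubLmodule of cocycle by <:].

Definition is_coboundary : {pred cocycle} :=
  fun z => `[< exists2 w, bcochain p (k - 1) w & delta w = val z >].

Lemma is_coboundary_submod : submod_closed is_coboundary.
Proof.
split=> [|a u v]; first by apply/asboolP; exists 0; [exact: bcochain0|rewrite !linear0].
move=> /asboolP[w cw dw] /asboolP[w' cw' dw']; apply/asboolP.
by exists (a *: w + w'); [exact: bcochain_lin|rewrite delta_linear dw dw'].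
Qed.
HB.instance Definition _ :=
  GRing.isSubmodClosed.Build R cocycle is_coboundary is_coboundary_submod.

End Cohomology.
End Families.

Arguments is_cocycle {K X R} p k.
Arguments is_coboundary {K X R} p k.
Arguments cocycle K {X} R p k.

Section QuotientModule.
Context (R : pzRingType) (V : lmodType R) (B : submodClosed V).
Local Open Scope quotient_scope.

Definition quotmod_ker : {pred V} := B.

Lemma quotmod_ker_zmod : zmod_closed quotmod_ker.
Proof.
split=> [|u v Bu Bv]; first exact: (rpred0 B).
by apply: (@rpredD _ B) => //; rewrite -scaleN1r; exact: (@rpredZ _ _ B).
Qed.
HB.instance Definition _ := GRing.isZmodClosed.Build V quotmod_ker quotmod_ker_zmod.

Definition quotmod : Type := Quotient.quot quotmod_ker.
HB.instance Definition _ := GRing.Zmodule.on quotmod.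

Definition quotmod_pi (v : V) : quotmod := \pi_(Quotient.quot quotmod_ker) v.
Definition quotmod_repr (c : quotmod) : V := repr (c : Quotient.quot quotmod_ker).

Lemma quotmod_reprK : cancel quotmod_repr quotmod_pi.
Proof. exact: reprK. Qed.

Lemma quotmod_piP u v : quotmod_pi u = quotmod_pi v <-> u - v \in B.
Proof.
have -> : (u - v \in B) = (u - v \in quotmod_ker) by [].
by rewrite Quotient.idealrBE; split=> /eqP.
Qed.

Definition quotmod_scale (a : R) (c : quotmod) : quotmod :=
  quotmod_pi (a *: quotmod_repr c).

Lemma quotmod_scaleE a v : quotmod_scale a (quotmod_pi v) = quotmod_pi (a *: v).
Proof.
apply/quotmod_piP; rewrite -scalerBr; apply: rpredZ; apply/quotmod_piP.
exact: quotmod_reprK.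
Qed.

Lemma quotmod_piD : {morph quotmod_pi : u v / u + v}.
Proof. by move=> u v; rewrite /quotmod_pi raddfD. Qed.

Lemma quotmod_scaleA a b c :
  quotmod_scale a (quotmod_scale b c) = quotmod_scale (a * b) c.
Proof. by rewrite -[c]quotmod_reprK !quotmod_scaleE scalerA. Qed.
Lemma quotmod_scale1 : left_id 1 quotmod_scale.
Proof. by move=> c; rewrite -[c]quotmod_reprK quotmod_scaleE scale1r. Qed.
Lemma quotmod_scaleDr : right_distributive quotmod_scale +%R.
Proof.
move=> a c d; rewrite -[c]quotmod_reprK -[d]quotmod_reprK.
by rewrite -quotmod_piD !quotmod_scaleE scalerDr quotmod_piD.
Qed.
Lemma quotmod_scaleDl c : {morph quotmod_scale^~ c : a b / a + b}.
Proof.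
by move=> a b; rewrite -[c]quotmod_reprK !quotmod_scaleE scalerDl quotmod_piD.
Qed.
HB.instance Definition _ := GRing.Zmodule_isLmodule.Build R quotmod
  quotmod_scaleA quotmod_scale1 quotmod_scaleDr quotmod_scaleDl.

Lemma quotmod_pi_linear : linear quotmod_pi.
Proof. by move=> a u v; rewrite quotmod_piD -quotmod_scaleE. Qed.
HB.instance Definition _ :=
  GRing.isLinear.Build R V quotmod _ quotmod_pi quotmod_pi_linear.

End QuotientModule.

Section QuotientMap.
Context (R : pzRingType) (V W : lmodType R) (B : submodClosed V) (C : submodClosed W).
Context (f : {linear V -> W}).
Hypothesis fBC : forall v, v \in B -> f v \in C.

Definition quotmod_map (c : quotmod B) : quotmod C := quotmod_pi C (f (quotmod_repr c)).

Lemma quotmod_mapE v : quotmod_map (quotmod_pi B v) = quotmod_pi C (f v).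
Proof.
apply/quotmod_piP; rewrite -linearB; apply: fBC; apply/quotmod_piP.
exact: quotmod_reprK.
Qed.

Lemma quotmod_map_linear : linear quotmod_map.
Proof.
move=> a c d; rewrite -[c]quotmod_reprK -[d]quotmod_reprK -linearP !quotmod_mapE.
by rewrite !linearP.
Qed.

End QuotientMap.

Definition blowup_cohomology (K : realType) (X : filteredSpace) (R : comPzRingType)
  (p : perversity X) (k : int) : lmodType R := quotmod (@is_coboundary K X R p k).

Section IotaPullback.
Context (K : realType) (X : filteredSpace) (R : comPzRingType).
Let cX := open_cone K X.

Definition iota_family (w : family K cX R) : family K X R :=
  fun m s => iota_pull (w m (iota_simplex s)).

Lemma iota_family_linear : linear iota_family.
Proof. by move=> a u v; apply: familyP => m s; exact: iota_pull_linear. Qed.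
HB.instance Definition _ := GRing.isLinear.Build R (family K cX R) (family K X R) _
  iota_family iota_family_linear.

Lemma iota_delta w : iota_family (delta w) = delta (iota_family w).
Proof. by apply: familyP => m s; exact: iota_pull_cobord. Qed.

Lemma iota_face_regular m (s : rsimplex K X m.+1) l : regular_simplex (face s l) ->
  regular_simplex (face (iota_simplex s) l).
Proof.
move=> [v sv]; exists v; apply: val_inj => /=.
by have /= /(congr1 val) /= e := sv; rewrite /bump /= add1n e.
Qed.

Lemma family_irrel (Y : filteredSpace) (w : family K Y R) m f lv c1 c2 m1 m2 s1 s2 h1 h2
    (b : cell lv) :
  w m (RSimplex (rsimplex_val := @FSimplex K Y m f lv c1 m1 s1) h1) b =
  w m (RSimplex (rsimplex_val := @FSimplex K Y m f lv c2 m2 s2) h2) b.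
Proof.
have ec : c1 = c2 := Prop_irrelevance c1 c2.
have em : m1 = m2 := Prop_irrelevance m1 m2.
have es : s1 = s2 := Prop_irrelevance s1 s2.
subst c2 m2 s2; have eh : h1 = h2 := Prop_irrelevance h1 h2.
by subst h2.
Qed.

Lemma iota_compatible w : compatible w -> compatible (iota_family w).
Proof.
move=> cw m s l h; apply/ffunP => b.
have /ffunP/(_ (iota_cell b)) := cw _ (iota_simplex s) l (iota_face_regular h).
rewrite !ffunE => e.
rewrite face_iota_cell e.
exact: family_irrel.
Qed.

Lemma iota_homogeneous k w : homogeneous k w -> homogeneous k (iota_family w).
Proof.
move=> hw m s b; rewrite ffunE => wb; rewrite -(cdeg_iota b).
exact: (hw m (iota_simplex s) (iota_cell b) wb).
Qed.

Lemma iota_allowable (p : perversity cX) w :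
  allowable p w -> allowable (induced_perversity p) (iota_family w).
Proof.
move=> /allowableP hw; apply/allowableP => S Ss m s [t St] b.
rewrite ffunE => wb; rewrite -(cnorm_iota b); last first.
  by rewrite lt0n leq_subr andbT; exact/eqP.
have : (cnorm (codim (cyl_stratum K S)) (iota_cell b) <= p (cyl_stratum K S))%O.
  apply: (hw (cyl_stratum K S) _ m (iota_simplex s) _ (iota_cell b) wb).
    by rewrite /singular_stratum cyl_codim.
  by exists t; apply/cylE; split=> //; exact: halfline1_gt0.
by rewrite cyl_codim.
Qed.

Lemma iota_bcochain (p : perversity cX) k w :
  bcochain p k w -> bcochain (induced_perversity p) k (iota_family w).
Proof.
move=> [cw dw aw bw]; split.
- exact: iota_compatible.
- exact: iota_homogeneous.
- exact: iota_allowable.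
- by rewrite -iota_delta; exact: iota_allowable.
Qed.

Context (p : perversity cX) (k : int).

Lemma iota_is_cocycle w : w \in is_cocycle p k ->
  iota_family w \in is_cocycle (induced_perversity p) k.
Proof.
move=> /asboolP[cw dw]; apply/asboolP; split; first exact: iota_bcochain.
by rewrite -iota_delta dw linear0.
Qed.

Definition iota_cocycle (z : cocycle K R p k) : cocycle K R (induced_perversity p) k :=
  Cocycle (iota_is_cocycle (cocycleP z)).

Lemma iota_cocycle_linear : linear iota_cocycle.
Proof. by move=> a u v; apply: val_inj; exact: iota_family_linear. Qed.
HB.instance Definition _ := GRing.isLinear.Build R (cocycle K R p k) (cocycle K R (induced_perversity p) k) _
  iota_cocycle iota_cocycle_linear.

Lemma iota_coboundary z : z \in is_coboundary p k ->
  iota_cocycle z \in is_coboundary (induced_perversity p) k.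
Proof.
move=> /asboolP[w cw dw]; apply/asboolP; exists (iota_family w).
  exact: iota_bcochain.
by rewrite -iota_delta dw.
Qed.

Definition iota_star_fun :
    blowup_cohomology K R p k -> blowup_cohomology K R (induced_perversity p) k :=
  @quotmod_map R _ _ (is_coboundary p k) (is_coboundary (induced_perversity p) k)
    iota_cocycle.

Lemma iota_star_linear : linear iota_star_fun.
Proof. exact: quotmod_map_linear iota_coboundary. Qed.
HB.instance Definition _ := GRing.isLinear.Build R (blowup_cohomology K R p k)
  (blowup_cohomology K R (induced_perversity p) k) _ iota_star_fun iota_star_linear.

Definition iota_star : {linear blowup_cohomology K R p k ->
  blowup_cohomology K R (induced_perversity p) k} := iota_star_fun.

End IotaPullback.
Arguments iota_star {K X} R p k.

(* Main.v *)
From HB Require Import structures.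
Require Import Defs.
From mathcomp Require Import all_boot all_order all_algebra.
From mathcomp Require Import all_classical all_reals all_analysis.
From mathcomp Require Import zify ring lra.

(** Up to a sign, the coboundary of a blown-up cochain takes on a cell B the sum,
    over the vertices x of B, of its values on B \ x ([cobord_dset]).  The sign
    is a product of pairwise signs which are antisymmetric in the two vertices,
    so inserting a given vertex z in all cells is formally a contracting
    homotopy ([dset_insert]).  For a vertex z of the first factor, and cochains
    read as 0 off the cells, this fails only on the cells B whose first factor
    is a single vertex, where z takes the place of that vertex
    ([insert_formula]).  Both halves of the theorem use this identity, for two
    choices of z.

    Vanishing in degrees k > p(w).  The cone on a simplex s of the open cone
    (s joined with a new first vertex sent to the apex w) is continuous because
    X is compact, so that the neighbourhoods of w contain all the points of small
    height.  Let z be the new vertex.  For a cocycle w' of degree k, evaluating w'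
    on cells with z inserted ([cone_op]) gives a cochain whose coboundary is w'
    minus its values on cells having {z} as first factor.  The norm of such a
    cell at the apex is its degree k > p(w), so these values vanish by
    allowability, and w' is a coboundary ([delta_cone_op_cocycle]).

    Isomorphism in degrees k <= p(w).  The norm of a cell is at most its degree,
    so in these degrees the condition at the apex is void
    ([allowable_open_cone]).  A cocycle of X is extended to the open cone by
    tensoring its pullback, on the link of each simplex (the face spanned by the
    vertices off the apex, projected to X), with the unit cochain of the first
    factor ([extend]).  This is a section of iota^*, whence surjectivity.

    For injectivity, every cocycle of the open cone is cohomologous to the
    extension of its restriction along iota ([delta_retraction_homotopy]), in two
    steps.  With z the virtual apex of the blown-up factor N^*(c Delta_0), the
    insertion identity deforms a cocycle into the extension of its restriction to
    X x ]0,oo[ ([delta_fill]).  Then simplices of X x ]0,oo[ are moved to height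
    1 by a prism operator ([prism_formula]).  Join decompositions respect the
    order of the vertices, so each cell of the prism over a product cell lies in
    one simplex of the usual decomposition of the prism.  Both homotopies
    preserve the allowability conditions along the strata S x ]0,oo[; for the
    extension, this uses that a simplex meeting such a stratum has a link meeting
    S ([link_meets]).

    Cochains are mostly handled through their coefficients [coef0] on arbitrary
    sets of blown-up vertices, whose type does not involve the level function of
    the simplex. *)

Set Implicit Arguments.
Unset Strict Implicit.
Unset Printing Implicit Defensive.

Import Order.TTheory GRing.Theory Num.Theory.
Import numFieldNormedType.Exports.

Local Open Scope ring_scope.

Local Notation factor := Defs.factor.
Local Notation coef0 := Defs.coef0.
Local Notation family := Defs.family.

(** * Signs of the blown-up differential *)

Section Signs.
Context (m n : nat) (lv : 'I_m.+1 -> 'I_n.+1).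
Implicit Types (B : {set bvert m n}) (x y z : bvert m n).
Notation blk := (blk lv).

(** The sign in front of a face is a product of pairwise signs, one for each
    vertex y of the cell; [twist] tells which y contribute -1. *)
Definition twist y x : bool :=
  (blk y < blk x)%N || ((blk y == blk x) && ~~ vlt y x).

Lemma twistxx x : twist x x.
Proof. by rewrite /twist eqxx ltnn; case: x => //= u; rewrite ltnn. Qed.

(** All the cancellations below come from this antisymmetry: handling two
    vertices in the other order changes the sign. *)
Lemma twist_anti x y : x != y -> twist x y = ~~ twist y x.
Proof.
rewrite /twist negb_or negb_and negbK -leqNgt => xy.
have [lt|gt|/val_inj e] := ltngtP (blk x) (blk y) => /=.
- by rewrite -val_eqE gtn_eqF.
- by rewrite -val_eqE gtn_eqF.
rewrite e eqxx /=; case: x y xy e => [u|i] [v|j] //=.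
  move=> uv _; rewrite -leqNgt [LHS]leq_eqVlt -[X in X || _]/(v == u :> 'I_ _).
  by case: (eqVneq v u) uv => // ->; rewrite eqxx.
by move=> ij /(congr1 val) /= /val_inj e; rewrite e eqxx in ij.
Qed.

Context (R : comPzRingType).

(** The sign of B \ x in the coboundary.  It merges the Koszul sign, the sign
    of (delta f)(v) = -(-1)^|f| f(d v) and the position of x in its factor;
    see [sgn_exp]. *)
Definition sgn B x : R :=
  (-1) ^+ (blk x).+1 * \prod_(y in B) (-1) ^+ twist y x.

Lemma sgnU1 B z x : z \notin B -> sgn (z |: B)%SET x = (-1) ^+ twist z x * sgn B x.
Proof. by move=> zB; rewrite /sgn big_setU1 //= mulrCA. Qed.

Lemma sgnD1 B z x : z \in B -> sgn B x = (-1) ^+ twist z x * sgn (B :\ z)%SET x.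
Proof. by move=> zB; rewrite -[in LHS](finset.setD1K zB) sgnU1 // setD11. Qed.

Lemma sgn_sqr B x : sgn B x * sgn B x = 1.
Proof.
rewrite /sgn mulrACA -expr2 sqrr_sign mul1r -big_split big1 //= => y _.
by rewrite -expr2 sqrr_sign.
Qed.

Lemma twist_sum x y : x != y -> (-1) ^+ twist x y = - (-1) ^+ twist y x :> R.
Proof. by move=> xy; rewrite (twist_anti xy) signrN. Qed.

(** The coboundary, written for functions on all sets of blown-up vertices,
    so that it does not depend on the type of cells of a simplex. *)
Definition dset (f : {set bvert m n} -> R) B : R :=
  \sum_(x in B) sgn B x * f (B :\ x)%SET.

(** The operator f |-> (B |-> f (z |: B)), with its sign, contracts the complex
    of functions on sets: only the removal of z itself survives, the other
    terms cancel in pairs by antisymmetry of [twist].  No restriction to cells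
    is made here; [insert_formula] measures the resulting defect. *)
Lemma dset_insert f B z : z \notin B ->
  sgn (z |: B)%SET z * dset f (z |: B)%SET +
  \sum_(x in B) sgn B x * (sgn (z |: B :\ x)%SET z * f (z |: B :\ x)%SET) = f B.
Proof.
move=> zB; rewrite /dset big_setU1 //= mulrDr mulrA sgn_sqr mul1r finset.setU1K //.
rewrite -addrA [X in _ + X](_ : _ = 0) ?addr0 // mulr_sumr -big_split big1 //= => x xB.
have xz : x != z by apply: contraNneq zB => <-.
have -> : ((z |: B) :\ x = z |: (B :\ x))%SET.
  apply/setP => y; rewrite !inE; case: (eqVneq y z) => //= ->.
  by rewrite eq_sym xz.
have zBx : z \notin (B :\ x)%SET by rewrite !inE (negPf zB) andbF.
rewrite (sgnU1 z zB) (sgnU1 x zB) (sgnU1 z zBx) (sgnD1 z xB) (twist_sum xz).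
rewrite twistxx.
have aux (a b c t : R) : t * t = 1 ->
    -1 * (- t * a) * (t * b * c) + b * (-1 * a * c) = 0.
  move=> tt; rewrite (_ : _ + _ = (t * t - 1) * (a * b * c)); last by ring.
  by rewrite tt subrr mul0r.
by apply: aux; rewrite -expr2 sqrr_sign.
Qed.

Lemma is_cellP B : reflect (forall i, factor lv B i != finset.set0) (is_cell lv B).
Proof. exact: forallP. Qed.

Lemma card_factor B i : is_cell lv B -> #|factor lv B i| = (fdeg lv B i).+1.
Proof. by move=> /is_cellP/(_ i); rewrite /fdeg -card_gt0 => /prednK. Qed.

Lemma coef0_cell (w : blowup lv R) (b : cell lv) : coef0 w (val b) = w b.
Proof. by rewrite /coef0 valK. Qed.

Lemma coef0_not w B : ~~ is_cell lv B -> coef0 (w : blowup lv R) B = 0.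
Proof. by move=> h; rewrite /coef0 insubN. Qed.

Lemma card_cell B (I : pred 'I_n.+1) : is_cell lv B ->
  #|[set y in B | I (blk y)]%SET| = (\sum_(i < n.+1 | I i) (fdeg lv B i).+1)%N.
Proof.
move=> cB; rewrite -sum1dep_card (partition_big blk I) /=; last by move=> y /andP[].
apply: eq_bigr => i Ii; rewrite -(card_factor i cB) -sum1dep_card; apply: eq_bigl => y.
by rewrite -andbA; congr (_ && _); case: eqP => [->|]; rewrite ?Ii ?andbF.
Qed.

(** Degrees become cardinals, so that inserting a vertex raises the degree by
    one with no computation in the separate factors. *)
Lemma cdeg_card (b : cell lv) : (cdeg b + n.+1)%N = #|val b|.
Proof.
have := card_cell predT (valP b); rewrite (_ : finset _ = val b); last first.
  by apply/setP => y; rewrite inE andbT.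
move=> ->; under [RHS]eq_bigr do rewrite -addn1.
by rewrite big_split /= big_const_ord iter_addn mul1n addn0.
Qed.

(** Modulo 2, the number of vertices in the blocks up to that of x is the sum
    of the degrees of these blocks plus their number, which accounts for the
    factor (-1) ^+ (blk x).+1 in [sgn]. A block reduced to x is excluded:
    there the predecessor of its degree 0 would be truncated. *)
Lemma sgn_exp B x : is_cell lv B -> fdeg lv B (blk x) != 0%N ->
  sgn B x = (-1) ^+ (\sum_(j < n.+1 | (j < blk x)%N) fdeg lv B j) *
    (- (-1) ^+ (fdeg lv B (blk x)).-1 * (-1) ^+ vpos lv B x).
Proof.
move=> cB f0; set i := blk x.
have vposE : #|[set y in B | (blk y == i) && ~~ vlt y x]%SET| = ((fdeg lv B i).+1 - vpos lv B x)%N.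
  rewrite -card_factor // (_ : vpos lv B x = #|factor lv B i :&: [set y | vlt y x]|%SET).
    rewrite -cardsD; apply: eq_card => y; rewrite !inE.
    by case: vlt; rewrite ?andbF ?andbT.
  by apply: eq_card => y; rewrite !inE.
have vle : (vpos lv B x <= (fdeg lv B i).+1)%N.
  by rewrite -card_factor //; apply: subset_leq_card; apply/fintype.subsetP => y; rewrite !inE => /andP[].
rewrite /sgn -expr_sum (_ : \sum_(y in B) _ = (\sum_(j < n.+1 | (j < i)%N) (fdeg lv B j).+1 +
   ((fdeg lv B i).+1 - vpos lv B x))%N); last first.
  rewrite -(card_cell (fun j => (j < i)%N) cB) -vposE -!sum1dep_card.
  rewrite big_mkcondr [X in (_ + X)%N]big_mkcondr -big_split; apply: eq_bigr => y _ /=.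
  rewrite /twist -/i; case: ltngtP => [lt|gt|e]; rewrite /=.
  - by rewrite -val_eqE ltn_eqF.
  - by rewrite -val_eqE gtn_eqF.
  - by case: vlt.
have -> : (\sum_(j < n.+1 | (j < i)%N) (fdeg lv B j).+1 = \sum_(j < n.+1 | (j < i)%N) fdeg lv B j + i)%N.
  under eq_bigr do rewrite -addn1; rewrite big_split /=; congr addn.
  rewrite (big_ord_narrow (ltnW (ltn_ord i))) /=.
  by rewrite big_const_ord iter_addn mul1n addn0.
have -> : - (-1) ^+ (fdeg lv B i).-1 = (-1) ^+ fdeg lv B i :> R.
  by rewrite -[in RHS](@prednK (fdeg lv B i)) ?lt0n // exprS mulN1r.
rewrite -!exprD -signr_odd -[in RHS]signr_odd.
congr (_ ^+ nat_of_bool _).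
rewrite -/i !oddD oddB //=.
by do 4!case: (odd _).
Qed.

(** When the factor of x is reduced to x, both sides contribute 0, as B \ x is
    not a cell; elsewhere the signs agree by [sgn_exp]. *)
Lemma cobord_dset (w : blowup lv R) B : is_cell lv B ->
  coef0 (cobord w) B = dset (coef0 w) B.
Proof.
move=> cB; rewrite {1}/coef0 insubT ffunE /= /dset.
rewrite (partition_big blk xpredT) //=; apply: eq_bigr => i _.
rewrite /dfactor !mulr_sumr; apply: eq_big => [x|x]; first by rewrite inE.
rewrite inE => /andP[xB /eqP xi].
have [d0|d0] := eqVneq (fdeg lv B i) 0%N.
  rewrite coef0_not ?mulr0 //; apply/negP => /is_cellP/(_ i)/set0Pn[y].
  rewrite !inE => /andP[/andP[yx yB] /eqP yi].
  have := card_factor i cB; rewrite d0 => /eqP/cards1P[u uE].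
  have : x \in factor lv B i by rewrite inE xB xi eqxx.
  have : y \in factor lv B i by rewrite inE yB yi eqxx.
  by rewrite uE !inE => /eqP <- /eqP xy; rewrite xy eqxx in yx.
by rewrite sgn_exp // xi // !mulrA.
Qed.

End Signs.

(** * Faces of arbitrary codimension *)

Definition incr (k m : nat) (phi : 'I_k.+1 -> 'I_m.+1) :=
  forall u v, (phi u < phi v)%N = (u < v)%N.

Section Increasing.
Context (k m : nat) (phi : 'I_k.+1 -> 'I_m.+1).
Hypothesis phi_incr : incr phi.

Lemma incr_leq u v : (phi u <= phi v)%N = (u <= v)%N.
Proof. by rewrite leqNgt phi_incr -leqNgt. Qed.

Lemma incr_inj : injective phi.
Proof. by move=> u v uv; apply/val_inj/eqP; rewrite eqn_leq -!incr_leq uv leqnn. Qed.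

End Increasing.

Lemma incr_lift m (l : 'I_m.+2) : incr (lift l).
Proof. by move=> u v; rewrite !ltnNge leq_bump2. Qed.

Lemma incr_comp j k m (phi : 'I_k.+1 -> 'I_m.+1) (psi : 'I_j.+1 -> 'I_k.+1) :
  incr phi -> incr psi -> incr (phi \o psi).
Proof. by move=> p q u v; rewrite /= p q. Qed.

Lemma incr_geq m (phi : 'I_m.+1 -> 'I_m.+1) (u : 'I_m.+1) : incr phi -> (u <= phi u)%N.
Proof.
move=> p; case: u => u um; elim: u um => // u IHu um.
by apply: leq_ltn_trans (IHu (ltnW um)) _; rewrite p.
Qed.

Lemma incr_endo m (phi : 'I_m.+1 -> 'I_m.+1) (u : 'I_m.+1) : incr phi -> phi u = u.
Proof.
move=> p; have p' : incr (@rev_ord m.+1 \o phi \o @rev_ord m.+1).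
  by move=> x y /=; rewrite ltn_sub2lE // ltnS p /= ltn_sub2lE // ltnS.
have := incr_geq (rev_ord u) p'; rewrite /= rev_ordK => h.
apply/val_inj/eqP; rewrite eqn_leq (incr_geq u p) andbT.
by move: h; rewrite leq_sub2lE // ltnS.
Qed.

Section Vmap.
Context (k m n : nat) (phi : 'I_k.+1 -> 'I_m.+1).
Context (lv1 : 'I_k.+1 -> 'I_n.+1) (lv : 'I_m.+1 -> 'I_n.+1).
Hypothesis phi_incr : incr phi.
Hypothesis lvE : forall u, lv1 u = lv (phi u).

Implicit Types B : {set bvert k n}.

Definition vmap (x : bvert k n) : bvert m n :=
  match x with inl v => inl (phi v) | inr i => inr i end.

Lemma vmap_inj : injective vmap.
Proof.
move=> [u|i] [v|j] //= => [[e]|[->] //].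
by rewrite (incr_inj phi_incr e).
Qed.

Lemma blk_vmap x : blk lv (vmap x) = blk lv1 x.
Proof. by case: x => //= u; rewrite lvE. Qed.

Lemma twist_vmap x y : twist lv (vmap x) (vmap y) = twist lv1 x y.
Proof. by rewrite /twist !blk_vmap; case: x y => [u|i] [v|j] //=; rewrite phi_incr. Qed.

Lemma factor_vmap B i : factor lv (vmap @: B)%SET i = (vmap @: factor lv1 B i)%SET.
Proof.
apply/setP => y; rewrite inE; apply/andP/imsetP => [[/imsetP[x xB ->]]|[x]].
  by rewrite blk_vmap => xi; exists x; rewrite // inE xB.
by rewrite inE => /andP[xB xi] ->; rewrite blk_vmap imset_f.
Qed.

Lemma is_cell_vmap B : is_cell lv (vmap @: B)%SET = is_cell lv1 B.
Proof. by apply: eq_forallb => i; rewrite factor_vmap imset_eq0. Qed.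

Lemma sgn_vmap (R : comPzRingType) B x :
  sgn lv R (vmap @: B)%SET (vmap x) = sgn lv1 R B x.
Proof.
rewrite /sgn blk_vmap big_imset /=; last by move=> ? ? _ _ /vmap_inj.
by congr (_ * _); apply: eq_bigr => y _; rewrite twist_vmap.
Qed.

Lemma vmap_setD1 B x : ((vmap @: B) :\ vmap x = vmap @: (B :\ x))%SET.
Proof.
apply/setP => y; rewrite !inE; apply/andP/imsetP => [[yx /imsetP[z zB yE]]|[z]].
  by exists z; rewrite // !inE zB andbT; apply: contraNneq yx => <-; rewrite yE.
rewrite !inE => /andP[zx zB] ->; rewrite (inj_eq vmap_inj) zx.
by rewrite imset_f.
Qed.

End Vmap.

Lemma vmap_comp j k m n (phi : 'I_k.+1 -> 'I_m.+1) (psi : 'I_j.+1 -> 'I_k.+1)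
  (B : {set bvert j n}) :
  (vmap phi @: (vmap psi @: B) = vmap (phi \o psi) @: B)%SET.
Proof. by rewrite -imset_comp; apply: eq_imset => -[]. Qed.

Lemma eq_vmap k m n (phi psi : 'I_k.+1 -> 'I_m.+1) (B : {set bvert k n}) :
  phi =1 psi -> (vmap phi @: B = vmap psi @: B)%SET.
Proof. by move=> e; apply: eq_imset => -[u|i] //=; rewrite e. Qed.

Lemma vmap_id m n (phi : 'I_m.+1 -> 'I_m.+1) (B : {set bvert m n}) :
  phi =1 id -> (vmap phi @: B = B)%SET.
Proof.
move=> e; rewrite (eq_vmap B e) -[RHS]imset_id; apply: eq_imset => -[] //.
Qed.

Lemma face_vertE m n (l : 'I_m.+2) : face_vert l =1 @vmap _ _ n (lift l).
Proof. by case. Qed.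

Lemma coef0_face_pull m n (lv : 'I_m.+2 -> 'I_n.+1) l (R : comPzRingType)
    (w : blowup lv R) B :
  coef0 (face_pull l w) B = coef0 w (vmap (lift l) @: B)%SET.
Proof.
have cE : is_cell lv (vmap (lift l) @: B)%SET = is_cell (fun v => lv (lift l v)) B.
  by apply: is_cell_vmap => //; exact: incr_lift.
have [cB|cB] := boolP (is_cell (fun v => lv (lift l v)) B); last first.
  by rewrite !coef0_not // cE.
rewrite /coef0 !insubT ?cE // => cB'; rewrite ffunE; congr (w _); apply: val_inj.
by apply: eq_imset; exact: face_vertE.
Qed.

Section Bary.
Context (K : realType).
Local Open Scope classical_set_scope.

Definition bary m (t : stdsimplex K m) (v : 'I_m.+1) : K := val t ord0 v.

Lemma bary_ge0 m (t : stdsimplex K m) v : 0 <= bary t v.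
Proof. by rewrite /bary; case: t => t /= /set_mem[]. Qed.

Lemma bary_sum m (t : stdsimplex K m) : \sum_v bary t v = 1.
Proof. by rewrite /bary; case: t => t /= /set_mem[]. Qed.

Lemma bary_inj m (s t : stdsimplex K m) : bary s =1 bary t -> s = t.
Proof.
by move=> e; apply: val_inj; apply/rowP => v; exact: e.
Qed.

Lemma bary_le1 m (t : stdsimplex K m) v : bary t v <= 1.
Proof.
rewrite -(bary_sum t) (bigD1 v) //= lerDl; apply: sumr_ge0 => u _; exact: bary_ge0.
Qed.

Lemma mk_simplexP m (f : 'I_m.+1 -> K) : (forall v, 0 <= f v) -> \sum_v f v = 1 ->
  (\row_v f v) \in stdsimplex K m.
Proof.
move=> f0 f1; apply/mem_set; split=> [v|]; first by rewrite mxE.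
by rewrite -[RHS]f1; apply: eq_bigr => v _; rewrite mxE.
Qed.

Definition mk_simplex m (f : 'I_m.+1 -> K) (f0 : forall v, 0 <= f v)
  (f1 : \sum_v f v = 1) : stdsimplex K m :=
  exist _ (\row_v f v) (mk_simplexP f0 f1).

Lemma bary_mk m (f : 'I_m.+1 -> K) f0 f1 v : bary (@mk_simplex m f f0 f1) v = f v.
Proof. by rewrite /bary /= mxE. Qed.

Lemma cvg_set_type (T U : topologicalType) (A : set U) (f : T -> A) (x : T) :
  val (f y) @[y --> x] --> val (f x) -> f y @[y --> x] --> f x.
Proof.
move=> h W [_ [[B oB <-] /= Bx BW]].
have : nbhs (val (f x)) B by exact: open_nbhs_nbhs.
move=> /h nB; have {}nB : nbhs x [set y | B (val (f y))] by [].
by apply: (@filterS T (nbhs x) _ _ (f @^-1` W) _ nB) => y /= By; exact: BW.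
Qed.

Lemma cvg_bary (T : topologicalType) m (f : T -> stdsimplex K m) (x : T) :
  (forall v, bary (f y) v @[y --> x] --> bary (f x) v) -> f y @[y --> x] --> f x.
Proof.
move=> h; apply: cvg_set_type => A [P fP PA].
have nP : nbhs x [set y | forall v, P ord0 v (bary (f y) v)].
  by apply: filter_forall => v; apply: (h v); exact: fP.
rewrite -[_ A]/(nbhs x [set y | A (val (f y))]).
by apply: (@filterS T (nbhs x) _ _ _ _ nP) => y Py; apply: PA => i j; rewrite (ord1 i); exact: Py.
Qed.

Lemma bary_continuous m v : continuous (fun t : stdsimplex K m => bary t v).
Proof.
move=> t; apply: (@continuous_comp (stdsimplex K m) _ _ val (fun r : 'rV[K]_m.+1 => r ord0 v)).
  exact: initial_continuous.
exact: coord_continuous.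
Qed.

Lemma big_sum_continuous (T : topologicalType) (I : finType) (P : pred I) (f : I -> T -> K) :
  (forall i, continuous (f i)) -> continuous (fun t => \sum_(i | P i) f i t).
Proof. by move=> h; apply: continuous_big => [|i _]; [exact: add_continuous|exact: h]. Qed.

End Bary.

Section Push.
Context (K : realType) (k m : nat) (phi : 'I_k.+1 -> 'I_m.+1).
Local Open Scope classical_set_scope.

Lemma push_ge0 (t : stdsimplex K k) v : 0 <= \sum_(u | phi u == v) bary t u.
Proof. by apply: sumr_ge0 => u _; exact: bary_ge0. Qed.

Lemma push_sum1 (t : stdsimplex K k) : \sum_v \sum_(u | phi u == v) bary t u = 1.
Proof. by rewrite -(bary_sum t) (partition_big phi predT). Qed.

Definition push (t : stdsimplex K k) : stdsimplex K m :=
  mk_simplex (push_ge0 t) (push_sum1 t).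

Lemma bary_push t v : bary (push t) v = \sum_(u | phi u == v) bary t u.
Proof. exact: bary_mk. Qed.

Lemma push_continuous : continuous push.
Proof.
move=> t; apply: cvg_bary => v; under eq_fun do rewrite bary_push; rewrite bary_push.
by apply: (big_sum_continuous (P := fun u => phi u == v)) => u; exact: bary_continuous.
Qed.

Lemma push_neq0 t v : bary (push t) v != 0 <-> exists2 u, bary t u != 0 & phi u = v.
Proof.
rewrite bary_push psumr_neq0; last by move=> u _; exact: bary_ge0.
split=> [/hasP[u _ /andP[/eqP uv]]|[u tu uv]].
  by rewrite lt0r => /andP[tu _]; exists u.
by apply/hasP; exists u; rewrite ?mem_index_enum // uv eqxx /= lt0r tu bary_ge0.
Qed.

Lemma sum_push (P : pred 'I_m.+1) t :
  \sum_(v | P v) bary (push t) v = \sum_(u | P (phi u)) bary t u.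
Proof.
rewrite (partition_big phi P) //=; apply: eq_bigr => v Pv; rewrite bary_push.
by apply: eq_bigl => u; case: eqP => [->|]; rewrite ?Pv ?andbF.
Qed.

End Push.

Lemma push_comp (K : realType) j k m (phi : 'I_k.+1 -> 'I_m.+1) (psi : 'I_j.+1 -> 'I_k.+1)
  (t : stdsimplex K j) : push phi (push psi t) = push (phi \o psi) t.
Proof. by apply: bary_inj => v; rewrite !bary_push sum_push. Qed.

Lemma eq_push (K : realType) k m (phi psi : 'I_k.+1 -> 'I_m.+1) (t : stdsimplex K k) :
  phi =1 psi -> push phi t = push psi t.
Proof. by move=> e; apply: bary_inj => v; rewrite !bary_push; apply: eq_bigl => u; rewrite e. Qed.

Lemma push_id (K : realType) m (phi : 'I_m.+1 -> 'I_m.+1) (t : stdsimplex K m) :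
  phi =1 id -> push phi t = t.
Proof.
move=> e; apply: bary_inj => v; rewrite bary_push (big_pred1 v) // => u /=.
by rewrite e.
Qed.

Lemma face_mapE (K : realType) m (l : 'I_m.+2) (t : stdsimplex K m) :
  face_map l t = push (lift l) t.
Proof.
apply: bary_inj => v; rewrite bary_push /bary /=.
case: (unliftP l v) => [u ->|->]; last first.
  by rewrite face_row_l big_pred0 // => u; rewrite eq_sym (negPf (neq_lift l u)).
by rewrite face_row_lift (big_pred1 u) // => u'; rewrite /= (inj_eq lift_inj).
Qed.

Section Faces.
Context (K : realType) (Y : filteredSpace).

(** Stated pointwise, because the simplex s1 often comes from another
    construction.  For phi increasing, s1 is the face of s spanned by the image
    of phi; for phi nondecreasing, a degeneracy of that face. *)
Definition subsimplex k m (phi : 'I_k.+1 -> 'I_m.+1) (s1 : fsimplex K Y k)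
    (s : fsimplex K Y m) :=
  (forall t, s1 t = s (push phi t)) /\ (forall u, lvl s1 u = lvl s (phi u)).

Lemma fsimplex_eq m (s1 s2 : fsimplex K Y m) :
  (forall t, s1 t = s2 t) -> (forall u, lvl s1 u = lvl s2 u) -> s1 = s2.
Proof.
case: s1 s2 => f1 l1 c1 o1 k1 [f2 l2 c2 o2 k2] /= /funext ef /funext el; subst f2 l2.
by rewrite (Prop_irrelevance c1 c2) (Prop_irrelevance o1 o2) (Prop_irrelevance k1 k2).
Qed.

Lemma rsimplex_eq m (s1 s2 : rsimplex K Y m) :
  (forall t, s1 t = s2 t) -> (forall u, lvl s1 u = lvl s2 u) -> s1 = s2.
Proof.
case: s1 s2 => s1 h1 [s2 h2] /= ef el; have e := fsimplex_eq ef el; subst s2.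
by rewrite (Prop_irrelevance h1 h2).
Qed.

Lemma subsimplex_face m (s : fsimplex K Y m.+1) (l : 'I_m.+2) :
  @subsimplex m m.+1 (lift l) (face s l) s.
Proof. by split=> // t /=; rewrite face_mapE. Qed.

(** Compatibility is assumed for faces of codimension one; a face of any
    codimension is reached by deleting the missing vertices one at a time.
    This makes the value of w on a cell depend only on the face spanned by any
    set of vertices containing those of the cell. *)
Lemma compatible_subsimplex (R : comPzRingType) (w : family K Y R) k m (phi : 'I_k.+1 -> 'I_m.+1)
    (s1 : rsimplex K Y k) (s : rsimplex K Y m) B :
  compatible w -> incr phi -> subsimplex phi s1 s ->
  coef0 (w k s1) B = coef0 (w m s) (vmap phi @: B)%SET.
Proof.
move=> cw; elim: m => [|m IHm] in k phi s1 s B *; move=> phi_incr [ef el].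
  have k0 : k = 0%N.
    have := leq_card _ (incr_inj phi_incr); rewrite !card_ord ltnS leqn0 => /eqP //.
  subst k; have e : phi =1 id by move=> u; rewrite !ord1.
  by rewrite vmap_id // (@rsimplex_eq _ s1 s) // => [t|u]; rewrite ?ef ?el ?e // push_id.
(* A vertex outside the image of phi can be deleted first; otherwise phi is the identity. *)
have [[l lphi]|surj] := pselect (exists l, forall u, phi u != l).
  pose psi u := odflt ord0 (unlift l (phi u)).
  have psiE u : phi u = lift l (psi u).
    by rewrite /psi; case: unliftP => [//|e]; have := lphi u; rewrite e eqxx.
  have psi_incr : incr psi by move=> u v; rewrite -(incr_lift l) -!psiE phi_incr.
  have h : regular_simplex (face s l).
    by have [u uE] := rsimplexP s1; exists (psi u); rewrite /= -psiE -el.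
  rewrite (IHm _ psi s1 (rface h)) //; last first.
    by split=> [t|u] /=; rewrite ?face_mapE ?push_comp ?ef ?el -?psiE //; congr (s _); exact: eq_push.
  rewrite -(cw _ s l h) coef0_face_pull vmap_comp; congr coef0.
  by apply: eq_vmap => u /=; rewrite -psiE.
have km : k = m.+1.
  apply/eqP; rewrite -eqSS -{1}(card_ord k.+1) -(card_ord m.+2) -(card_codom (incr_inj phi_incr)).
  apply/eqP/eq_card => l; apply/codomP; apply: contrapT => h; apply: surj; exists l => u.
  by apply/eqP => ul; apply: h; exists u.
subst k; have e : phi =1 id by move=> u; exact: incr_endo.
by rewrite vmap_id // (@rsimplex_eq _ s1 s) // => [t|u]; rewrite ?ef ?el ?e // push_id.
Qed.

Section Pull.
Context (k m : nat) (phi : 'I_k.+1 -> 'I_m.+1) (s : fsimplex K Y m).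
Hypothesis phi_mono : {homo phi : u v / (u <= v)%N}.
Local Open Scope classical_set_scope.

Let pmap t := s (push phi t).
Let plvl u := lvl s (phi u).

Lemma pull_continuous : continuous pmap.
Proof.
move=> t; apply: (@continuous_comp _ _ _ (push phi) s).
  exact: push_continuous.
exact: smap_continuous.
Qed.

Lemma pull_lvl_mono : {homo plvl : u v / (u <= v)%N}.
Proof. by move=> u v uv; apply: lvl_mono; exact: phi_mono. Qed.

Lemma pull_skel (i : nat) (t : stdsimplex K k) : (i <= fdim Y)%N ->
  skel Y i (pmap t) <-> (forall v, val t ord0 v != 0 -> (plvl v <= i)%N).
Proof.
move=> iY; rewrite /pmap smap_skel //; split=> h v.
  by move=> v0; apply: h; apply/push_neq0; exists v.
by move=> /push_neq0[u tu <-]; exact: h.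
Qed.

(** For a nondecreasing phi the linear map of simplices is again compatible
    with the filtration: this gives the degenerate simplices underlying a prism
    as well as faces. *)
Definition pull : fsimplex K Y k := FSimplex pull_continuous pull_lvl_mono pull_skel.

End Pull.
End Faces.

(** * The prism operator *)

Lemma cell_top m n (lv : 'I_m.+1 -> 'I_n.+1) B : is_cell lv B ->
  exists2 u, inl u \in B & lv u = ord_max.
Proof.
move=> /is_cellP/(_ ord_max)/set0Pn[[u|i]]; rewrite inE /= => /andP[uB /eqP ui].
  by exists u.
by have := ltn_ord i; rewrite -[X in (X < _)%N]/(val (widen_ord (leqnSn n) i)) ui /= ltnn.
Qed.

Section Thick.
Context (m : nat) (v : 'I_m.+1).

(** In the (m+1)-simplex of the prism over v, the vertices are the first v+1
    vertices of the base (indices up to v) and the vertices v, ..., m of the top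
    (indices from v+1): the top copy of v has index v+1, its base copy v. *)
Definition slot : 'I_m.+2 := lift ord0 v.

Definition degen (w : 'I_m.+2) : 'I_m.+1 := odflt v (unlift slot w).

Lemma degen_lift u : degen (lift slot u) = u.
Proof. by rewrite /degen liftK. Qed.

Lemma degen_slot : degen slot = v.
Proof. by rewrite /degen unlift_none. Qed.

Lemma lift_slot u : lift slot u = ((v < u) + u)%N :> nat.
Proof. by []. Qed.

Lemma degenE w : degen w = (if (w <= v)%N then (w : nat) else w.-1) :> nat.
Proof.
by case: (unliftP slot w) => [u|] ->; rewrite ?degen_lift ?degen_slot /= /bump /=; case: ifP; lia.
Qed.

Lemma degen_mono : {homo degen : a b / (a <= b)%N}.
Proof. by move=> a b ab /=; rewrite !degenE; do 2!case: ifP; lia. Qed.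

Lemma degen_lift0 u : degen (lift (widen_ord (leqnSn _) v) u) = u.
Proof. by apply: val_inj; rewrite /= degenE /= /bump; case: ifP; lia. Qed.

End Thick.

Section ThickMap.
Context (k m : nat) (v : 'I_k.+1) (psi : 'I_k.+1 -> 'I_m.+1).
Hypothesis psi_incr : incr psi.

(** The map of prisms induced by the map psi of their base simplices. *)
Definition thick (w : 'I_k.+2) : 'I_m.+2 :=
  if unlift (slot v) w is Some u then lift (slot (psi v)) (psi u) else slot (psi v).

Lemma thick_lift u : thick (lift (slot v) u) = lift (slot (psi v)) (psi u).
Proof. by rewrite /thick liftK. Qed.

Lemma thick_slot : thick (slot v) = slot (psi v).
Proof. by rewrite /thick unlift_none. Qed.

Lemma degen_thick w : degen (psi v) (thick w) = psi (degen v w).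
Proof.
by case: (unliftP (slot v) w) => [u|] ->; rewrite ?thick_lift ?thick_slot ?degen_lift ?degen_slot.
Qed.

Lemma thick_incr : incr thick.
Proof.
move=> a b; case: (unliftP (slot v) a) => [u|] ->; case: (unliftP (slot v) b) => [u'|] ->;
  rewrite ?thick_lift ?thick_slot ?incr_lift ?psi_incr //.
- by rewrite !lift_slot /= /bump /= !add1n psi_incr; have := psi_incr v u; lia.
- by rewrite !lift_slot /= /bump /= !add1n psi_incr; have := psi_incr v u'; lia.
Qed.

Lemma thick_gt w : (psi v < thick w)%N = (v < w)%N.
Proof.
case: (unliftP (slot v) w) => [u|] ->; rewrite ?thick_lift ?thick_slot.
  rewrite !lift_slot psi_incr.
  by case: (ltnP v u) => _; rewrite ?add0n ?add1n ?ltnS ?(incr_leq psi_incr) ?psi_incr.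
by rewrite /= /bump /= !add1n !ltnS !leqnn.
Qed.

End ThickMap.

Section Heights.
Context (K : realType).
Local Open Scope classical_set_scope.

(** A simplex of X x ]0,oo[ is a simplex of X together with such a function. *)
Record height (m : nat) := Height {
  height_fun :> stdsimplex K m -> K;
  height_continuous : continuous height_fun;
  height_gt0 : forall t, 0 < height_fun t
}.

Lemma height1_continuous m : continuous (fun _ : stdsimplex K m => 1 : K).
Proof. exact: cst_continuous. Qed.

Definition height1 m : height m :=
  Height (@height1_continuous m) (fun=> ltr01).

Section Pull.
Context (k m : nat) (phi : 'I_k.+1 -> 'I_m.+1) (g : height m).

Lemma height_pull_continuous : continuous (fun t => g (push phi t)).
Proof.
move=> t; apply: (@continuous_comp _ _ _ (push phi) g).
  exact: push_continuous.
exact: height_continuous.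
Qed.

Definition height_pull : height k :=
  Height height_pull_continuous (fun t => height_gt0 g _).

End Pull.

Section Mix.
Context (m : nat) (Q : pred 'I_m.+1) (g : height m).

(** The height at the barycentric point t of the straight homotopy from g to
    the constant 1, at the time given by the total weight of Q: vertices in Q
    lie on the top of the prism, the others on its base. *)
Definition mix (t : stdsimplex K m) : K :=
  (1 - \sum_(u | Q u) bary t u) * g t + \sum_(u | Q u) bary t u.

Lemma mix_continuous : continuous mix.
Proof.
have cs : continuous (fun t : stdsimplex K m => \sum_(u | Q u) bary t u).
  by apply: big_sum_continuous => u; exact: bary_continuous.
move=> t; apply: (@continuousD _ _ _ (fun t => (1 - \sum_(u | Q u) bary t u) * g t)); last exact: cs.
apply: (@continuousM _ _ (fun t => 1 - \sum_(u | Q u) bary t u)); last exact: height_continuous.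
exact: (continuousB (@height1_continuous m t) (cs t)).
Qed.

Lemma mix_gt0 t : 0 < mix t.
Proof.
rewrite /mix; set s := \sum_(u | _) _.
have s0 : 0 <= s by apply: sumr_ge0 => u _; exact: bary_ge0.
have s1 : s <= 1.
  rewrite -(bary_sum t) (bigID Q) /= lerDl; apply: sumr_ge0 => u _; exact: bary_ge0.
have g0 := height_gt0 g t; nra.
Qed.

Definition height_mix : height m := Height mix_continuous mix_gt0.

End Mix.
End Heights.

Section Prism.
Context (K : realType) (X : filteredSpace) (R : comPzRingType).
Notation n := (fdim X).

(** Cochains on X x ]0,oo[, as functions on all sets of blown-up vertices,
    meant to vanish off the cells ([hsupported]): since X x ]0,oo[ carries the
    filtration induced by X, the cells only depend on the simplex of X. *)
Definition hfamily := forall m, rsimplex K X m -> height K m -> {set bvert m n} -> R.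
Implicit Types theta : hfamily.

Definition hsupported theta := forall m (tau : rsimplex K X m) g B,
  ~~ is_cell (lvl tau) B -> theta m tau g B = 0.

(** Stated for faces of all codimensions at once, and up to extensional
    equality of heights. *)
Definition hcompatible theta :=
  forall k m (psi : 'I_k.+1 -> 'I_m.+1) (tau1 : rsimplex K X k)
    (g1 : height K k) (tau : rsimplex K X m) (g : height K m) B,
    incr psi -> subsimplex psi tau1 tau -> (forall t, g1 t = g (push psi t)) ->
    theta k tau1 g1 B = theta m tau g (vmap psi @: B)%SET.

Definition hdelta theta : hfamily := fun m tau g B =>
  if is_cell (lvl tau) B then dset (lvl tau) (theta m tau g) B else 0.

Section Simplex.
Context (m : nat) (v : 'I_m.+1) (tau : rsimplex K X m) (g : height K m).

Lemma prism_regular : regular_simplex (pull tau (@degen_mono m v)).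
Proof. by have [u uE] := rsimplexP tau; exists (lift (slot v) u); rewrite /= degen_lift. Qed.

Definition prism_simplex : rsimplex K X m.+1 := RSimplex prism_regular.

Definition prism_height : height K m.+1 :=
  height_mix (fun w => (v < w)%N) (height_pull (degen v) g).

Definition prism_set (B : {set bvert m n}) : {set bvert m.+1 n} :=
  (inl (slot v) |: vmap (lift (slot v)) @: B)%SET.

Implicit Types B : {set bvert m n}.

Lemma slot_notin B : inl (slot v) \notin (@vmap m m.+1 n (lift (slot v)) @: B)%SET.
Proof.
apply/imsetP => -[[u|i] _] // [e].
by move: e; rewrite /bump; lia.
Qed.

Lemma lvl_prism u : lvl tau u = lvl prism_simplex (lift (slot v) u).
Proof. by rewrite /= degen_lift. Qed.

Lemma prism_set_cell B : inl v \in B ->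
  is_cell (lvl prism_simplex) (prism_set B) = is_cell (lvl tau) B.
Proof.
move=> vB; rewrite -(is_cell_vmap lvl_prism).
apply: eq_forallb => i; apply/set0Pn/set0Pn => -[y]; rewrite !inE.
  case/andP => /predU1P[->|yB] yi; last by exists y; rewrite inE yB.
  exists (vmap (lift (slot v)) (inl v)); rewrite inE imset_f //=.
  by move: yi; rewrite /= degen_slot degen_lift.
by move=> /andP[yB yi]; exists y; rewrite !inE yB orbT.
Qed.

(** The top copy of v holds, with respect to the vertices other than v, the
    position of v itself. *)
Lemma twist_slot_l x : x != inl v ->
  twist (lvl prism_simplex) (inl (slot v)) (vmap (lift (slot v)) x) = twist (lvl tau) (inl v) x.
Proof.
move=> xv; rewrite /twist (blk_vmap lvl_prism) /= degen_slot.
congr (_ || (_ && ~~ _)); case: x xv => [u|i] //= uv.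
have {}uv : (u : nat) <> v by move=> /val_inj e; rewrite e eqxx in uv.
by rewrite /bump; lia.
Qed.

Lemma twist_slot_r x : x != inl v ->
  twist (lvl prism_simplex) (vmap (lift (slot v)) x) (inl (slot v)) = twist (lvl tau) x (inl v).
Proof.
move=> xv; rewrite twist_anti ?twist_slot_l ?[RHS]twist_anti //.
by apply: contraNneq (slot_notin [set x]) => <-; rewrite imset_f // inE.
Qed.

Lemma sgn_slot B : inl v \in B ->
  sgn (lvl prism_simplex) R (prism_set B) (inl (slot v)) = sgn (lvl tau) R B (inl v).
Proof.
move=> vB; rewrite sgnU1 ?slot_notin // twistxx.
rewrite /sgn /= degen_slot big_imset /=; last by move=> ? ? _ _ /(vmap_inj (incr_lift _)).
rewrite [in LHS](big_setD1 _ vB) [in RHS](big_setD1 _ vB) /= twistxx.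
rewrite [twist _ _ _](_ : _ = false) ?mul1r; last first.
  by rewrite /twist /= degen_lift degen_slot ltnn eqxx /= /bump; lia.
rewrite expr1 mulrCA; congr (_ * (_ * _)); apply: eq_bigr => x; rewrite !inE => /andP[xv _].
by rewrite twist_slot_r.
Qed.

Lemma sgn_prism B x : x != inl v ->
  sgn (lvl prism_simplex) R (prism_set B) (vmap (lift (slot v)) x) =
  (-1) ^+ twist (lvl tau) (inl v) x * sgn (lvl tau) R B x.
Proof.
by move=> xv; rewrite sgnU1 ?slot_notin // twist_slot_l // (sgn_vmap (incr_lift _) lvl_prism).
Qed.

Lemma sgn_prism_v B :
  sgn (lvl prism_simplex) R (prism_set B) (vmap (lift (slot v)) (inl v)) = - sgn (lvl tau) R B (inl v).
Proof.
rewrite sgnU1 ?slot_notin // (sgn_vmap (incr_lift _) lvl_prism) [twist _ _ _](_ : _ = true) ?mulN1r //.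
by rewrite /twist /= degen_lift degen_slot ltnn eqxx /= -leqNgt /bump; lia.
Qed.

Lemma prism_setD1 B x : x != inl v ->
  (prism_set B :\ vmap (lift (slot v)) x = prism_set (B :\ x))%SET.
Proof.
move=> xv; rewrite /prism_set -(vmap_setD1 (incr_lift _)).
apply/setP => y; rewrite !inE; have [->|//] := eqVneq y (inl (slot v)).
rewrite /= andbT; apply: contraNneq (slot_notin [set x]) => ->.
by rewrite imset_f // inE.
Qed.

Lemma prism_setD1_v B : inl v \in B ->
  (prism_set B :\ vmap (lift (slot v)) (inl v) =
   vmap (lift (widen_ord (leqnSn m.+1) v)) @: B)%SET.
Proof.
move=> vB; apply/setP => y; rewrite !inE; apply/andP/imsetP.
  case=> yv /predU1P[->|/imsetP[x xB yE]].
    exists (inl v) => //=; congr inl; apply: val_inj => /=; rewrite /bump; lia.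
  exists x => //; rewrite yE in yv *; case: x yv {yE xB} => [u|i] //= uv.
  have {}uv : (u : nat) <> v by move=> /val_inj e; rewrite e eqxx in uv.
  by congr inl; apply: val_inj; rewrite /= /bump /=; lia.
move=> [[u|i] xB ->] /=; last by split=> //; apply/imsetP; exists (inr i).
have [uv|uv] := eqVneq u v.
  rewrite uv; split; last by apply/orP; left; apply/eqP; congr inl; apply: val_inj; rewrite /= /bump; lia.
  by apply/eqP => -[]; rewrite /bump /=; lia.
have {}uv : (u : nat) <> v by move=> /val_inj e; rewrite e eqxx in uv.
split; first by apply/eqP => -[]; rewrite /bump /=; lia.
apply/orP; right; apply/imsetP; exists (inl u) => //; congr inl; apply: val_inj; rewrite /= /bump /=; lia.
Qed.

End Simplex.

(** The prism over a product of simplices is usually a sum over the factors.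
    Because the join decomposition is compatible with the order of the
    vertices, the term with the factors before that of v at the base, those
    after it at the top, and the factor of v broken at v, lives on the single
    simplex [prism_simplex v]; the apexes of the blown-up factors stay fixed. *)
Definition prism theta : hfamily := fun m tau g B =>
  \sum_(v | inl v \in B) sgn (lvl tau) R B (inl v) *
    theta m.+1 (prism_simplex v tau) (prism_height v g) (prism_set v B).

Lemma prism_supported theta : hsupported theta -> hsupported (prism theta).
Proof.
move=> st m tau g B cB; apply: big1 => v vB.
by rewrite st ?mulr0 // prism_set_cell.
Qed.

Lemma prism_compatible theta : hcompatible theta -> hcompatible (prism theta).
Proof.
move=> ct k m psi tau1 g1 tau g B psi_incr sub ge.
have [ef el] := sub.
rewrite /prism [RHS](eq_bigl (fun v => v \in psi @: [set v | inl v \in B])%SET); last first.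
  move=> v'; apply/imsetP/imsetP => [[[u|i] // uB [->]]|[u uB ->]].
    by exists u; rewrite // inE.
  by exists (inl u); rewrite // inE in uB.
rewrite big_imset /=; last by move=> ? ? _ _ /(incr_inj psi_incr).
apply: eq_big => [v|v vB]; first by rewrite inE.
rewrite -[inl (psi v)]/(vmap psi (inl v)) (sgn_vmap psi_incr el); congr (_ * _).
rewrite (ct _ _ (thick v psi) _ _ (prism_simplex (psi v) tau) (prism_height (psi v) g)).
- congr (theta _ _ _ _); rewrite /prism_set imsetU1 /= thick_slot; congr (_ |: _)%SET.
  by rewrite !vmap_comp; apply: eq_vmap => u /=; rewrite thick_lift.
- exact: thick_incr.
- split=> [t|u] /=; last by rewrite el degen_thick.
  by rewrite ef !push_comp; congr (tau _); apply: eq_push => u /=; rewrite degen_thick.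
- move=> t /=; rewrite /mix /= sum_push ge !push_comp.
  rewrite (@eq_push _ _ _ (degen (psi v) \o thick v psi) (psi \o degen v)); last first.
    by move=> u /=; rewrite degen_thick.
  by under [in RHS]eq_bigl do rewrite thick_gt //.
Qed.

End Prism.

Section PrismFormula.
Context (K : realType) (X : filteredSpace) (R : comPzRingType) (theta : hfamily K X R).
Hypothesis theta_comp : hcompatible theta.
Notation n := (fdim X).

Section Simplex.
Context (m : nat) (tau : rsimplex K X m) (g : height K m) (B : {set bvert m n}).

Notation T c := (theta tau (height_mix (fun u : 'I_m.+1 => (c <= u)%N) g) B).

Lemma hcompatible_ext (g' : height K m) : g =1 g' -> theta tau g B = theta tau g' B.
Proof.
move=> gg'; rewrite (@theta_comp _ _ id tau g tau g') ?vmap_id //.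
  by split=> // t; rewrite push_id.
by move=> t; rewrite push_id.
Qed.

(** Without the base copy of v in play, the face of the prism opposite the top
    copy of v is the base simplex with the vertices after v lifted. *)
Lemma prism_top (v : 'I_m.+1) :
  theta (prism_simplex v tau) (prism_height v g) (vmap (lift (slot v)) @: B)%SET = T v.+1.
Proof.
rewrite -(@theta_comp _ _ (lift (slot v)) tau (height_mix (fun u => (v.+1 <= u)%N) g)) //.
- exact: incr_lift.
- split=> [t|u] /=; last by rewrite degen_lift.
  by rewrite push_comp push_id // => u /=; rewrite degen_lift.
- move=> t /=; rewrite /mix /= sum_push push_comp [in RHS]push_id; last first.
    by move=> u /=; rewrite degen_lift.
  rewrite (eq_bigl (fun u => (v < lift (slot v) u)%N)) // => u.
  by rewrite lift_slot; case: (ltnP v u) => vu; [rewrite add1n ltnS ltnW|rewrite add0n ltnNge vu].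
Qed.

Lemma prism_bottom (v : 'I_m.+1) : inl v \in B ->
  theta (prism_simplex v tau) (prism_height v g)
    (prism_set v B :\ vmap (lift (slot v)) (inl v))%SET = T v.
Proof.
move=> vB; rewrite prism_setD1_v //.
rewrite -(@theta_comp _ _ (lift (widen_ord (leqnSn m.+1) v)) tau
   (height_mix (fun u => (v <= u)%N) g)) //.
- exact: (@incr_lift m).
- split=> [t|u] /=; last by rewrite degen_lift0.
  by rewrite push_comp push_id // => u /=; rewrite degen_lift0.
- move=> t /=; rewrite /mix /= sum_push push_comp [in RHS]push_id; last first.
    by move=> u /=; rewrite degen_lift0.
  rewrite (eq_bigl (fun u => (v < lift (widen_ord (leqnSn m.+1) v) u)%N)) // => u.
  by rewrite /= /bump; case: (leqP v u) => vu; [rewrite add1n ltnS vu|rewrite add0n ltnNge ltnW].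
Qed.

Lemma mix_last : T m.+1 = theta tau g B.
Proof.
symmetry; apply: hcompatible_ext => t /=; rewrite /mix big_pred0 ?subr0 ?mul1r ?addr0 // => u.
by rewrite leqNgt ltn_ord.
Qed.

Lemma mix_first : T 0 = theta tau (height1 K m) B.
Proof.
rewrite (@theta_comp _ _ id tau _ tau (height1 K m)) ?vmap_id //.
  by split=> // t; rewrite push_id.
move=> t /=; rewrite /mix /= (_ : \sum_(u | _) _ = 1) ?subrr ?mul0r ?add0r //.
by rewrite -(bary_sum t); apply: eq_bigl.
Qed.

End Simplex.

(** The two heights agree on the face opposite v, which carries all the
    vertices of B. *)
Lemma mix_step m (tau : rsimplex K X m) (g : height K m) B (v : 'I_m.+1) :
  is_cell (lvl tau) B -> inl v \notin B ->
  theta tau (height_mix (fun u => (v.+1 <= u)%N) g) B =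
  theta tau (height_mix (fun u => (v <= u)%N) g) B.
Proof.
move=> cB vB; have [u uB uE] := cell_top cB.
have uv : u != v by apply: contraNneq vB => <-.
case: m => [|m] in tau g B v cB vB u uB uE uv *; first by rewrite !ord1 eqxx in uv.
have [u' u'E] : exists u', u = lift v u'.
  by case: (unliftP v u) uv => [u' ->|->]; [exists u'|rewrite eqxx].
have h : regular_simplex (face tau v) by exists u'; rewrite /= -u'E.
pose B0 := (@vmap _ _ n (lift v) @^-1: B)%SET.
have -> : B = (vmap (lift v) @: B0)%SET.
  apply/setP => y; apply/idP/imsetP => [yB|[x]]; last by rewrite inE => xB ->.
  case: y yB => [w|i] yB; last by exists (inr i); rewrite // inE.
  case: (unliftP v w) yB => [w' ->|->]; last by rewrite (negPf vB).
  by move=> yB; exists (inl w'); rewrite // inE.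
rewrite -!(@theta_comp _ _ (lift v) (rface h) (height_pull (lift v) (height_mix (fun u => (v <= u)%N) g))) //.
- exact: incr_lift.
- exact: subsimplex_face.
- exact: incr_lift.
- exact: subsimplex_face.
move=> t /=; rewrite /mix !sum_push; congr ((1 - _) * _ + _); apply: eq_bigl => w /=;
  rewrite /bump; case: (leqP v w) => vw; rewrite ?add1n ?add0n ?ltnS;
  by [rewrite vw leqW | move: vw; case: (ltngtP v w)].
Qed.

(** The two faces of a prism cell omitting a copy of v are cells of simplices
    with mixed heights, lifted from v+1 on and from v on: their differences
    telescope to the two ends of the homotopy.  The remaining terms cancel
    because [twist] is antisymmetric. *)
Lemma prism_formula m (tau : rsimplex K X m) (g : height K m) B : is_cell (lvl tau) B ->
  hdelta (prism theta) tau g B + prism (hdelta theta) tau g B =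
  theta tau g B - theta tau (height1 K m) B.
Proof.
move=> cB; pose T c := theta tau (height_mix (fun u : 'I_m.+1 => (c <= u)%N) g) B.
have -> : theta tau g B - theta tau (height1 K m) B =
    \sum_(v | inl v \in B) (T v.+1 - T v).
  have <- : T m.+1 = theta tau g B := mix_last tau g B.
  have <- : T 0%N = theta tau (height1 K m) B := mix_first tau g B.
  rewrite [RHS]big_mkcond /=.
  rewrite -(telescope_sumr T (leq0n m.+1)) big_mkord; apply: eq_bigr => v _.
  by case: ifPn => // vB; rewrite /T mix_step ?subrr.
rewrite /hdelta cB /dset.
under eq_bigr do rewrite /prism mulr_sumr.
(* Collect all the terms living on the prism over the same vertex v. *)
rewrite (exchange_big_dep (fun v => inl v \in B)) /=; last first.
  by move=> x v xB; rewrite !inE => /andP[].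
rewrite /prism -big_split; apply: eq_bigr => v vB /=.
set S := sgn (lvl tau) R B.
have -> : \sum_(x in B | inl v \in (B :\ x)%SET) S x * (sgn (lvl tau) R (B :\ x)%SET (inl v) *
    theta (prism_simplex v tau) (prism_height v g) (prism_set v (B :\ x)%SET)) =
  \sum_(x in (B :\ inl v)%SET) S x * ((-1) ^+ twist (lvl tau) x (inl v) * S (inl v) *
    theta (prism_simplex v tau) (prism_height v g) (prism_set v (B :\ x)%SET)).
  apply: eq_big => [x|x /andP[xB _]]; first by rewrite !inE vB andbT andbC eq_sym.
  rewrite /S (sgnD1 _ _ (inl v) xB); congr (_ * (_ * _)).
  by rewrite mulrA -expr2 sqrr_sign mul1r.
rewrite prism_set_cell // cB /dset big_setU1 ?slot_notin //=.
rewrite big_imset /=; last by move=> ? ? _ _ /(vmap_inj (incr_lift _)).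
rewrite sgn_slot // finset.setU1K ?slot_notin // -[fun u : 'I_m.+2 => lvl tau (degen v u)]/(lvl (prism_simplex v tau)).
rewrite [X in _ * (_ + X)](big_setD1 (inl v)) // sgn_prism_v prism_top // prism_bottom //.
rewrite -/(S (inl v)) addrC; have SS : S (inl v) * S (inl v) = 1 := sgn_sqr _ _ _ _.
rewrite [X in X + _](_ : _ = T v.+1 - T v + S (inl v) * \sum_(x in (B :\ inl v)%SET)
    sgn (lvl (prism_simplex v tau)) R (prism_set v B) (vmap (lift (slot v)) x) *
    theta (prism_simplex v tau) (prism_height v g)
      (prism_set v B :\ vmap (lift (slot v)) x)%SET); last first.
  by rewrite /= !mulrDr mulrA SS mul1r mulNr mulrN mulrA SS mul1r addrA.
rewrite -addrA [X in _ + X](_ : _ = 0) ?addr0 // mulr_sumr -big_split big1 //= => x.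
rewrite !inE => /andP[xv xB].
rewrite sgn_prism // prism_setD1 // (twist_sum _ _ xv) -/(S x).
set a := (-1) ^+ _; set b := S x; set c := S (inl v); set d := theta _ _ _.
ring.
Qed.

End PrismFormula.

(** * Simplices of the open cone *)

Section ConeTopology.
Context (K : realType) (X : topologicalType).
Local Open Scope classical_set_scope.

Lemma cvg_cone_pt (T : topologicalType) (f : T -> X) (g : T -> halfline K) (x : T) :
  f y @[y --> x] --> f x -> val (g y) @[y --> x] --> val (g x) ->
  cone_pt (f y) (g y) @[y --> x] --> cone_pt (f x) (g x).
Proof.
move=> hf /cvg_set_type hg.
apply: (@continuous_comp T (X * halfline K)%type (cone K X) (fun y => (f y, g y)) \pi_(cone K X)%qT x).
  by apply: (@cvg_pair _ _ _ _ (nbhs (f x)) (nbhs (g x))).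
exact: pi_continuous.
Qed.

Lemma cone_eta (z : cone K X) : z = cone_pt (cone_pr z) (halfline_pt (cone_ht_ge0 z)).
Proof.
by rewrite -{1}(reprK z) /cone_pt /cone_pr [in LHS](surjective_pairing (repr z));
  congr (\pi_(cone K X)%qT (_, _)); exact: val_inj.
Qed.

(** Away from the apex the open cone is the product X x ]0,oo[. *)
Lemma cone_pr_cvg (z : cone K X) : 0 < cone_ht z -> cone_pr y @[y --> z] --> cone_pr z.
Proof.
move=> z0 U; rewrite nbhsE => -[V [oV Vz VU]].
have : nbhs z [set z | 0 < cone_ht z /\ V (cone_pr z)].
  by apply: open_nbhs_nbhs; split; [exact: cone_pr_open|].
by apply: filterS => v /= [_ /VU].
Qed.

(** For X compact, a neighbourhood of the apex contains all the points of
    small height (tube lemma), so that only the height has to be controlled. *)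
Lemma cvg_cone_apex (T : topologicalType) (f : T -> cone K X) (x : T) :
  compact [set: X] -> cone_ht (f x) = 0 ->
  cone_ht (f y) @[y --> x] --> 0 -> f y @[y --> x] --> f x.
Proof.
move=> cX fx0 hh U Ux.
have [V [oV Vx] VU] : exists2 V, open_nbhs (f x) V & V `<=` U by move: Ux; rewrite nbhsE.
pose h y := halfline_pt (cone_ht_ge0 (f y)).
have hcvg : h y @[y --> x] --> h x by apply: cvg_set_type; rewrite /h /= fx0.
have : \forall s \near h x, [set: X] `<=` (fun x' => V (cone_pt x' s)).
  have nc := (compact_near_coveringP _).1 cX.
  apply: (nc _ (nbhs (h x)) (fun s x' => V (cone_pt x' s))) => x' _.
  have : nbhs (x', h x) [set a : X * halfline K | V (cone_pt a.1 a.2)].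
    apply: open_nbhs_nbhs; split; first exact/cone_openE.
    rewrite /= (_ : cone_pt _ _ = f x) // [RHS]cone_eta; apply/cone_pt_eq; right.
    by rewrite /= fx0.
  exact.
move=> /hcvg nh; have {}nh : nbhs x [set y | [set: X] `<=` (fun x' => V (cone_pt x' (h y)))] by [].
apply: (@filterS T (nbhs x) _ _ (f @^-1` U) _ nh) => y /= hy; apply: VU.
by rewrite [f y]cone_eta; exact: hy.
Qed.

End ConeTopology.

Section ConeSkeleton.
Context (K : realType) (X : filteredSpace).

Lemma cone_skel0 (z : open_cone K X) : skel (open_cone K X) 0 z <-> cone_ht z = 0.
Proof.
rewrite [z]cone_eta /= /cone_skel subconeE /= cone_htE /=.
by split=> [[]|]; [|by []|left].
Qed.

Lemma cone_skelS i (z : open_cone K X) : 0 < cone_ht z ->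
  skel (open_cone K X) i.+1 z <-> skel X i (cone_pr z).
Proof.
move=> z0; rewrite {1}[z]cone_eta /= /cone_skel subconeE /=.
by split=> [[z00|//]|]; [rewrite z00 ltxx in z0|right].
Qed.

End ConeSkeleton.

Section CylSimplex.
Context (K : realType) (X : filteredSpace) (m : nat).
Local Open Scope classical_set_scope.

Section Fsimplex.
Context (tau : fsimplex K X m) (g : height K m).

Let cmap (t : stdsimplex K m) : open_cone K X :=
  cone_pt (tau t) (halfline_pt (ltW (height_gt0 g t))).
Let clvl (v : 'I_m.+1) : 'I_(fdim (open_cone K X)).+1 := lift ord0 (lvl tau v).

Lemma cyl_simplex_continuous : continuous cmap.
Proof.
move=> t; apply: (@cvg_cone_pt K X (stdsimplex K m) tau
  (fun t => halfline_pt (ltW (height_gt0 g t)))).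
  exact: smap_continuous.
exact: height_continuous.
Qed.

Lemma cyl_lvl_mono : {homo clvl : u v / (u <= v)%N}.
Proof. exact: iota_lvl_mono. Qed.

Lemma cyl_skel (i : nat) (t : stdsimplex K m) : (i <= (fdim X).+1)%N ->
  skel (open_cone K X) i (cmap t) <->
  (forall v, val t ord0 v != 0 -> (clvl v <= i)%N).
Proof.
move=> iX; rewrite -(iota_skel tau t iX).
rewrite /iota /= /cone_skel !subconeE; apply: or_iff_compat_r; split=> /= h.
  by have := height_gt0 g t; rewrite h ltxx.
by have := @ltr01 K; rewrite h ltxx.
Qed.

(** The simplex of X x ]0,oo[ given by tau and g, seen in the open cone. *)
Definition cyl_fsimplex : fsimplex K (open_cone K X) m :=
  @FSimplex K (open_cone K X) m cmap clvl cyl_simplex_continuous cyl_lvl_mono cyl_skel.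

End Fsimplex.

Lemma cyl_regular (tau : rsimplex K X m) (g : height K m) :
  regular_simplex (cyl_fsimplex tau g).
Proof.
have [v sv] := rsimplexP tau; exists v; apply: val_inj => /=.
by rewrite sv.
Qed.

Definition cyl_simplex (tau : rsimplex K X m) (g : height K m) :
  rsimplex K (open_cone K X) m := RSimplex (cyl_regular tau g).

End CylSimplex.

Section Base.
Context (K : realType) (X : filteredSpace) (m : nat) (s : fsimplex K (open_cone K X) m).
Local Open Scope classical_set_scope.

Lemma apex_simplexP t : cone_ht (s t) = 0 <-> forall v, bary t v != 0 -> lvl s v = ord0.
Proof.
rewrite -cone_skel0 smap_skel //; split=> h v tv; last by rewrite h.
by apply: val_inj; apply/eqP; rewrite -leqn0; exact: h.
Qed.

Hypothesis lvl_gt0 : forall v, (0 < lvl s v)%N.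

Lemma base_ht_gt0 t : 0 < cone_ht (s t).
Proof.
rewrite lt_neqAle cone_ht_ge0 andbT eq_sym; apply/eqP => /apex_simplexP h.
have [v tv] := stdsimplex_neq0 t.
by have := lvl_gt0 v; rewrite h.
Qed.

(** Levels in the cone are those in X shifted by one; all levels are positive
    here, so the predecessor is the inverse shift. *)
Definition base_lvl v : 'I_(fdim X).+1 := inord (lvl s v).-1.

Lemma base_lvlE v : lvl s v = lift ord0 (base_lvl v).
Proof.
have e := prednK (lvl_gt0 v); have h : ((lvl s v).-1 < (fdim X).+1)%N.
  by rewrite -ltnS e ltn_ord.
by apply: val_inj; rewrite /= /bump /= inordK // add1n e.
Qed.

Let bmap t : X := cone_pr (s t).

Lemma base_continuous : continuous bmap.
Proof.
move=> t; apply: (@continuous_comp (stdsimplex K m) (open_cone K X) X s (@cone_pr K X)).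
  exact: smap_continuous.
exact: cone_pr_cvg (base_ht_gt0 t).
Qed.

Lemma base_lvl_mono : {homo base_lvl : u v / (u <= v)%N}.
Proof. by move=> u v /(lvl_mono s); rewrite !base_lvlE leq_bump2. Qed.

Lemma base_skel (i : nat) (t : stdsimplex K m) : (i <= fdim X)%N ->
  skel X i (bmap t) <-> (forall v, val t ord0 v != 0 -> (base_lvl v <= i)%N).
Proof.
move=> iX; rewrite -cone_skelS ?base_ht_gt0 // smap_skel //.
by split=> h v /h; rewrite base_lvlE /= /bump /= add1n ltnS.
Qed.

(** The projection to X of a simplex avoiding the apex; with [base_height] it
    recovers the simplex. *)
Definition base_fsimplex : fsimplex K X m :=
  FSimplex base_continuous base_lvl_mono base_skel.

Lemma base_height_continuous : continuous (fun t => cone_ht (s t)).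
Proof.
move=> t; apply: (@continuous_comp (stdsimplex K m) (open_cone K X) K s (@cone_ht K X)).
  exact: smap_continuous.
exact: cone_ht_continuous.
Qed.

Definition base_height : height K m := Height base_height_continuous base_ht_gt0.

Lemma base_regular : regular_simplex s -> regular_simplex base_fsimplex.
Proof.
move=> [v sv]; exists v; apply: (@lift_inj _ ord0); rewrite -base_lvlE sv.
exact: val_inj.
Qed.

End Base.

Section Link.
Context (K : realType) (X : filteredSpace) (m : nat) (s : rsimplex K (open_cone K X) m).

Lemma lvl_last : (0 < lvl s ord_max)%N.
Proof.
have [v sv] := rsimplexP s.
by apply: (@leq_trans (lvl s v)); [rewrite sv|apply: lvl_mono; rewrite -ltnS].
Qed.

(** Levels are nondecreasing, so the vertices off the apex are those from
    [link_first] on; the default [ord_max] is one of them by regularity. *)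
Definition link_first : 'I_m.+1 :=
  fintype.arg_min ord_max (fun v => (0 < lvl s v)%N) (@nat_of_ord m.+1).

Lemma link_firstP v : (0 < lvl s v)%N = (link_first <= v)%N.
Proof.
rewrite /link_first; case: arg_minnP; first exact: lvl_last.
move=> d d0 dmin; apply/idP/idP; first exact: dmin.
by move=> dv; apply: leq_trans d0 _; exact: lvl_mono.
Qed.

Notation k := (m - link_first)%N.

Definition link_vert (u : 'I_k.+1) : 'I_m.+1 := inord (link_first + u).

Lemma link_vertE u : link_vert u = (link_first + u)%N :> nat.
Proof. by rewrite /link_vert inordK //; have := ltn_ord u; have := ltn_ord link_first; lia. Qed.

Lemma link_incr : incr link_vert.
Proof. by move=> u v; rewrite !link_vertE ltn_add2l. Qed.

Lemma link_vert_gt0 u : (0 < lvl s (link_vert u))%N.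
Proof. by rewrite link_firstP link_vertE leq_addr. Qed.

Lemma link_vert_surj v : (0 < lvl s v)%N -> exists u, v = link_vert u.
Proof.
rewrite link_firstP => dv; have vk : (v - link_first < k.+1)%N by have := ltn_ord v; lia.
by exists (Ordinal vk); apply: val_inj; rewrite /= link_vertE /= subnKC.
Qed.

Lemma link_mono : {homo link_vert : u v / (u <= v)%N}.
Proof. by move=> u v; rewrite (incr_leq link_incr). Qed.

(** The face Delta_1 * ... * Delta_(n+1) of s, which is the largest one avoiding
    the apex. *)
Definition link : fsimplex K (open_cone K X) k := pull s link_mono.

Lemma link_regular : regular_simplex link.
Proof.
have [v sv] := rsimplexP s; have v0 : (0 < lvl s v)%N by rewrite sv.
by have [u uE] := link_vert_surj v0; exists u; rewrite /= -uE.
Qed.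

Definition link_base : rsimplex K X k :=
  RSimplex (@base_regular K X k link link_vert_gt0 link_regular).

Definition link_height : height K k := @base_height K X k link link_vert_gt0.

Lemma lvl_link u : lvl s (link_vert u) = lift ord0 (lvl link_base u).
Proof. exact: (@base_lvlE K X k link link_vert_gt0). Qed.

End Link.
Arguments link_vert {K X m} s u.
Arguments link_incr {K X m} s.

(** * Inserting a vertex in the first factor *)

Section FirstFactor.
Context (m n : nat) (lv : 'I_m.+1 -> 'I_n.+1) (R : comPzRingType).
Implicit Types (B : {set bvert m n}) (x y z : bvert m n).
Notation blk := (blk lv).

Definition away B : {set bvert m n} := [set x in B | blk x != ord0]%SET.

Lemma sgn_single B x : factor lv B ord0 = [set x]%SET -> sgn lv R B x = 1.
Proof.
move=> Bx; have : x \in factor lv B ord0 by rewrite Bx inE.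
rewrite inE => /andP[xB /eqP x0]; rewrite /sgn (big_setD1 x) //= twistxx x0.
rewrite big1 ?mulr1 ?expr1 ?mulrN1 ?opprK // => y; rewrite !inE => /andP[yx yB].
have y0 : blk y != ord0.
  apply: contra yx => y0; have : y \in factor lv B ord0 by rewrite inE yB.
  by rewrite Bx inE.
by rewrite /twist x0 ltn0 (negPf y0).
Qed.

Lemma factorD1 B x i : factor lv (B :\ x)%SET i =
  if i == blk x then (factor lv B i :\ x)%SET else factor lv B i.
Proof.
apply/setP => y; case: eqP => [->|ix]; rewrite !inE ?andbA //.
by case: (eqVneq y x) => //= ->; move/eqP/negPf: ix => ix; rewrite eq_sym ix andbF.
Qed.

Lemma factorU1 B z i : factor lv (z |: B)%SET i =
  if i == blk z then (z |: factor lv B i)%SET else factor lv B i.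
Proof.
apply/setP => y; case: eqP => [->|iz]; rewrite !inE.
  by case: (eqVneq y z) => //= ->; rewrite eqxx.
by case: (eqVneq y z) => //= ->; move/eqP/negPf: iz => iz; rewrite eq_sym iz andbF.
Qed.

Lemma cell_setD1 B x : is_cell lv B -> x \in B ->
  is_cell lv (B :\ x)%SET = (#|factor lv B (blk x)| != 1%N).
Proof.
move=> /is_cellP cB xB.
have xf : x \in factor lv B (blk x) by rewrite inE xB eqxx.
have -> : (#|factor lv B (blk x)| != 1%N) = (factor lv B (blk x) :\ x != finset.set0)%SET.
  by rewrite -card_gt0 (cardsD1 x) xf; case: #|_|.
apply/is_cellP/idP => [/(_ (blk x))|h i]; first by rewrite factorD1 eqxx.
by rewrite factorD1; case: (i =P blk x) => // ->.
Qed.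

Lemma cell_setU1 B z : is_cell lv B -> is_cell lv (z |: B)%SET.
Proof.
move=> /is_cellP cB; apply/is_cellP => i; rewrite factorU1; case: (i =P blk z) => // _.
by apply/set0Pn; exists z; rewrite !inE eqxx.
Qed.

(** Adding z can only fill the factor of z, which does not lose x. *)
Lemma cell_exchange B x z : is_cell lv B -> x \in B -> blk x != blk z ->
  is_cell lv (z |: B :\ x)%SET -> is_cell lv (B :\ x)%SET.
Proof.
move=> /is_cellP cB xB xz /is_cellP h; apply/is_cellP => i.
have := h i; rewrite factorU1; case: (i =P blk z) => // -> _.
by rewrite factorD1 [blk z == _]eq_sym (negPf xz).
Qed.

(** The defect of [dset_insert] on functions that vanish off the cells comes
    from the x whose removal empties the first factor while z refills it: that
    is the case exactly when x is the whole first factor, and the sign of this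
    term is 1 by [sgn_single]. *)
Lemma insert_formula (f : {set bvert m n} -> R) B z :
  (forall B, ~~ is_cell lv B -> f B = 0) -> is_cell lv B -> z \notin B -> blk z = ord0 ->
  sgn lv R (z |: B)%SET z * dset lv f (z |: B)%SET +
  \sum_(x in B) sgn lv R B x *
    (if is_cell lv (B :\ x)%SET then sgn lv R (z |: B :\ x)%SET z * f (z |: B :\ x)%SET else 0) =
  f B - (if #|factor lv B ord0| == 1%N then f (z |: away B)%SET else 0).
Proof.
move=> f0 cB zB z0; pose T x := sgn lv R (z |: B :\ x)%SET z * f (z |: B :\ x)%SET.
(* The defect term has sign 1 and forgets the first factor of B. *)
have single x0 : factor lv B ord0 = [set x0]%SET ->
    x0 \in B /\ sgn lv R B x0 * T x0 = f (z |: away B)%SET.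
  move=> Bx; have : x0 \in factor lv B ord0 by rewrite Bx inE.
  rewrite inE => /andP[xB /eqP x0b].
  have -> : away B = (B :\ x0)%SET.
    apply/setP => y; rewrite !inE andbC; case: (boolP (y \in B)) => yB; rewrite ?andbF //= !andbT.
    congr (~~ _); have : (y \in factor lv B ord0) = (y == x0) by rewrite Bx inE.
    by rewrite inE yB.
  split=> //; rewrite /T !sgn_single ?mul1r //.
  by rewrite factorU1 factorD1 z0 x0b eqxx Bx finset.setDv finset.setU0.
rewrite -(dset_insert lv f zB) -addrA; congr (_ + _).
have [/cards1P[x0 x0E]|B0] := boolP (#|factor lv B ord0| == 1%N).
  have [xB <-] := single _ x0E; rewrite -/(T _) [LHS](big_setD1 x0) // [X in _ = X - _](big_setD1 x0) //=.
  have bx : blk x0 = ord0.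
    have : x0 \in factor lv B ord0 by rewrite x0E inE.
    by rewrite inE => /andP[_ /eqP].
  rewrite cell_setD1 // bx x0E cards1 mulr0 add0r [RHS]addrAC subrr add0r.
  apply: eq_bigr => x; rewrite !inE => /andP[xx xB'].
  case: ifPn => // ncx; rewrite f0 ?mulr0 //.
  apply: contra ncx; apply: cell_exchange => //.
  apply: contra xx; rewrite z0 => xb.
  have : x \in factor lv B ord0 by rewrite inE xB'.
  by rewrite x0E inE.
rewrite subr0; apply: eq_bigr => x xB; case: ifPn => // ncx.
rewrite f0 ?mulr0 //; apply: contra ncx => h.
have [xb|xb] := eqVneq (blk x) ord0; first by rewrite cell_setD1 // xb.
by apply: cell_exchange h; rewrite ?z0.
Qed.

End FirstFactor.

(** * Extension of cochains from the link *)

Section Trace.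
Context (K : realType) (X : filteredSpace) (m : nat) (s : rsimplex K (open_cone K X) m).
Notation n := (fdim X).
Notation cX := (open_cone K X).
Notation d := (m - link_first s)%N.
Notation lvb := (lvl (link_base s)).

Implicit Types B : {set bvert m n.+1}.

(** Identifies the blown-up vertices of the link, as a simplex of X, with
    those of s outside the first factor. *)
Definition linkmap (x : bvert d n) : bvert m n.+1 := vmap (link_vert s) (iota_vert x).

Lemma linkmap_inj : injective linkmap.
Proof. by move=> x y /(vmap_inj (link_incr s)) /iota_vert_inj. Qed.

Lemma blk_linkmap x : blk (lvl s) (linkmap x) = lift ord0 (blk lvb x).
Proof. by rewrite /linkmap -(blk_iota lvb) (@blk_vmap _ _ _ _ (fun v => lift ord0 (lvb v))) // => u; rewrite lvl_link. Qed.

Lemma linkmap_onto y : blk (lvl s) y != ord0 -> exists x, y = linkmap x.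
Proof.
case: y => [v|i] /= h.
  have [|u ->] := @link_vert_surj K X m s v; last by exists (inl u).
  by rewrite lt0n; apply: contra h => /eqP h; apply/eqP/val_inj.
case: (unliftP ord0 i) h => [j -> _|->]; first by exists (inr j).
by rewrite (_ : widen_ord _ _ = ord0) ?eqxx //; apply: val_inj.
Qed.

Lemma twist_linkmap x y : twist (lvl s) (linkmap x) (linkmap y) = twist lvb x y.
Proof.
rewrite /twist !blk_linkmap !lift0 ltnS (inj_eq lift_inj); congr (_ || (_ && ~~ _)).
by case: x y => [u|i] [v|j] //=; rewrite (link_incr s).
Qed.

Definition trace B : {set bvert d n} := (linkmap @^-1: B)%SET.

Lemma away_trace B : away (lvl s) B = (linkmap @: trace B)%SET.
Proof.
apply/setP => y; rewrite inE; apply/andP/imsetP => [[yB y0]|[x xB ->]].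
  by have [x xE] := linkmap_onto y0; exists x => //; rewrite inE -xE.
by rewrite inE in xB; split=> //; rewrite blk_linkmap.
Qed.

Lemma trace_image (C : {set bvert d n}) : trace (linkmap @: C)%SET = C.
Proof. by apply/setP => x; rewrite inE mem_imset //; exact: linkmap_inj. Qed.

Lemma trace_away B : trace (away (lvl s) B) = trace B.
Proof. by rewrite away_trace trace_image. Qed.

Lemma factor_trace B i : factor (lvl s) B (lift ord0 i) = (linkmap @: factor lvb (trace B) i)%SET.
Proof.
apply/setP => y; rewrite inE; apply/andP/imsetP => [[yB /eqP yi]|[x]].
  have [|x xE] := @linkmap_onto y; first by rewrite yi.
  exists x => //; rewrite !inE -xE yB /= -(inj_eq (@lift_inj _ ord0)) -blk_linkmap -xE.
  exact/eqP.
by rewrite !inE => /andP[xB /eqP xi] ->; rewrite blk_linkmap xi.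
Qed.

Lemma fdeg_trace B i : fdeg (lvl s) B (lift ord0 i) = fdeg lvb (trace B) i.
Proof. by rewrite /fdeg factor_trace card_imset //; exact: linkmap_inj. Qed.

Lemma is_cell_trace B : #|factor (lvl s) B ord0| = 1%N ->
  is_cell (lvl s) B = is_cell lvb (trace B).
Proof.
move=> B1; apply/is_cellP/is_cellP => h i.
  by have := h (lift ord0 i); rewrite factor_trace imset_eq0.
case: (unliftP ord0 i) => [j ->|->]; first by rewrite factor_trace imset_eq0.
by rewrite -card_gt0 B1.
Qed.

Lemma split_single B z : factor (lvl s) B ord0 = [set z]%SET ->
  [/\ z \in B, blk (lvl s) z = ord0, z \notin away (lvl s) B & B = (z |: away (lvl s) B)%SET].
Proof.
move=> Bz; have : z \in factor (lvl s) B ord0 by rewrite Bz inE.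
rewrite inE => /andP[zB /eqP z0]; split=> //; first by rewrite inE z0 eqxx andbF.
apply/setP => y; rewrite !inE; have : (y \in factor (lvl s) B ord0) = (y == z) by rewrite Bz inE.
by rewrite inE; case: (eqVneq y z) => [->|] /=; [rewrite zB|case: (y \in B) => //= _ ->].
Qed.

(** The unique vertex of the first factor contributes one sign, which is
    absorbed by the shift of the blocks by one. *)
Lemma sgn_linkmap (R : comPzRingType) B x : #|factor (lvl s) B ord0| = 1%N ->
  sgn (lvl s) R B (linkmap x) = sgn lvb R (trace B) x.
Proof.
move=> /eqP/cards1P[z Bz]; have [zB z0 zA ->] := split_single Bz.
rewrite sgnU1 // [twist _ _ _](_ : _ = true) ?expr1; last by rewrite /twist z0 blk_linkmap.
have -> : trace (z |: away (lvl s) B)%SET = trace B.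
  by rewrite -(trace_away B); apply/setP => y; rewrite !inE; case: eqP => // yz; rewrite -yz blk_linkmap in z0.
rewrite away_trace /sgn blk_linkmap lift0 big_imset /=; last by move=> ? ? _ _ /linkmap_inj.
rewrite exprS !mulN1r mulNr opprK; congr (_ * _).
by apply: eq_bigr => y _; rewrite twist_linkmap.
Qed.

Lemma trace_setD1 B x : trace (B :\ linkmap x)%SET = (trace B :\ x)%SET.
Proof. by apply/setP => y; rewrite !inE (inj_eq linkmap_inj). Qed.

Lemma trace_setD1_0 B z : blk (lvl s) z = ord0 -> trace (B :\ z)%SET = trace B.
Proof. by move=> z0; apply/setP => y; rewrite !inE; case: eqP => // yz; rewrite -yz blk_linkmap in z0. Qed.

End Trace.

Section Extension.
Context (K : realType) (X : filteredSpace) (R : comPzRingType).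
Notation n := (fdim X).
Notation cX := (open_cone K X).

(** The tensor product of the cochain theta on the link with the unit cochain 1
    of the first factor N^*(c Delta_0); 1 is the sum of 1_x over the vertices x
    of c Delta_0. *)
Definition extend (theta : hfamily K X R) : family K cX R := fun m s =>
  [ffun b : cell (lvl s) => if #|factor (lvl s) (val b) ord0| == 1%N
     then theta _ (link_base s) (link_height s) (trace s (val b)) else 0].

Section Supported.
Context (theta : hfamily K X R).
Hypothesis theta_supp : hsupported theta.

Lemma coef0_extend m (s : rsimplex K cX m) B :
  coef0 (extend theta s) B = if #|factor (lvl s) B ord0| == 1%N
     then theta (link_base s) (link_height s) (trace s B) else 0.
Proof.
have [cB|cB] := boolP (is_cell (lvl s) B).
  by rewrite /coef0 insubT ffunE.
by rewrite coef0_not //; case: eqP => // B1; rewrite theta_supp // -is_cell_trace.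
Qed.

(** Since 1 is a cocycle: when the first factor is an edge, its two ends
    contribute opposite terms. *)
Lemma delta_extend : delta (extend theta) = extend (hdelta theta).
Proof.
apply: Defs.familyP => m s; apply/ffunP => b; rewrite -[LHS]coef0_cell.
rewrite cobord_dset ?valP // ffunE.
set B := val b; have cB : is_cell (lvl s) B by exact: valP.
have card0 x : x \in B -> #|factor (lvl s) (B :\ x)%SET ord0| =
   (#|factor (lvl s) B ord0| - (blk (lvl s) x == ord0))%N.
  move=> xB; rewrite factorD1 eq_sym; case: eqP => x0 /=; last by rewrite subn0.
  by rewrite (cardsD1 x (factor _ _ _)) inE xB x0 eqxx addKn.
rewrite /dset; under eq_bigr do rewrite coef0_extend.
have [/eqP B1|B1] := ifPn.
  rewrite /hdelta -is_cell_trace // cB /dset.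
  have [z Bz] := cards1P (introT eqP B1); have [zB z0 zA BE] := split_single Bz.
  rewrite (big_setD1 z) //= card0 // B1 z0 /= mulr0 add0r.
  have -> : (B :\ z = linkmap (s := s) @: trace s B)%SET.
    by rewrite -away_trace {1}BE finset.setU1K.
  rewrite big_imset /=; last by move=> ? ? _ _ /linkmap_inj.
  apply: eq_bigr => x; rewrite inE => xB.
  by rewrite card0 // B1 blk_linkmap subn0 eqxx sgn_linkmap // trace_setD1.
have [/cards2P[x [y [xy Bxy]]]|B2] := boolP (#|factor (lvl s) B ord0| == 2%N).
  have xB : x \in factor (lvl s) B ord0 by rewrite Bxy !inE eqxx.
  have yB : y \in factor (lvl s) B ord0 by rewrite Bxy !inE eqxx orbT.
  move: xB yB; rewrite !inE => /andP[xB /eqP x0] /andP[yB /eqP y0].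
  have yB' : y \in (B :\ x)%SET by rewrite !inE eq_sym xy.
  rewrite (big_setD1 x) //= (big_setD1 y) //= !card0 // x0 y0 Bxy cards2 xy /=.
  rewrite !trace_setD1_0 // addrA -mulrDl big1 ?addr0 => [|w].
    have sgn2 u v : u != v -> [set u; v]%SET = factor (lvl s) B ord0 ->
        sgn (lvl s) R B u = (-1) ^+ twist (lvl s) v u.
      move=> uv Buv.
      have : v \in factor (lvl s) B ord0 by rewrite -Buv !inE eqxx orbT.
      rewrite inE => /andP[vB v0]; rewrite (sgnD1 _ _ _ vB) (@sgn_single _ _ _ _ _ u) ?mulr1 //.
      rewrite factorD1 (eqP v0) eqxx -Buv; apply/setP => w; rewrite !inE.
      by case: (eqVneq w v) => [->|]; rewrite ?orbF // eq_sym (negPf uv).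
    have yx : y != x by rewrite eq_sym.
    have Byx : [set y; x]%SET = factor (lvl s) B ord0 by rewrite Bxy finset.setUC.
    by rewrite (sgn2 x y) // (sgn2 y x) // (twist_sum _ _ yx) addNr mul0r.
  rewrite !inE => /andP[wy /andP[wx wB]]; rewrite card0 // Bxy cards2 xy.
  have : (w \in factor (lvl s) B ord0) = false by rewrite Bxy !inE (negPf wy) (negPf wx).
  by rewrite inE wB /= => ->; rewrite subn0 mulr0.
(* The first factor of B has at least three vertices, so that of any face has at least two. *)
apply: big1 => x xB; rewrite card0 //.
have B0 : (0 < #|factor (lvl s) B ord0|)%N by rewrite card_factor.
by rewrite ifN ?mulr0 //; move: B0 B1 B2; case: (_ == ord0); lia.
Qed.

End Supported.

(** A value of theta on a simplex with height coming from any face of s that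
    avoids the apex is a value on the link of s. *)
Lemma link_eval (theta : hfamily K X R) m (s : rsimplex K cX m) k
    (phi : 'I_k.+1 -> 'I_m.+1) (tau : rsimplex K X k) (g : height K k) B :
  hcompatible theta -> incr phi ->
  (forall t, cone_pr (s (push phi t)) = tau t) -> (forall t, cone_ht (s (push phi t)) = g t) ->
  (forall u, lvl s (phi u) = lift ord0 (lvl tau u)) ->
  theta k tau g B =
  theta _ (link_base s) (link_height s) (trace s (vmap phi @: (@iota_vert k n @: B)))%SET.
Proof.
move=> ct phi_incr taue ge le.
have ex u : exists v, phi u = link_vert s v.
  by apply: link_vert_surj; rewrite le.
have /choice[psi psiE] := ex.
have psi_incr : incr psi.
  by move=> u v; rewrite -(link_incr s) -!psiE phi_incr.
rewrite (ct _ _ psi tau g (link_base s) (link_height s)) //.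
- congr (theta _ _ _ _); rewrite -[LHS](trace_image (s := s)); congr trace.
  rewrite -!imset_comp; apply: eq_imset => -[u|i] //=.
  by rewrite /linkmap /= psiE.
- split=> [t|u]; last by apply: (@lift_inj _ ord0); rewrite -lvl_link -psiE -le.
  rewrite -taue /= push_comp; congr (cone_pr (s _)).
  by apply: eq_push => u; rewrite psiE.
- move=> t; rewrite -ge /= push_comp; congr (cone_ht (s _)).
  by apply: eq_push => u; rewrite psiE.
Qed.

Lemma trace_eq m (s : rsimplex K cX m) B1 B2 :
  away (lvl s) B1 = away (lvl s) B2 -> trace s B1 = trace s B2.
Proof. by move=> h; rewrite -trace_away h trace_away. Qed.

(** The vertices of positive level of a face of s are among those of s, so
    that its link is a face of the link of s. *)
Lemma extend_compatible (theta : hfamily K X R) :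
  hcompatible theta -> compatible (extend theta).
Proof.
move=> ct m s l h; apply/ffunP => b; rewrite !ffunE.
have lvE u : lvl (face s l) u = lvl s (lift l u) by [].
have bE : val (face_cell (lv := lvl s) (l := l) b) = (vmap (lift l) @: val b)%SET.
  by apply: eq_imset; exact: face_vertE.
rewrite bE (factor_vmap lvE) card_imset; last exact: (vmap_inj (incr_lift l)).
case: ifP => // _.
rewrite (@link_eval _ _ s _ (lift l \o link_vert (rface h)) (link_base (rface h))
  (link_height (rface h))) //.
- congr (theta _ _ _ _); apply: trace_eq.
  rewrite -vmap_comp.
  have -> : (vmap (link_vert (rface h)) @: (@iota_vert _ n @: trace (rface h) (val b)) =
             away (lvl (rface h)) (val b))%SET.
    by rewrite away_trace -imset_comp.
  apply/setP => y; rewrite !inE; case: (boolP (blk _ y != ord0)) => y0; rewrite ?andbF // !andbT.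
  apply/imsetP/imsetP => -[x xB yE]; exists x => //; last by move: xB; rewrite inE => /andP[].
  by rewrite inE xB -(blk_vmap lvE) -yE.
- by apply: incr_comp; [exact: incr_lift|exact: link_incr].
- by move=> t /=; rewrite -push_comp face_mapE.
- by move=> t /=; rewrite -push_comp face_mapE.
- by move=> u; rewrite -[RHS]lvl_link.
Qed.

Lemma iota_extend (theta : hfamily K X R) m (tau : rsimplex K X m) (b : cell (lvl tau)) :
  hcompatible theta ->
  iota_family (extend theta) tau b = theta m tau (height1 K m) (val b).
Proof.
move=> ct; rewrite ffunE ffunE /= factor_iota0 cards1 /=.
rewrite [RHS](@link_eval _ _ (iota_simplex tau) _ id) //.
- congr (theta _ _ _ _); apply: trace_eq; rewrite (vmap_id _ (frefl id)).
  apply/setP => y; rewrite !inE; case: (boolP (blk _ y != ord0)) => y0; rewrite ?andbF // !andbT.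
  case: eqP => // e; case/negP: y0; rewrite e; exact/eqP/val_inj.
- by move=> t; rewrite push_id // /iota_simplex /= /iota cone_prE // halfline1_gt0.
- by move=> t; rewrite push_id // /iota_simplex /= /iota cone_htE.
Qed.

End Extension.

(** * Contraction onto the link *)

Section Restriction.
Context (K : realType) (X : filteredSpace) (R : comPzRingType).
Notation n := (fdim X).
Notation cX := (open_cone K X).

(** The pullback of eta under the projection X x ]0,oo[ -> X. *)
Definition hconst (eta : family K X R) : hfamily K X R := fun m tau _ B => coef0 (eta m tau) B.

Lemma hconst_supported eta : hsupported (hconst eta).
Proof. by move=> m tau g B cB; exact: coef0_not. Qed.

Lemma hconst_compatible eta : compatible eta -> hcompatible (hconst eta).
Proof. by move=> ce k m psi tau1 g1 tau g B psi_incr sub _; exact: compatible_subsimplex. Qed.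

Lemma hdelta_const eta m (tau : rsimplex K X m) g B :
  hdelta (hconst eta) tau g B = hconst (delta eta) tau g B.
Proof.
rewrite /hdelta; case: ifPn => cB; last by rewrite /hconst coef0_not.
by rewrite /hconst /delta cobord_dset.
Qed.

(** The restriction of w to X x ]0,oo[.  The first factor of a simplex avoiding
    the apex is the cone on the empty set, whence [iota_set]. *)
Definition hrestrict (w : family K cX R) : hfamily K X R :=
  fun m tau g B => coef0 (w m (cyl_simplex tau g)) (iota_set B).

Lemma hrestrict_supported w : hsupported (hrestrict w).
Proof.
by move=> m tau g B cB; apply: coef0_not; rewrite /= (is_cell_iota (lvl tau)).
Qed.

Lemma vmap_iota_set k m (psi : 'I_k.+1 -> 'I_m.+1) (B : {set bvert k n}) :
  (vmap psi @: iota_set B = iota_set (vmap psi @: B))%SET.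
Proof.
rewrite /iota_set imsetU1 /= -!imset_comp; congr (_ |: _)%SET.
by apply: eq_imset => -[].
Qed.

Lemma hrestrict_compatible w : compatible w -> hcompatible (hrestrict w).
Proof.
move=> cw k m psi tau1 g1 tau g B psi_incr [ef el] ge.
rewrite /hrestrict (@compatible_subsimplex _ _ _ w _ _ psi _ (cyl_simplex tau g)) //.
  by rewrite vmap_iota_set.
split=> [t|u] /=; last by rewrite el.
by rewrite ef; congr cone_pt; apply: val_inj; rewrite /= ge.
Qed.

Lemma hdelta_restrict w m (tau : rsimplex K X m) g B :
  hdelta (hrestrict w) tau g B = hrestrict (delta w) tau g B.
Proof.
have e (v : blowup (lvl (cyl_simplex tau g)) R) C :
  coef0 v (iota_set C) = coef0 (iota_pull (lv := lvl tau) v) C := coef0_iota _ _.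
rewrite /hdelta; case: ifPn => cB; last by rewrite hrestrict_supported.
rewrite /hrestrict e /delta iota_pull_cobord cobord_dset //.
by apply: eq_bigr => x xB; rewrite e.
Qed.

Lemma hrestrict1 w m (tau : rsimplex K X m) B :
  hrestrict w tau (height1 K m) B = coef0 (iota_family w tau) B.
Proof.
rewrite /iota_family -coef0_iota /hrestrict.
rewrite (_ : cyl_simplex tau (height1 K m) = iota_simplex tau) //.
apply: rsimplex_eq => // t /=; rewrite /iota; congr cone_pt.
exact: val_inj.
Qed.

Lemma iota_extend_const eta : compatible eta -> iota_family (extend (hconst eta)) = eta.
Proof.
move=> ce; apply: Defs.familyP => m tau; apply/ffunP => b.
by rewrite (iota_extend _ (hconst_compatible ce)); exact: coef0_cell.
Qed.

(** Extending the restriction of w amounts to moving the first factor of a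
    cell to its virtual apex: the link of s is a face of s, so w can be computed
    on s itself. *)
Lemma coef0_extend_restrict w m (s : rsimplex K cX m) B : compatible w ->
  coef0 (extend (hrestrict w) s) B =
  if #|factor (lvl s) B ord0| == 1%N then coef0 (w m s) (inr ord0 |: away (lvl s) B)%SET else 0.
Proof.
move=> cw; rewrite coef0_extend; last exact: hrestrict_supported.
case: ifP => // _; rewrite /hrestrict.
rewrite (@compatible_subsimplex _ _ _ w _ _ (link_vert s) _ s) //; last first.
- split=> [t|u]; last by rewrite /= -lvl_link.
  by rewrite [in RHS](cone_eta (s _)); congr cone_pt; exact: val_inj.
- exact: link_incr.
by rewrite /iota_set imsetU1 away_trace -imset_comp.
Qed.

End Restriction.

Section Fill.
Context (K : realType) (X : filteredSpace) (R : comPzRingType).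
Notation n := (fdim X).
Notation cX := (open_cone K X).

Notation vx m := (@inr 'I_m.+1 'I_(fdim X).+1 ord0).

(** The contraction of the first factor N^*(c Delta_0) onto the virtual apex
    of the cone c Delta_0. *)
Definition fill (w : family K cX R) : family K cX R := fun m s =>
  [ffun b : cell (lvl s) => if vx m \in val b then 0
     else sgn (lvl s) R (vx m |: val b)%SET (vx m) * coef0 (w m s) (vx m |: val b)%SET].

Lemma coef0_fill w m (s : rsimplex K cX m) B : coef0 (fill w s) B =
  if is_cell (lvl s) B && (vx m \notin B) then
    sgn (lvl s) R (vx m |: B)%SET (vx m) * coef0 (w m s) (vx m |: B)%SET else 0.
Proof.
have [cB|cB] := boolP (is_cell (lvl s) B); last by rewrite coef0_not.
by rewrite /coef0 insubT ffunE /=; case: (_ \in _).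
Qed.

Lemma fill_compatible w : compatible w -> compatible (fill w).
Proof.
move=> cw m s l h; apply/ffunP => b; rewrite !ffunE.
have lvE u : lvl (face s l) u = lvl s (lift l u) by [].
have bE : val (face_cell (lv := lvl s) (l := l) b) = (vmap (lift l) @: val b)%SET.
  by apply: eq_imset; exact: face_vertE.
have vE : (vx m.+1 |: vmap (lift l) @: val b = vmap (lift l) @: (vx m |: val b))%SET.
  by rewrite imsetU1.
have -> : (vx m.+1 \in val (face_cell (lv := lvl s) (l := l) b)) = (vx m \in val b).
  by rewrite bE -[vx m.+1]/(vmap (lift l) (vx m)) mem_imset //; exact: (vmap_inj (incr_lift l)).
case: ifP => // _; rewrite bE vE -[vx m.+1]/(vmap (lift l) (vx m)).
rewrite (sgn_vmap (incr_lift l) lvE); congr (_ * _).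
by rewrite -coef0_face_pull cw.
Qed.

(** When B contains the virtual apex, only the removal of that apex
    contributes, and [fill] is inverse to it; otherwise this is
    [insert_formula]. *)
Lemma delta_fill w : compatible w ->
  delta (fill w) + fill (delta w) = w - extend (hrestrict w).
Proof.
move=> cw; apply/eqP; rewrite eq_sym subr_eq; apply/eqP/esym.
apply: Defs.familyP => m s; apply/ffunP => b.
set B := val b; have cB : is_cell (lvl s) B by exact: valP.
have vx0 : blk (lvl s) (vx m) = ord0 by exact: val_inj.
rewrite -[LHS]coef0_cell -[RHS]coef0_cell -/B.
rewrite (Defs.coef0D (cobord (fill w s) + fill (delta w) s)) Defs.coef0D.
rewrite cobord_dset // coef0_extend_restrict // [coef0 (fill _ s) B]coef0_fill cB.
apply: (canLR (subrK _)).
have [vB|vB] := boolP (vx m \in B).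
  rewrite /= addr0 /dset (big_setD1 (vx m)) //= [X in _ + X]big1 ?addr0; last first.
    by move=> x; rewrite !inE => /andP[xv xB]; rewrite coef0_fill !inE vB eq_sym xv andbF mulr0.
  rewrite coef0_fill setD11 andbT finset.setD1K // cell_setD1 // vx0.
  case: eqP => [/eqP/cards1P[z Bz]|_] /=.
    have [zB z0 _ BE] := split_single Bz.
    have zv : vx m = z.
      have : vx m \in factor (lvl s) B ord0 by rewrite inE vB vx0 eqxx.
      by rewrite Bz inE => /eqP.
    by rewrite mulr0 -[inr ord0]/(vx m) zv -BE subrr.
  by rewrite mulrA sgn_sqr mul1r subr0.
rewrite -(insert_formula _ cB vB vx0); last by move=> C; exact: coef0_not.
rewrite addrC /delta cobord_dset ?cell_setU1 //; congr (_ + _).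
apply: eq_bigr => x xB; rewrite coef0_fill !inE (negPf vB) andbF andbT.
by case: ifP.
Qed.

End Fill.

(** * The cone on a simplex *)

Section Rest.
Context (K : realType) (m : nat).
Local Open Scope classical_set_scope.
Implicit Types u : stdsimplex K m.+1.

Definition cowt u : K := 1 - bary u ord0.

Lemma cowt_sum u : \sum_v bary u (lift ord0 v) = cowt u.
Proof. by rewrite /cowt -(bary_sum u) [in RHS]big_ord_recl [RHS]addrAC subrr add0r. Qed.

Lemma cowt_ge0 u : 0 <= cowt u.
Proof. by rewrite subr_ge0 bary_le1. Qed.

Lemma cowt_le1 u : cowt u <= 1.
Proof. by rewrite gerBl bary_ge0. Qed.

Lemma cowt_continuous : continuous cowt.
Proof.
move=> u; exact: (continuousB (@cst_continuous _ _ (1 : K) u) (@bary_continuous K m.+1 ord0 u)).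
Qed.

Lemma cowt_eq0 u v : cowt u = 0 -> bary u (lift ord0 v) = 0.
Proof.
rewrite -cowt_sum => /eqP; rewrite psumr_eq0; last by move=> i _; exact: bary_ge0.
by move=> /allP/(_ v (mem_index_enum v))/eqP.
Qed.

Definition rest_weight u (v : 'I_m.+1) : K :=
  if cowt u == 0 then (v == ord0)%:R else bary u (lift ord0 v) / cowt u.

Lemma rest_ge0 u v : 0 <= rest_weight u v.
Proof.
by rewrite /rest_weight; case: ifP => _; rewrite ?ler0n // divr_ge0 ?bary_ge0 ?cowt_ge0.
Qed.

Lemma rest_sum1 u : \sum_v rest_weight u v = 1.
Proof.
rewrite /rest_weight; have [u0|u0] := eqVneq (cowt u) 0.
  by rewrite (bigD1 ord0) //= big1 ?addr0 // => v /negPf ->.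
by rewrite -mulr_suml cowt_sum divff.
Qed.

(** The radial projection from the first vertex onto the opposite face; its
    value at the first vertex itself is arbitrary. *)
Definition rest u : stdsimplex K m := mk_simplex (rest_ge0 u) (rest_sum1 u).

Lemma bary_rest u v : cowt u != 0 -> bary (rest u) v = bary u (lift ord0 v) / cowt u.
Proof. by rewrite bary_mk /rest_weight => /negPf ->. Qed.

Lemma rest_cvg u : cowt u != 0 -> rest y @[y --> u] --> rest u.
Proof.
move=> u0; apply: cvg_bary => v; rewrite bary_rest //.
have nz : \forall y \near u, cowt y != 0.
  apply: (@cowt_continuous u [set x | x != 0]).
  apply: open_nbhs_nbhs; split; last exact: u0.
  exact: open_neq.
have eqn : \forall y \near u, bary y (lift ord0 v) / cowt y = bary (rest y) v.
  by apply: (@filterS _ (nbhs u) _ _ _ _ nz) => y y0; rewrite bary_rest.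
apply: cvg_trans (near_eq_cvg eqn) _.
exact: (cvgM (@bary_continuous K m.+1 (lift ord0 v) u) (cvgV u0 (@cowt_continuous u))).
Qed.

End Rest.

Section ConeSimplex.
Context (K : realType) (X : filteredSpace) (m : nat).
Notation cX := (open_cone K X).
Hypothesis cptX : compact [set: X]%classic.
Local Open Scope classical_set_scope.

Section Fsimplex.
Context (s : fsimplex K cX m).
Implicit Types u : stdsimplex K m.+1.

(** With r = cowt u and h the height of s at the projection of u, the fraction
    r h / (1 + (1 - r) h) equals h on the opposite face (r = 1), vanishes only
    if r or h does, and is at most r / (1 - r) whatever h: it tends to 0 at the
    new vertex although h has no limit there. *)
Definition cone_height u : K :=
  cowt u * cone_ht (s (rest u)) / (1 + (1 - cowt u) * cone_ht (s (rest u))).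

Lemma cone_height_den u : 1 <= 1 + (1 - cowt u) * cone_ht (s (rest u)).
Proof. by rewrite lerDl mulr_ge0 ?subr_ge0 ?cowt_le1 ?cone_ht_ge0. Qed.

Lemma cone_height_den_neq0 u : 1 + (1 - cowt u) * cone_ht (s (rest u)) != 0.
Proof. by rewrite gt_eqF // (lt_le_trans ltr01) ?cone_height_den. Qed.

Lemma cone_height_ge0 u : 0 <= cone_height u.
Proof.
rewrite divr_ge0 ?mulr_ge0 ?cowt_ge0 ?cone_ht_ge0 //.
exact: le_trans ler01 (cone_height_den u).
Qed.

Lemma cone_height_eq0 u : (cone_height u == 0) = (cowt u == 0) || (cone_ht (s (rest u)) == 0).
Proof. by rewrite /cone_height mulf_eq0 invr_eq0 (negPf (cone_height_den_neq0 u)) orbF mulf_eq0. Qed.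

(** Bounds the height near the new vertex uniformly in s. *)
Lemma cone_height_le u : cowt u <= 1 / 2 -> cone_height u <= 2 * cowt u.
Proof.
move=> u2; rewrite ler_pdivrMr; last exact: lt_le_trans ltr01 (cone_height_den u).
have := cone_ht_ge0 (s (rest u)); have := cowt_ge0 u; move: u2.
set r := cowt u; set h := cone_ht _ => r2 r0 h0.
have rh : 0 <= r * h * (1 - 2 * r) by apply: mulr_ge0; [exact: mulr_ge0|lra].
rewrite -subr_ge0 [X in 0 <= X](_ : _ = 2 * r + r * h * (1 - 2 * r)); last by ring.
lra.
Qed.

Let cmap u : cX := cone_pt (cone_pr (s (rest u))) (halfline_pt (cone_height_ge0 u)).

Lemma rest_simplex_cvg u : cowt u != 0 -> s (rest y) @[y --> u] --> s (rest u).
Proof.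
move=> u0; apply: (@continuous_comp (stdsimplex K m.+1) (stdsimplex K m) cX (@rest K m) s u).
  exact: rest_cvg.
exact: smap_continuous.
Qed.

Lemma rest_ht_cvg u : cowt u != 0 -> cone_ht (s (rest y)) @[y --> u] --> cone_ht (s (rest u)).
Proof.
move=> u0; apply: (@continuous_comp (stdsimplex K m.+1) cX K (s \o @rest K m) (@cone_ht K X) u).
  exact: rest_simplex_cvg.
exact: cone_ht_continuous.
Qed.

Lemma cone_height_continuous : continuous cone_height.
Proof.
move=> u; have [u0|u0] := eqVneq (cowt u) 0.
  have e : cone_height u = 0 by apply/eqP; rewrite cone_height_eq0 u0 eqxx.
  rewrite /continuous_at e.
  have c2 : 2 * cowt y @[y --> u] --> (0 : K).
    have -> : (0 : K) = 2 * cowt u by rewrite u0 mulr0.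
    exact: (continuousM (@cst_continuous _ _ (2 : K) u) (@cowt_continuous K m u)).
  have nz : \forall y \near u, cowt y <= 1 / 2.
    have : \forall y \near u, cowt y < 1 / 2.
      apply: (@cowt_continuous K m u [set x | x < 1 / 2]).
      apply: open_nbhs_nbhs; split; first exact: open_lt.
      by rewrite /= u0; lra.
    by apply: (@filterS _ (nbhs u)) => y /ltW.
  (* At the new vertex the height of s has no limit, whence the squeeze. *)
  apply: (squeeze_cvgr _ (cvg_cst 0) c2).
  by apply: (@filterS _ (nbhs u) _ _ _ _ nz) => y /cone_height_le h; rewrite cone_height_ge0.
have hc := rest_ht_cvg u0; have wc := @cowt_continuous K m u.
have den : 1 + (1 - cowt y) * cone_ht (s (rest y)) @[y --> u] -->
    1 + (1 - cowt u) * cone_ht (s (rest u)).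
  apply: (continuousD (@cst_continuous _ _ (1 : K) u)).
  by apply: (continuousM _ hc); exact: (continuousB (@cst_continuous _ _ (1 : K) u) wc).
exact: (cvgM (cvgM wc hc) (cvgV (cone_height_den_neq0 u) den)).
Qed.

Lemma cone_map_ht u : cone_ht (cmap u) = cone_height u.
Proof. by rewrite /cmap cone_htE. Qed.

Lemma cone_map_continuous : continuous cmap.
Proof.
move=> u; have [u0|u0] := eqVneq (cone_height u) 0.
  apply: cvg_cone_apex => //; first by rewrite cone_map_ht.
  under eq_fun do rewrite cone_map_ht; rewrite -u0; exact: cone_height_continuous.
have := u0; rewrite cone_height_eq0 negb_or => /andP[c0 h0].
apply: (@cvg_cone_pt K X (stdsimplex K m.+1) (fun u => cone_pr (s (rest u)))
  (fun u => halfline_pt (cone_height_ge0 u))); last exact: cone_height_continuous.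
apply: (@continuous_comp (stdsimplex K m.+1) cX X (s \o @rest K m) (@cone_pr K X) u).
  exact: rest_simplex_cvg.
by apply: cone_pr_cvg; rewrite lt_neqAle eq_sym h0 cone_ht_ge0.
Qed.

Definition cone_lvl (v : 'I_m.+2) : 'I_(fdim cX).+1 :=
  if unlift ord0 v is Some v' then lvl s v' else ord0.

Lemma cone_lvl0 : cone_lvl ord0 = ord0.
Proof. by rewrite /cone_lvl unlift_none. Qed.

Lemma cone_lvlS v : cone_lvl (lift ord0 v) = lvl s v.
Proof. by rewrite /cone_lvl liftK. Qed.

Lemma cone_lvl_mono : {homo cone_lvl : u v / (u <= v)%N}.
Proof.
move=> a b; case: (unliftP ord0 a) => [a'|] ->; case: (unliftP ord0 b) => [b'|] ->;
  rewrite ?cone_lvl0 ?cone_lvlS //.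
by rewrite leq_bump2; exact: lvl_mono.
Qed.

Lemma cone_skelE i (z : cX) :
  skel cX i z <-> (cone_ht z = 0 \/ below (skel X) i (cone_pr z)).
Proof. by rewrite {1}[z]cone_eta /= /cone_skel subconeE. Qed.

Lemma cone_map_skel (i : nat) u : (i <= fdim cX)%N ->
  skel cX i (cmap u) <-> (forall v, val u ord0 v != 0 -> (cone_lvl v <= i)%N).
Proof.
move=> iX; have [u0|u0] := eqVneq (cowt u) 0.
  split=> [_ v|_]; last first.
    by apply/cone_skelE; left; rewrite cone_map_ht; apply/eqP; rewrite cone_height_eq0 u0 eqxx.
  case: (unliftP ord0 v) => [v' ->|->]; last by rewrite cone_lvl0.
  by rewrite -/(bary u (lift ord0 v')) cowt_eq0 ?eqxx.
have -> : skel cX i (cmap u) <-> skel cX i (s (rest u)).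
  rewrite (cone_skelE i (s (rest u))) /cmap /= /cone_skel subconeE /=.
  apply: or_iff_compat_r; split=> /eqP h; apply/eqP; last by rewrite cone_height_eq0 h orbT.
  by move: h; rewrite cone_height_eq0 (negPf u0).
rewrite smap_skel //; split=> h v.
  case: (unliftP ord0 v) => [v' ->|->]; last by rewrite cone_lvl0.
  rewrite cone_lvlS => v0; apply: h; rewrite -/(bary (rest u) v') bary_rest //.
  by rewrite mulf_neq0 ?invr_eq0.
rewrite -/(bary (rest u) v) bary_rest // mulf_eq0 negb_or => /andP[v0 _].
by rewrite -cone_lvlS; exact: h.
Qed.

(** The join of s with a new first vertex placed at the apex of the cone. *)
Definition cone_fsimplex : fsimplex K cX m.+1 :=
  @FSimplex K cX m.+1 cmap cone_lvl cone_map_continuous cone_lvl_mono cone_map_skel.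

End Fsimplex.

Lemma cone_regular (s : rsimplex K cX m) : regular_simplex (cone_fsimplex s).
Proof. by have [v sv] := rsimplexP s; exists (lift ord0 v); rewrite /= cone_lvlS. Qed.

Definition cone_simplex (s : rsimplex K cX m) : rsimplex K cX m.+1 := RSimplex (cone_regular s).

Lemma subsimplex_cone (s : rsimplex K cX m) :
  @subsimplex _ _ m m.+1 (lift ord0) s (cone_simplex s).
Proof.
split=> [t|u]; last by rewrite /= cone_lvlS.
have p0 : bary (push (lift ord0) t) (ord0 : 'I_m.+2) = 0.
  by rewrite bary_push big_pred0 // => v; rewrite eq_sym (negPf (neq_lift _ _)).
have pS v : bary (push (lift ord0) t) (lift ord0 v : 'I_m.+2) = bary t v.
  by rewrite bary_push (big_pred1 v) // => w; rewrite /= (inj_eq lift_inj).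
have c1 : cowt (push (lift ord0) t) = 1 by rewrite /cowt p0 subr0.
have rE : rest (push (lift ord0) t) = t.
  by apply: bary_inj => v; rewrite bary_rest c1 ?oner_eq0 // pS divr1.
rewrite [LHS]cone_eta /=; congr cone_pt; first by rewrite rE.
by apply: val_inj; rewrite /= /cone_height c1 rE subrr mul0r addr0 divr1 mul1r.
Qed.

Lemma cone_apex (s : rsimplex K cX m) : exists u, cone_simplex s u = apex K X.
Proof.
have f0 (v : 'I_m.+2) : 0 <= (v == ord0)%:R :> K by rewrite ler0n.
have f1 : \sum_(v < m.+2) (v == ord0)%:R = 1 :> K.
  by rewrite (bigD1 ord0) //= big1 ?addr0 // => v /negPf ->.
exists (mk_simplex f0 f1); apply/esym/apexE => /=; apply/eqP.
by rewrite cone_height_eq0 /cowt bary_mk eqxx subrr eqxx.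
Qed.

End ConeSimplex.

Lemma cone_simplex_face (K : realType) (X : filteredSpace) (cptX : compact [set: X]%classic) m
    (s : rsimplex K (open_cone K X) m.+1) (l : 'I_m.+2) (h : regular_simplex (face s l)) :
  @subsimplex _ _ m.+1 m.+2 (lift (lift ord0 l)) (cone_simplex cptX (rface h)) (cone_simplex cptX s).
Proof.
have l0 : lift (lift ord0 l : 'I_m.+3) ord0 = ord0 :> 'I_m.+3 by apply: val_inj.
have lS v : lift (lift ord0 l : 'I_m.+3) (lift ord0 v) = lift ord0 (lift l v) :> 'I_m.+3.
  by apply: val_inj; rewrite /= /bump /=; lia.
split=> [t|v]; last first.
  case: (unliftP ord0 v) => [v' ->|->]; first by rewrite lS /= !cone_lvlS.
  by rewrite l0 /= !cone_lvl0.
set t' := push _ t.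
have p0 : bary t' ord0 = bary t ord0.
  rewrite bary_push (big_pred1 ord0) // => v; rewrite /= -[in LHS]l0.
  by rewrite (inj_eq lift_inj).
have cE : cowt t' = cowt t by rewrite /cowt p0.
have [t0|t0] := eqVneq (cowt t) 0.
  apply/cone_pt_eq; right; split; apply/eqP; rewrite /= cone_height_eq0 ?cE t0 eqxx //.
have rE : rest t' = push (lift l) (rest t).
  apply: bary_inj => v; rewrite bary_rest cE // !bary_push mulr_suml.
  rewrite [LHS]big_mkcond big_ord_recl l0 (negPf (neq_lift ord0 v)) [LHS]add0r [RHS]big_mkcond.
  by apply: eq_bigr => w _; rewrite lS (inj_eq lift_inj); case: eqP => // _; rewrite bary_rest.
rewrite /= face_mapE -rE; congr cone_pt; apply: val_inj.
by rewrite /= /cone_height /= face_mapE -rE cE.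
Qed.

Section ConeOperator.
Context (K : realType) (X : filteredSpace) (R : comPzRingType).
Notation n := (fdim X).
Notation cX := (open_cone K X).
Hypothesis cptX : compact [set: X]%classic.

Definition cone_set m (B : {set bvert m n.+1}) : {set bvert m.+1 n.+1} :=
  (vmap (lift ord0) @: B)%SET.

Notation v0 m := (@inl 'I_m.+2 'I_(fdim X).+1 ord0).

(** The analogue of [fill] for the new vertex of the cone on s. *)
Definition cone_op (w : family K cX R) : family K cX R := fun m s =>
  [ffun b : cell (lvl s) =>
     sgn (lvl (cone_simplex cptX s)) R (v0 m |: cone_set (val b))%SET (v0 m) *
     coef0 (w _ (cone_simplex cptX s)) (v0 m |: cone_set (val b))%SET].

Lemma coef0_cone_op w m (s : rsimplex K cX m) B : coef0 (cone_op w s) B =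
  if is_cell (lvl s) B then
    sgn (lvl (cone_simplex cptX s)) R (v0 m |: cone_set B)%SET (v0 m) *
    coef0 (w _ (cone_simplex cptX s)) (v0 m |: cone_set B)%SET else 0.
Proof.
have [cB|cB] := boolP (is_cell (lvl s) B); last by rewrite coef0_not.
by rewrite /coef0 insubT ffunE.
Qed.

Lemma lvl_cone m (s : rsimplex K cX m) u : lvl s u = lvl (cone_simplex cptX s) (lift ord0 u).
Proof. by rewrite /= cone_lvlS. Qed.

Lemma v0_notin m (B : {set bvert m n.+1}) : v0 m \notin cone_set B.
Proof. by apply/imsetP => -[[u|i] _] // []. Qed.

Lemma blk_v0 m (s : rsimplex K cX m) : blk (lvl (cone_simplex cptX s)) (v0 m) = ord0.
Proof. by rewrite /= cone_lvl0. Qed.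

(** [insert_formula] for the new vertex, in the cone on s: the face opposite
    that vertex is s, where w takes the value on b. *)
Lemma delta_cone_op w m (s : rsimplex K cX m) (b : cell (lvl s)) : compatible w ->
  (delta (cone_op w) + cone_op (delta w)) m s b =
  w m s b - (if #|factor (lvl s) (val b) ord0| == 1%N then
     coef0 (w _ (cone_simplex cptX s))
       (v0 m |: away (lvl (cone_simplex cptX s)) (cone_set (val b)))%SET else 0).
Proof.
move=> cw; set B := val b; have cB : is_cell (lvl s) B by exact: valP.
set lv' := lvl (cone_simplex cptX s).
have li := @incr_lift m ord0.
have cB' : is_cell lv' (cone_set B) by rewrite (is_cell_vmap (@lvl_cone m s)).
rewrite -[LHS]/((delta (cone_op w) s + cone_op (delta w) s) b) -coef0_cell Defs.coef0D -/B.
rewrite [w m s b](_ : _ = coef0 (w _ (cone_simplex cptX s)) (cone_set B)); last first.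
  by rewrite -coef0_cell (compatible_subsimplex _ cw li (subsimplex_cone cptX s)).
rewrite (_ : #|factor (lvl s) B ord0| = #|factor lv' (cone_set B) ord0|); last first.
  by rewrite (factor_vmap (@lvl_cone m s)) card_imset //; exact: (vmap_inj li).
rewrite -(insert_formula _ cB' (v0_notin B) (blk_v0 s)); last by move=> C; exact: coef0_not.
rewrite addrC coef0_cone_op cB cobord_dset ?cell_setU1 //; congr (_ + _).
rewrite cobord_dset // /dset big_imset /=; last by move=> ? ? _ _ /(vmap_inj li).
apply: eq_bigr => x xB; rewrite (sgn_vmap li (@lvl_cone m s)) (vmap_setD1 li).
by rewrite (is_cell_vmap (@lvl_cone m s)) coef0_cone_op.
Qed.

Lemma cone_op_compatible w : compatible w -> compatible (cone_op w).
Proof.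
move=> cw m s l h; apply/ffunP => b; rewrite !ffunE.
have bE : val (face_cell (lv := lvl s) (l := l) b) = (vmap (lift l) @: val b)%SET.
  by apply: eq_imset; exact: face_vertE.
have l0 : lift (lift ord0 l : 'I_m.+3) ord0 = ord0 :> 'I_m.+3 by apply: val_inj.
have lS v : lift (lift ord0 l : 'I_m.+3) (lift ord0 v) = lift ord0 (lift l v) :> 'I_m.+3.
  by apply: val_inj; rewrite /= /bump /=; lia.
have li := @incr_lift m.+1 (lift ord0 l).
have sub := cone_simplex_face cptX h.
have E : (v0 m.+1 |: cone_set (vmap (lift l) @: val b) =
  vmap (lift (lift ord0 l)) @: (v0 m |: cone_set (val b)))%SET.
  rewrite imsetU1 /= l0 /cone_set !vmap_comp; congr (_ |: _)%SET.
  by apply: eq_vmap => v /=; rewrite lS.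
rewrite bE E -(compatible_subsimplex _ cw li sub); congr (_ * _).
have -> : v0 m.+1 = vmap (lift (lift ord0 l)) (v0 m) by rewrite /= l0.
by rewrite (sgn_vmap li sub.2).
Qed.

End ConeOperator.

(** * Norms and strata *)

Section Norms.
Context (n : nat).

Lemma coef0_neq0 m (lv : 'I_m.+1 -> 'I_n.+1) (R : comPzRingType) (w : blowup lv R) B :
  coef0 w B != 0 -> exists2 c : cell lv, val c = B & w c != 0.
Proof.
have [cB|cB] := boolP (is_cell lv B); last by rewrite coef0_not ?eqxx.
by exists (Sub B cB) => //; rewrite -coef0_cell.
Qed.

Lemma cnorm_le m1 m2 (lv1 : 'I_m1.+1 -> 'I_n.+1) (lv2 : 'I_m2.+1 -> 'I_n.+1)
    (b1 : cell lv1) (b2 : cell lv2) l :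
  (forall i : 'I_n.+1, (n - l < i)%N -> (fdeg lv1 (val b1) i <= fdeg lv2 (val b2) i)%N) ->
  (forall i : 'I_n, i = (n - l)%N :> nat -> inr i \in val b2 -> inr i \in val b1) ->
  (cnorm l b1 <= cnorm l b2)%O.
Proof.
move=> hd hi; rewrite /cnorm; case: ifPn => [_|b1i]; first exact: leNye.
case: ifPn => [/existsP[i /andP[/eqP il ib]]|_].
  by case/existsP: b1i; exists i; rewrite il eqxx hi.
by rewrite lee_fin lez_nat leq_sum.
Qed.

Lemma cnorm_le_cdeg m (lv : 'I_m.+1 -> 'I_n.+1) (b : cell lv) l :
  (cnorm l b <= ((cdeg b)%:Z)%:E)%O.
Proof.
rewrite /cnorm; case: ifPn => _; first exact: leNye.
by rewrite lee_fin lez_nat /cdeg [leqRHS](bigID (fun i : 'I_n.+1 => (n - l < i)%N)) leq_addr.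
Qed.

End Norms.

Section Strata.
Context (K : realType) (X : filteredSpace).
Notation cX := (open_cone K X).

Lemma stratum_eq (Y : filteredSpace) (S T : stratum Y) :
  stratum_set S = stratum_set T -> stratum_dim S = stratum_dim T -> S = T.
Proof.
case: S T => A i a [B j b] /= AB ij; subst B j.
by rewrite (Prop_irrelevance a b).
Qed.

(** The components of a layer of the cone other than {apex} are products with
    ]0,oo[, by [cyl_component]. *)
Lemma cone_strata (S : stratum cX) :
  S = apex_stratum K X \/ exists T : stratum X, S = cyl_stratum K T.
Proof.
have [z Lz SE] := stratumP S; case iE : (stratum_dim S) => [|i]; rewrite iE in Lz SE.
  left; apply: stratum_eq => //; rewrite SE /=.
  by move: Lz; rewrite cone_layer0 => ->; rewrite connected_component_id //; exact: connected1.
right; move: Lz; rewrite cone_layer; have [x [t zE]] := cone_ptP z.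
rewrite zE => /cylE[t0 Lx].
have TP : exists2 y, layer X i y & connected_component (layer X i) x = connected_component (layer X i) y.
  by exists x.
exists (Stratum TP); apply: stratum_eq => //=.
by rewrite (cyl_component t0 Lx) SE cone_layer zE.
Qed.

Lemma codim_le (Y : filteredSpace) (S : stratum Y) : (codim S <= fdim Y)%N.
Proof. exact: leq_subr. Qed.

Section Meet.
Context (m : nat) (s : rsimplex K cX m) (t : stdsimplex K m).
Hypothesis t_apex : cone_ht (s t) != 0.
Local Open Scope classical_set_scope.

Definition above_apex v := (0 < lvl s v)%N.
Definition link_weight : K := \sum_(v | above_apex v) bary t v.

Lemma link_weight_gt0 : 0 < link_weight.
Proof.
rewrite lt_neqAle eq_sym sumr_ge0 ?andbT => [|v _]; last exact: bary_ge0.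
apply: contra t_apex; rewrite psumr_eq0 => [/allP h|v _]; last exact: bary_ge0.
apply/eqP/apex_simplexP => v tv; apply: val_inj => /=; apply/eqP.
rewrite -leqn0 leqNgt; apply: contra tv => v0.
by have := h v (mem_index_enum v); rewrite /above_apex v0.
Qed.

Definition slide_den (x : K) : K := x ^+ 2 * (1 - link_weight) + link_weight.

Lemma slide_den_gt0 x : 0 < slide_den x.
Proof.
have r1 : link_weight <= 1.
  rewrite -(bary_sum t) [leRHS](bigID above_apex) /= lerDl; apply: sumr_ge0 => v _; exact: bary_ge0.
have r0 := link_weight_gt0; rewrite ltr_wpDl // mulr_ge0 ?sqr_ge0 ?subr_ge0 //.
Qed.

Definition slide_weight (x : K) v : K := (if above_apex v then 1 else x ^+ 2) * bary t v / slide_den x.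

Lemma slide_weight_ge0 x v : 0 <= slide_weight x v.
Proof.
rewrite /slide_weight divr_ge0 ?mulr_ge0 ?bary_ge0 //; last exact/ltW/slide_den_gt0.
by case: ifP => _; rewrite ?ler01 ?sqr_ge0.
Qed.

Lemma slide_weight_sum1 x : \sum_v slide_weight x v = 1.
Proof.
rewrite /slide_weight -mulr_suml (bigID above_apex) /=.
rewrite (eq_bigr (bary t)); last by move=> v ->; rewrite mul1r.
rewrite [X in _ + X](eq_bigr (fun v => x ^+ 2 * bary t v)); last by move=> v /negPf ->.
have rest : \sum_(v | ~~ above_apex v) bary t v = 1 - link_weight.
  by rewrite -(bary_sum t) [in RHS](bigID above_apex) /= -/link_weight addrAC subrr add0r.
by rewrite -mulr_sumr -/link_weight rest [link_weight + _]addrC divff // gt_eqF // slide_den_gt0.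
Qed.

(** Scaling the weights of the vertices of level 0 by x ^+ 2, and normalizing,
    joins t (x = 1) to a point of the link (x = 0); the square keeps the weights
    nonnegative for every real x. *)
Definition slide x : stdsimplex K m := mk_simplex (slide_weight_ge0 x) (slide_weight_sum1 x).

Lemma slide_continuous : continuous slide.
Proof.
move=> x; apply: cvg_bary => v; under eq_fun do rewrite bary_mk; rewrite bary_mk.
have sq : y ^+ 2 @[y --> x] --> x ^+ 2 by exact: exprn_continuous.
have cd : slide_den y @[y --> x] --> slide_den x.
  by apply: cvgD; [apply: cvgM => //; exact: cvg_cst|exact: cvg_cst].
apply: cvgM; last by apply: cvgV => //; rewrite gt_eqF // slide_den_gt0.
apply: cvgM; last exact: cvg_cst.
by case: ifP => _ //; exact: cvg_cst.
Qed.

Lemma slide1 : slide 1 = t.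
Proof.
apply: bary_inj => v; rewrite bary_mk /slide_weight /slide_den expr1n mul1r subrK divr1.
by rewrite if_same mul1r.
Qed.

(** The vertices of level 0 do not matter for membership in a skeleton, and
    the other vertices keep their nonzero weights. *)
Lemma slide_skel x j : (j <= fdim cX)%N -> skel cX j (s (slide x)) <-> skel cX j (s t).
Proof.
move=> jX; rewrite !smap_skel //; split=> h v v0.
  have [v1|v1] := boolP (above_apex v); last by move: v1; rewrite /above_apex -leqNgt leqn0 => /eqP ->.
  apply: h; rewrite -/(bary (slide x) v) bary_mk /slide_weight v1 mul1r mulf_neq0 //.
  by rewrite invr_eq0 gt_eqF // slide_den_gt0.
apply: h; apply: contra v0 => /eqP v0; rewrite -/(bary (slide x) v) bary_mk /slide_weight.
by rewrite [bary t v]v0 mulr0 mul0r.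
Qed.

Lemma slide_link : exists t', slide 0 = push (link_vert s) t'.
Proof.
have r0 := link_weight_gt0.
have f0 u : 0 <= bary t (link_vert s u) / link_weight by rewrite divr_ge0 ?bary_ge0 // ltW.
have sumQ (F : 'I_m.+1 -> K) : \sum_(v | above_apex v) F v = \sum_u F (link_vert s u).
  rewrite (eq_bigl (fun v => v \in [set link_vert s u | u in predT]%SET)); last first.
    move=> v; apply/idP/imsetP => [/link_vert_surj[u ->]|[u _ ->]]; first by exists u.
    exact: link_vert_gt0.
  by rewrite big_imset //= => ? ? _ _ /(incr_inj (link_incr s)).
have f1 : \sum_u bary t (link_vert s u) / link_weight = 1.
  by rewrite -mulr_suml -sumQ divff // gt_eqF.
exists (mk_simplex f0 f1); apply: bary_inj => v; rewrite bary_push bary_mk /slide_weight /slide_den.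
rewrite expr0n /= !mul0r add0r.
case: ifPn => [Qv|Qv].
  have [u uE] := link_vert_surj Qv.
  rewrite (big_pred1 u) ?bary_mk -?uE ?mul1r // => u'.
  by rewrite /= uE (inj_eq (incr_inj (link_incr s))).
rewrite !mul0r big_pred0 // => u; apply: contraNF Qv => /eqP <-; exact: link_vert_gt0.
Qed.

(** A stratum is a connected component of its layer, and the slide from s t
    to the link stays in that layer. *)
Lemma link_meets (T : stratum X) : cyl T (s t) -> exists t', stratum_set T (link_base s t').
Proof.
move=> Tt; have [z Lz SE] := stratumP (cyl_stratum K T); rewrite /= in Lz SE.
set j := (stratum_dim T).+1 in Lz SE; set L := layer cX j in Lz SE.
have Lt : connected_component L z (s t) by rewrite -SE.
have [Lt1 Lt2] := connected_component_sub Lt.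
have jX : (j <= fdim cX)%N.
  rewrite leqNgt; apply/negP => jX; apply: Lt2; rewrite /below /j.
  by rewrite (@skel_top cX) //.
have DL : (s \o slide) @` [set: K] `<=` L.
  move=> _ [x _ <-]; split; first exact/slide_skel.
  by move: Lt2; rewrite /below /j => h /slide_skel h'; apply: h; apply: h'; exact: ltnW.
(* The whole image of the slide is connected, so it stays in the component of s t. *)
have cD : connected ((s \o slide) @` [set: K]).
  apply: connected_continuous_connected; first by apply/connected_intervalP => ? ? _ _ ? _.
  apply: continuous_subspaceT => x; apply: (@continuous_comp K (stdsimplex K m) cX slide s x).
    exact: slide_continuous.
  exact: smap_continuous.
have Dt : ((s \o slide) @` [set: K]) (s t) by exists 1 => //=; rewrite slide1.
have : connected_component L z (s (slide 0)).
  apply: connected_component_trans Lt _; apply: (connected_component_max Dt DL cD).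
  by exists 0.
have [t' tE] := slide_link; rewrite -SE tE [s _]cone_eta => /cylE[_ h].
by exists t'.
Qed.

End Meet.
End Strata.

(** * Degrees and allowability *)

Section Bookkeeping.
Context (K : realType) (X : filteredSpace) (R : comPzRingType).
Notation n := (fdim X).
Notation cX := (open_cone K X).

Implicit Types (theta : hfamily K X R) (w : family K cX R) (eta : family K X R).

Definition hhomogeneous (j : int) (theta : hfamily K X R) :=
  forall m (tau : rsimplex K X m) g (b : cell (lvl tau)), theta m tau g (val b) != 0 ->
    (cdeg b)%:Z = j.

(** Allowability on X x ]0,oo[ for the perversity q of X. *)
Definition hallowable (q : perversity X) (theta : hfamily K X R) :=
  forall T : stratum X, singular_stratum T ->
  forall m (tau : rsimplex K X m) g (b : cell (lvl tau)),
    (exists t, stratum_set T (tau t)) -> theta m tau g (val b) != 0 ->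
    (cnorm (codim T) b <= q T)%O.

Lemma cdeg_setU1 (Y : filteredSpace) m1 m2 (lv1 : 'I_m1.+1 -> 'I_(fdim Y).+1)
    (lv2 : 'I_m2.+1 -> 'I_(fdim Y).+1)
    (b1 : cell lv1) (b2 : cell lv2) (z : bvert m2 (fdim Y)) (f : bvert m1 (fdim Y) -> bvert m2 (fdim Y)) :
  injective f -> z \notin (f @: val b1)%SET -> val b2 = (z |: f @: val b1)%SET ->
  cdeg b2 = (cdeg b1).+1.
Proof.
move=> fi zb b2E; apply/eqP; rewrite -(eqn_add2r (fdim Y).+1) addSn !cdeg_card.
by rewrite b2E cardsU1 zb card_imset.
Qed.

Lemma hconst_homogeneous j eta : homogeneous j eta -> hhomogeneous j (hconst eta).
Proof. by move=> h m tau g b; rewrite /hconst coef0_cell; exact: h. Qed.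

(** [iota_cell] is the identification N^*(c emptyset) = R at the level of
    cells. *)
Lemma hrestrictE (w : family K cX R) m (tau : rsimplex K X m) g (b : cell (lvl tau)) :
  hrestrict w tau g (val b) = w m (cyl_simplex tau g) (iota_cell b).
Proof. by rewrite /hrestrict -[iota_set _]/(val (iota_cell b)) (coef0_cell (lv := lvl (cyl_simplex tau g))). Qed.

Lemma hrestrict_homogeneous j w : homogeneous j w -> hhomogeneous j (hrestrict w).
Proof.
move=> h m tau g b; rewrite hrestrictE -(cdeg_iota b).
exact: (h m (cyl_simplex tau g) (iota_cell b)).
Qed.

Lemma prism_neq0 theta m (tau : rsimplex K X m) g B : prism theta tau g B != 0 ->
  exists2 v, inl v \in B & theta _ (prism_simplex v tau) (prism_height v g) (prism_set v B) != 0.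
Proof.
move=> h; apply: contrapT => nv; case/eqP: h; apply: big1 => v vB.
have [->|tv] := eqVneq (theta _ (prism_simplex v tau) (prism_height v g) (prism_set v B)) 0.
  by rewrite mulr0.
by case: nv; exists v.
Qed.

Lemma prism_homogeneous j theta : hhomogeneous j theta -> hhomogeneous (j - 1) (prism theta).
Proof.
move=> h m tau g b /prism_neq0[v vB tv].
have cp : is_cell (lvl (prism_simplex v tau)) (prism_set v (val b)).
  by rewrite prism_set_cell // (valP b).
have := h _ _ _ (Sub _ cp) tv; rewrite (@cdeg_setU1 X _ _ _ _ b (Sub _ cp) (inl (slot v)) (vmap (lift (slot v)))) //.
- by lia.
- exact: (vmap_inj (incr_lift _)).
- exact: slot_notin.
Qed.

Lemma fdeg_subset m1 m2 k (lv1 : 'I_m1.+1 -> 'I_k.+1) (lv2 : 'I_m2.+1 -> 'I_k.+1)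
    (B : {set bvert m1 k}) (C : {set bvert m2 k})
    (f : bvert m1 k -> bvert m2 k) i :
  injective f -> (forall x, blk lv2 (f x) = blk lv1 x) -> (f @: B \subset C)%SET ->
  (fdeg lv1 B i <= fdeg lv2 C i)%N.
Proof.
move=> fi fb fBC; rewrite /fdeg -!subn1 leq_sub2r // -(card_imset _ fi).
apply/subset_leq_card/fintype.subsetP => y /imsetP[x]; rewrite !inE => /andP[xB xi] ->.
by rewrite fb xi andbT (fintype.subsetP fBC) // imset_f.
Qed.

(** The prism raises the degree of one factor without touching the apexes
    of the blown-up factors, so the norms of the cells can only grow; and the
    homotopy stays inside each stratum. *)
Lemma prism_allowable q theta : hallowable q theta -> hallowable q (prism theta).
Proof.
move=> h T Ts m tau g b [t tT] /prism_neq0[v vB tv].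
have cp : is_cell (lvl (prism_simplex v tau)) (prism_set v (val b)).
  by rewrite prism_set_cell // (valP b).
apply: (@le_trans _ _ (cnorm (codim T) (Sub _ cp : cell (lvl (prism_simplex v tau))))); last first.
  apply: (h T Ts _ (prism_simplex v tau) (prism_height v g) (Sub _ cp)) => //; exists (push (lift (slot v)) t).
  by rewrite /= push_comp push_id // => u /=; rewrite degen_lift.
apply: cnorm_le => i _.
  apply: (@fdeg_subset _ _ _ _ _ _ _ (vmap (lift (slot v)))).
  - exact: (vmap_inj (incr_lift _)).
  - exact: blk_vmap (lvl_prism v tau).
  - exact: finset.subsetUr.
by rewrite !inE /= => /imsetP[[u|i'] // ib [->]].
Qed.

Lemma hconst_allowable q eta : allowable q eta -> hallowable q (hconst eta).
Proof.
move=> /allowableP h T Ts m tau g b Tt; rewrite /hconst coef0_cell.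
exact: h Tt b.
Qed.

Section Perversity.
Context (p : perversity cX).

Lemma cyl_singular (T : stratum X) : singular_stratum T -> singular_stratum (cyl_stratum K T).
Proof. by rewrite /singular_stratum cyl_codim. Qed.

Lemma codim_bounds (T : stratum X) : singular_stratum T -> (0 < codim T <= n)%N.
Proof. by move=> Ts; rewrite lt0n codim_le andbT; exact/eqP. Qed.

Lemma hrestrict_allowable w : allowable p w -> hallowable (induced_perversity p) (hrestrict w).
Proof.
move=> /allowableP h T Ts m tau g b [t tT]; rewrite hrestrictE => wb.
rewrite -(cnorm_iota b) ?codim_bounds // -(cyl_codim K T).
apply: (h (cyl_stratum K T) (cyl_singular Ts) m (cyl_simplex tau g) _ (iota_cell b) wb).
by exists t; apply/cylE; split=> //=; exact: height_gt0.
Qed.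

Lemma trace_cell m (s : rsimplex K cX m) (b : cell (lvl s)) :
  #|factor (lvl s) (val b) ord0| = 1%N ->
  exists b' : cell (lvl (link_base s)), val b' = trace s (val b).
Proof.
move=> b1; have cb : is_cell (lvl (link_base s)) (trace s (val b)).
  by rewrite -is_cell_trace // (valP b).
by exists (Sub _ cb).
Qed.

Lemma extend_neq0 theta m (s : rsimplex K cX m) (b : cell (lvl s)) :
  extend theta s b != 0 -> exists b' : cell (lvl (link_base s)),
    [/\ #|factor (lvl s) (val b) ord0| = 1%N, val b' = trace s (val b) &
        theta _ (link_base s) (link_height s) (val b') != 0].
Proof.
rewrite ffunE; case: ifPn => [/eqP b1|_]; last by rewrite eqxx.
by have [b' b'E] := trace_cell b1; move=> h; exists b'; rewrite b'E.
Qed.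

Lemma extend_homogeneous j theta : hhomogeneous j theta -> homogeneous j (extend theta).
Proof.
move=> h m s b /extend_neq0[b' [b1 b'E /h <-]]; congr (_%:Z).
rewrite /cdeg big_ord_recl {1}/fdeg b1 add0n; apply: eq_bigr => i _.
by rewrite b'E -fdeg_trace.
Qed.

(** For strata off the apex the norm only sees the factors after the first,
    which are those of the link. *)
Lemma extend_cyl_allowable theta : hallowable (induced_perversity p) theta ->
  forall T : stratum X, singular_stratum T -> forall m (s : rsimplex K cX m),
  (exists t, cyl T (s t)) -> forall b, extend theta s b != 0 ->
  (cnorm (codim T) b <= p (cyl_stratum K T))%O.
Proof.
move=> h T Ts m s [t tT] b /extend_neq0[b' [b1 b'E tb]].
have t0 : cone_ht (s t) != 0.
  by move: tT; rewrite [s t]cone_eta => /cylE[/= t0 _]; rewrite cone_htE /= gt_eqF.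
have ln := codim_bounds Ts.
apply: le_trans (h T Ts _ (link_base s) _ b' (link_meets t0 tT) tb).
rewrite -(cnorm_iota b') //.
apply: cnorm_le => i; last first.
  move=> il; rewrite -[val (iota_cell b')]/(iota_set (val b')).
  case: (unliftP ord0 i) il => [i' ->|->] il.
    by rewrite (mem_iota_set (inr i')) b'E inE.
  by move: il ln => /=; lia.
case: (unliftP ord0 i) => [i' ->|->] // _.
by rewrite fdeg_trace -b'E -(fdeg_iota (lvl (link_base s))).
Qed.

(** The norm of a cell is at most its degree, so that in degrees up to the
    perversity of the apex the condition there holds automatically; the other
    strata of the cone are the products of strata of X with ]0,oo[. *)
Lemma allowable_open_cone j (w : family K cX R) :
  homogeneous j w -> (j%:E <= p (apex_stratum K X))%E ->
  (forall T : stratum X, singular_stratum T -> forall m (s : rsimplex K cX m),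
    (exists t, cyl T (s t)) -> forall b, w m s b != 0 ->
    (cnorm (codim T) b <= p (cyl_stratum K T))%O) ->
  allowable p w.
Proof.
move=> hw jp h; apply/allowableP => S Ss m s St b wb.
have [SE|[T SE]] := cone_strata S; subst S.
  by apply: le_trans jp; rewrite -(hw _ _ _ wb); exact: cnorm_le_cdeg.
rewrite cyl_codim; apply: h wb => //.
Qed.

Lemma fill_neq0 w m (s : rsimplex K cX m) (b : cell (lvl s)) : fill w s b != 0 ->
  exists2 c : cell (lvl s), val c = (inr ord0 |: val b)%SET & inr ord0 \notin val b /\ w m s c != 0.
Proof.
rewrite ffunE; case: ifPn => [_|vb]; first by rewrite eqxx.
have [->|wb _] := eqVneq (coef0 (w m s) (inr ord0 |: val b)%SET) 0; first by rewrite mulr0 eqxx.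
by have [c cE wc] := coef0_neq0 wb; exists c.
Qed.

Lemma fill_homogeneous j w : homogeneous j w -> homogeneous (j - 1) (fill w).
Proof.
move=> h m s b /fill_neq0[c cE [vb /h <-]].
rewrite (@cdeg_setU1 cX _ _ _ _ b c (inr ord0) id) ?imset_id //.
by lia.
Qed.

(** The virtual apex of the first factor is only seen by the norm at the apex
    of the cone. *)
Lemma fill_cyl_allowable w : allowable p w ->
  forall T : stratum X, singular_stratum T -> forall m (s : rsimplex K cX m),
  (exists t, cyl T (s t)) -> forall b, fill w s b != 0 ->
  (cnorm (codim T) b <= p (cyl_stratum K T))%O.
Proof.
move=> /allowableP h T Ts m s tT b /fill_neq0[c cE [vb wc]].
have /andP[l0 ln] := codim_bounds Ts.
apply: le_trans (h _ (cyl_singular Ts) m s tT c wc); rewrite cyl_codim.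
apply: cnorm_le => i il.
  by apply: (@fdeg_subset _ _ _ _ _ _ _ id) => //; rewrite imset_id cE finset.subsetUr.
rewrite cE !inE => /orP[/eqP[i0]|//].
by move: il; rewrite i0 /=; lia.
Qed.

Section ConeOp.
Hypothesis cptX : compact [set: X]%classic.

Lemma cone_op_neq0 w m (s : rsimplex K cX m) (b : cell (lvl s)) : cone_op cptX w s b != 0 ->
  exists2 c : cell (lvl (cone_simplex cptX s)),
    val c = (inl ord0 |: cone_set (val b))%SET & w _ (cone_simplex cptX s) c != 0.
Proof.
rewrite ffunE.
have [->|wb _] := eqVneq (coef0 (w _ (cone_simplex cptX s)) (inl ord0 |: cone_set (val b))%SET) 0.
  by rewrite mulr0 eqxx.
exact: coef0_neq0.
Qed.

Lemma cone_op_homogeneous j w : homogeneous j w -> homogeneous (j - 1) (cone_op cptX w).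
Proof.
move=> h m s b /cone_op_neq0[c cE /h <-].
rewrite (@cdeg_setU1 cX _ _ _ _ b c (inl ord0) (vmap (lift ord0))) //.
- by lia.
- exact: (vmap_inj (incr_lift _)).
- exact: v0_notin.
Qed.

(** The cone on s meets every stratum that s meets, and the new vertex has
    level 0, hence belongs to a factor that no norm counts; the norm at the
    apex of the cone depends on the first factor only through its virtual
    apex. *)
Lemma cone_op_allowable w : allowable p w -> allowable p (cone_op cptX w).
Proof.
move=> /allowableP h; apply/allowableP => S Ss m s [t tS] b /cone_op_neq0[c cE wc].
apply: (@le_trans _ _ (cnorm (codim S) c)); last first.
  apply: (h S Ss _ (cone_simplex cptX s)) wc.
  by exists (push (lift ord0) t); rewrite -(subsimplex_cone cptX s).1.
apply: cnorm_le => i il.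
  apply: (@fdeg_subset _ _ _ _ _ _ _ (vmap (lift ord0))).
  - exact: (vmap_inj (incr_lift _)).
  - exact: blk_vmap (lvl_cone cptX s).
  - by rewrite cE finset.subsetUr.
by rewrite cE !inE /= => /imsetP[[u|i'] // ib [->]].
Qed.

(** The correction term of [delta_cone_op] is a value of w on a cell whose first
    factor is the single vertex at the apex of the cone.  All the degree of such
    a cell lies in the other factors, so its norm at the apex is j; as j exceeds
    the perversity there, allowability makes the value zero. *)
Lemma delta_cone_op_cocycle j w : compatible w -> homogeneous j w -> allowable p w ->
  delta w = 0 -> (p (apex_stratum K X) < j%:E)%E -> delta (cone_op cptX w) = w.
Proof.
move=> cw hw /allowableP aw dw pj; apply: Defs.familyP => m s; apply/ffunP => b.
have := delta_cone_op cptX b cw; rewrite dw.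
have -> : cone_op cptX (0 : family K cX R) = 0.
  apply: Defs.familyP => m' s'; apply/ffunP => b'; rewrite !ffunE.
  by rewrite /Defs.coef0; case: insub => [c|]; rewrite ?ffunE mulr0.
rewrite addr0 => ->; case: ifPn => [/cards1P[x bx]|_]; last by rewrite subr0.
rewrite [X in _ - X](_ : _ = 0) ?subr0 //; apply/eqP; apply: contraT => /coef0_neq0[c cE wc].
have Ss : singular_stratum (apex_stratum K X) by rewrite /singular_stratum /codim /= subn0.
have Sc : exists t, stratum_set (apex_stratum K X) (cone_simplex cptX s t).
  by have [u ue] := cone_apex cptX s; exists u.
have := aw _ Ss _ _ Sc c wc; rewrite leNgt => /negP[].
apply: lt_le_trans pj _; rewrite -(hw _ _ _ wc) /codim /= subn0 /cnorm subnn.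
(* This excludes the virtual apex from c, whose degree in the first factor is thus 0. *)
have c0 : factor (lvl (cone_simplex cptX s)) (val c) ord0 = [set inl ord0]%SET.
  rewrite cE; apply/setP => y; rewrite !inE; case: (eqVneq y (inl ord0)) => [->|yv].
    by rewrite (blk_v0 cptX s) eqxx.
  by case: (blk _ y =P ord0); rewrite ?andbF.
case: ifPn => [/existsP[i /andP[/eqP i0 ic]]|_].
  have : inr i \in factor (lvl (cone_simplex cptX s)) (val c) ord0.
    by rewrite inE ic /=; apply/eqP/val_inj.
  by rewrite c0 inE.
rewrite lee_fin lez_nat /cdeg big_ord_recl /= {1}/fdeg c0 cards1 add0n.
rewrite [leqRHS]big_mkcond [leqRHS]big_ord_recl /= add0n; exact: leq_sum.
Qed.

End ConeOp.
End Perversity.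

Lemma eq_extend (t1 t2 : hfamily K X R) :
  (forall m tau g B, t1 m tau g B = t2 m tau g B) -> extend t1 = extend t2.
Proof.
move=> e; apply: Defs.familyP => m s; apply/ffunP => b; rewrite !ffunE.
by case: ifP => // _; exact: e.
Qed.

Lemma extendB (t1 t2 : hfamily K X R) :
  extend (fun m tau g B => t1 m tau g B - t2 m tau g B) = extend t1 - extend t2.
Proof.
apply: Defs.familyP => m s; apply/ffunP => b.
rewrite -[RHS]/((extend t1 s + - extend t2 s) b) !ffunE.
by case: ifP => _; rewrite ?subr0.
Qed.

Lemma extend0 : extend (hconst (0 : family K X R)) = 0.
Proof.
apply: Defs.familyP => m s; apply/ffunP => b; rewrite !ffunE /hconst.
by rewrite /Defs.coef0; case: insub => [c|]; rewrite ?ffunE if_same.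
Qed.

Lemma delta_extend_const eta : delta (extend (hconst eta)) = extend (hconst (delta eta)).
Proof.
rewrite delta_extend; last exact: hconst_supported.
by apply: eq_extend => m tau g B; exact: hdelta_const.
Qed.

(** Contract the first factor to its virtual apex, then move the link to
    height 1. *)
Definition retraction_homotopy (w : family K cX R) : family K cX R :=
  fill w + extend (prism (hrestrict w)).

Lemma delta_retraction_homotopy w : compatible w -> delta w = 0 ->
  delta (retraction_homotopy w) = w - extend (hconst (iota_family w)).
Proof.
move=> cw dw; rewrite /retraction_homotopy linearD /=.
have -> : delta (fill w) = w - extend (hrestrict w).
  rewrite -delta_fill // dw (_ : fill 0 = 0) ?addr0 //.
  apply: Defs.familyP => m s; apply/ffunP => b; rewrite !ffunE.
  by rewrite /Defs.coef0; case: insub => [c|]; rewrite ?ffunE mulr0 if_same.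
rewrite delta_extend; last exact/prism_supported/hrestrict_supported.
rewrite (@eq_extend (hdelta (prism (hrestrict w))) (fun m tau g B => hrestrict w tau g B - hconst (iota_family w) tau g B)).
  by rewrite extendB addrA subrK.
move=> m tau g B; rewrite /hconst -(hrestrict1 w tau).
have [cB|cB] := boolP (is_cell (lvl tau) B); last first.
  by rewrite /hdelta (negPf cB) !hrestrict_supported // subrr.
rewrite -(prism_formula (hrestrict_compatible cw)) //.
rewrite [X in _ = _ + X](_ : _ = 0) ?addr0 //; apply: big1 => v vB.
rewrite hdelta_restrict dw /hrestrict /Defs.coef0.
by case: insub => [c|]; rewrite ?ffunE mulr0.
Qed.

End Bookkeeping.

(** * The cone formula *)

Section ConeFormula.
Context (K : realType) (X : filteredSpace) (R : comPzRingType).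
Notation cX := (open_cone K X).
Context (p : perversity cX) (k : int).
Notation q := (induced_perversity p).

Lemma compatibleD (w1 w2 : family K cX R) : compatible w1 -> compatible w2 -> compatible (w1 + w2).
Proof.
move=> c1 c2 m s l h; rewrite -[RHS]/(w1 m (rface h) + w2 m (rface h)) -c1 -c2.
by apply/ffunP => b; rewrite !ffunE.
Qed.

Lemma homogeneousD j (w1 w2 : family K cX R) :
  homogeneous j w1 -> homogeneous j w2 -> homogeneous j (w1 + w2).
Proof.
move=> h1 h2 m s b; rewrite -[w1 in X in X -> _]scale1r => /blowup_lin_neq0[].
  exact: h1.
exact: h2.
Qed.

Lemma allowableD (w1 w2 : family K cX R) : allowable p w1 -> allowable p w2 -> allowable p (w1 + w2).
Proof. by move=> a1 a2; rewrite -[w1]scale1r; exact: allowable_lin. Qed.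

(** In the top degree, where j is the perversity of the apex, the coboundary of
    the extension has too high a degree for this lemma: it is allowable for
    cocycles eta, being zero. *)
Lemma extend_const_allowable j (eta : family K X R) :
  homogeneous j eta -> allowable q eta -> (j%:E <= p (apex_stratum K X))%E ->
  allowable p (extend (hconst eta)).
Proof.
move=> he ae jp.
apply: (@allowable_open_cone _ _ _ p j) => //.
  exact/extend_homogeneous/hconst_homogeneous.
exact/extend_cyl_allowable/hconst_allowable.
Qed.

Section LowDegree.
Hypothesis kp : (k%:E <= p (apex_stratum K X))%E.

Lemma pred_le_apex : ((k - 1)%:E <= p (apex_stratum K X))%E.
Proof. by apply: le_trans kp; rewrite lee_fin; lia. Qed.

Lemma iota_star_surjective c : exists b, iota_star R p k b = c.
Proof.
rewrite -[c]quotmod_reprK; set z := quotmod_repr c.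
have /asboolP[[ce he ae _] dz] := cocycleP z.
have dE : delta (extend (hconst (cocycle_val z))) = 0.
  by rewrite delta_extend_const dz extend0.
have zP : extend (hconst (cocycle_val z)) \in is_cocycle p k.
  apply/asboolP; split=> //; split.
  - exact/extend_compatible/hconst_compatible.
  - exact/extend_homogeneous/hconst_homogeneous.
  - exact: extend_const_allowable he ae kp.
  - by rewrite dE; have [] := @bcochain0 K cX R p k.
exists (quotmod_pi _ (Cocycle zP)).
rewrite /iota_star /= /iota_star_fun quotmod_mapE; last exact: iota_coboundary.
congr quotmod_pi; apply: val_inj; exact: iota_extend_const.
Qed.

Lemma retraction_homotopy_bcochain (w : family K cX R) : bcochain p k w -> delta w = 0 ->
  [/\ compatible (retraction_homotopy w), homogeneous (k - 1) (retraction_homotopy w) &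
      allowable p (retraction_homotopy w)].
Proof.
move=> [cw hw aw _] dw.
have hh : homogeneous (k - 1) (extend (prism (hrestrict w))).
  exact/extend_homogeneous/prism_homogeneous/hrestrict_homogeneous.
split.
- apply: compatibleD; first exact: fill_compatible.
  exact/extend_compatible/prism_compatible/hrestrict_compatible.
- by apply: homogeneousD => //; exact: fill_homogeneous.
- apply: allowableD.
    apply: (allowable_open_cone (fill_homogeneous hw) pred_le_apex).
    exact: fill_cyl_allowable.
  apply: (allowable_open_cone hh pred_le_apex); apply: extend_cyl_allowable.
  exact/prism_allowable/hrestrict_allowable.
Qed.

Lemma iota_star_injective : injective (iota_star R p k).
Proof.
apply: raddf_inj => c; rewrite -[c]quotmod_reprK; set z := quotmod_repr c.
have /asboolP[bz dz] := cocycleP z; have [cz hz az _] := bz.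
rewrite /iota_star /= /iota_star_fun quotmod_mapE; last exact: iota_coboundary.
rewrite -[RHS](linear0 (quotmod_pi (is_coboundary q k))).
move=> /quotmod_piP; rewrite subr0 => /asboolP[eta [ce he ae _] /= de].
rewrite -[RHS](linear0 (quotmod_pi (is_coboundary p k))).
apply/quotmod_piP; rewrite subr0; apply/asboolP.
have [ch hh ah] := retraction_homotopy_bcochain bz dz.
have dE : delta (extend (hconst eta) + retraction_homotopy (cocycle_val z)) = cocycle_val z.
  by rewrite linearD /= delta_extend_const de delta_retraction_homotopy // addrC subrK.
exists (extend (hconst eta) + retraction_homotopy (cocycle_val z)) => //; split.
- apply: compatibleD => //; exact/extend_compatible/hconst_compatible.
- apply: homogeneousD => //; exact/extend_homogeneous/hconst_homogeneous.
- by apply: allowableD => //; exact: extend_const_allowable he ae pred_le_apex.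
- by rewrite dE.
Qed.

End LowDegree.

Lemma cone_vanishing : compact [set: X]%classic -> (p (apex_stratum K X) < k%:E)%E ->
  forall c : blowup_cohomology K R p k, c = 0.
Proof.
move=> cptX kp c; rewrite -[c]quotmod_reprK; set z := quotmod_repr c.
have /asboolP[[cz hz az _] dz] := cocycleP z.
rewrite -[RHS](linear0 (quotmod_pi (is_coboundary p k))).
apply/quotmod_piP; rewrite subr0; apply/asboolP.
have dE := delta_cone_op_cocycle cptX cz hz az dz kp.
exists (cone_op cptX (cocycle_val z)) => //; split.
- exact: cone_op_compatible.
- exact: cone_op_homogeneous.
- exact: cone_op_allowable.
- by rewrite dE.
Qed.

End ConeFormula.

Theorem theorem5 (K : realType) (X : filteredSpace) (R : comPzRingType)
    (p : perversity (open_cone K X)) (hX : compact [set: X]%classic) :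
  (forall k : int, (k%:E <= p (apex_stratum K X))%E ->
     bijective (iota_star R p k)) /\
  (forall k : int, (p (apex_stratum K X) < k%:E)%E ->
     forall c : blowup_cohomology K R p k, c = 0%R).
Proof.
split=> k kp; last exact: cone_vanishing.
have [g gK] := choice (@iota_star_surjective K X R p k kp).
by exists g => // c; apply: (iota_star_injective kp); rewrite gK.
Qed.
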